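(* Let $R$ and $S$ be arbitrary rings and let ${}_RC_S$ be a semidualizing $(R,S)$-bimodule. Let $\mathcal{A}_C(R^{op})\subseteq \operatorname{Mod} R^{op}$ be the Auslander class and $\mathcal{B}_C(R)\subseteq\operatorname{Mod} R$ the Bass class with respect to $C$. Then: (1) Both pairs $(\mathcal{A}_C(R^{op}),\mathcal{B}_C(R))$ and $(\mathcal{B}_C(R),\mathcal{A}_C(R^{op}))$ are coproduct-closed and product-closed duality pairs; furthermore, the duality pair $(\mathcal{A}_C(R^{op}),\mathcal{B}_C(R))$ is perfect. (2) $\mathcal{A}_C(R^{op})$ is covering and preenveloping in $\operatorname{Mod} R^{op}$, and $\mathcal{B}_C(R)$ is covering and preenveloping in $\operatorname{Mod} R$.
   Context: All rings are associative with identity. For a ring $T$, $\operatorname{Mod} T$ is the category of left $T$-modules, and $\operatorname{Mod} T^{op}$ is identified with the category of right $T$-modules. All subcategories are full and closed under isomorphisms. Semidualizing: an $(R,S)$-bimodule ${}_RC_S$ is semidualizing if (a1) ${}_RC$ has a projective resolution by finitely generated projective left $R$-modules; (a2) $C_S$ has a projective resolution by finitely generated projective right $S$-modules; (b1) the homothety map $R\to\operatorname{Hom}_{S^{op}}(C,C)$ is an isomorphism; (b2) the homothety map $S\to\operatorname{Hom}_R(C,C)$ is an isomorphism; (c1) $\operatorname{Ext}_R^{i}(C,C)=0$ for all $i\ge1$; (c2) $\operatorname{Ext}_{S^{op}}^{i}(C,C)=0$ for all $i\geq 1$. Auslander class $\mathcal{A}_C(R^{op})$: all $N\in\operatorname{Mod}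 R^{op}$ such that $\operatorname{Tor}^R_i(N,C)=0$ for all $i\ge1$; $\operatorname{Ext}^i_{S^{op}}(C,N\otimes_RC)=0$ for all $i\ge 1$; and the map $\mu_N:N\to\operatorname{Hom}_{S^{op}}(C,N\otimes_RC)$, $\mu_N(x)(c)=x\otimes c$, is an isomorphism. Bass class $\mathcal{B}_C(R)$: all $M\in\operatorname{Mod} R$ such that $\operatorname{Ext}_R^i(C,M)=0$ for all $i\ge1$; $\operatorname{Tor}^S_i(C,\operatorname{Hom}_R(C,M))=0$ for all $i\ge1$; and the map $\theta_M:C\otimes_S\operatorname{Hom}_R(C,M)\to M$, $\theta_M(c\otimes f)=f(c)$, is an isomorphism. Duality pairs: for a ring $T$ and a left or right $T$-module $X$ write $X^+=\operatorname{Hom}_{\mathbb{Z}}(X,\mathbb{Q}/\mathbb{Z})$, a $T$-module on the opposite side. Given subcategories $\mathscr{X}\subseteq\operatorname{Mod} T$ and $\mathscr{Y}\subseteq\operatorname{Mod} T^{op}$, the pair $(\mathscr{X},\mathscr{Y})$ is a duality pair if (i) for every $X\in\operatorname{Mod} T$, $X\in\mathscr{X}$ if and only if $X^+\in\mathscr{Y}$; and (ii) $\mathscr{Y}$ is closed under direct summands and finite direct sums. It is coproduct-closed (resp. product-closed) if $\mathscr{X}$ is closed under coproducts (resp. products). It is perfect if it is coproduct-closed, the regular module ${}_TT$ lies in $\mathscr{X}$, and $\mathscr{X}$ is closed under extensions. (For the pair $(\mathcal{A}_C(R^{op}),\mathcal{B}_C(R))$ take $T=R^{op}$; for $(\mathcal{B}_C(R),\mathcal{A}_C(R^{op}))$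 take $T=R$.) Covers and envelopes: let $\mathscr{X}\subseteq\operatorname{Mod} T$. A homomorphism $f:X\to Y$ with $X\in\mathscr{X}$ is an $\mathscr{X}$-precover of $Y$ if $\operatorname{Hom}_T(X',f)$ is surjective for every $X'\in\mathscr{X}$; it is an $\mathscr{X}$-cover if in addition every endomorphism $h$ of $X$ with $f=fh$ is an automorphism. $\mathscr{X}$ is covering in $\operatorname{Mod} T$ if every $T$-module has an $\mathscr{X}$-cover. Dually, a homomorphism $f:Y\to X$ with $X\in\mathscr{X}$ is an $\mathscr{X}$-preenvelope of $Y$ if $\operatorname{Hom}_T(f,X')$ is surjective for every $X'\in\mathscr{X}$; $\mathscr{X}$ is preenveloping in $\operatorname{Mod} T$ if every $T$-module has an $\mathscr{X}$-preenvelope. *)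

(* Defs.v *)
From HB Require Import structures.
From mathcomp Require Import all_boot all_algebra.
From mathcomp Require Import all_classical.

Set Implicit Arguments.
Unset Strict Implicit.
Unset Printing Implicit Defensive.
Import GRing.Theory.
Local Open Scope ring_scope.

(** Conventions.  [lmodType T] is Mod T; right [T]-modules are objects of
    [lmodType T^c], so that [x t] is written [(t : T^c) *: x].  Rings are of
    type [pzRingType]: the zero ring is allowed.  A homomorphism is an
    isomorphism when its underlying function is [bijective]. *)

Section LinearZmod.
Variables (T : pzRingType) (U V : lmodType T).
Implicit Types f g h : {linear U -> V}.

HB.instance Definition _ := gen_eqMixin {linear U -> V}.
HB.instance Definition _ := gen_choiceMixin {linear U -> V}.

Lemma linear_ext f g : f =1 g -> f = g.
Proof.
move=> /funext; case: f g => [f [[a1] [a2] ]] [g [[b1] [b2] ]] /= e.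
case: _ / e in b1 b2 *.
by rewrite (Prop_irrelevance b1 a1) (Prop_irrelevance b2 a2).
Qed.

Definition linear_zero : {linear U -> V} := \0.
Definition linear_add f g : {linear U -> V} := f \+ g.
Definition linear_opp f : {linear U -> V} := \- f.

Fact linear_addA : associative linear_add.
Proof. by move=> f g h; apply: linear_ext => x /=; rewrite addrA. Qed.
Fact linear_addC : commutative linear_add.
Proof. by move=> f g; apply: linear_ext => x /=; rewrite addrC. Qed.
Fact linear_add0 : left_id linear_zero linear_add.
Proof. by move=> f; apply: linear_ext => x /=; rewrite add0r. Qed.
Fact linear_addN : left_inverse linear_zero linear_opp linear_add.
Proof. by move=> f; apply: linear_ext => x /=; rewrite addNr. Qed.

HB.instance Definition _ := GRing.isZmodule.Build {linear U -> V}
  linear_addA linear_addC linear_add0 linear_addN.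
End LinearZmod.

Section AdditiveZmod.
Variables (U V : zmodType).
Implicit Types f g h : {additive U -> V}.

HB.instance Definition _ := gen_eqMixin {additive U -> V}.
HB.instance Definition _ := gen_choiceMixin {additive U -> V}.

Lemma additive_ext f g : f =1 g -> f = g.
Proof.
move=> /funext; case: f g => [f [[a1]]] [g [[b1]]] /= e.
by case: _ / e in b1 *; rewrite (Prop_irrelevance b1 a1).
Qed.

Definition additive_zero : {additive U -> V} := \0.
Definition additive_add f g : {additive U -> V} := f \+ g.
Definition additive_opp f : {additive U -> V} := \- f.

Fact additive_addA : associative additive_add.
Proof. by move=> f g h; apply: additive_ext => x /=; rewrite addrA. Qed.
Fact additive_addC : commutative additive_add.
Proof. by move=> f g; apply: additive_ext => x /=; rewrite addrC. Qed.
Fact additive_add0 : left_id additive_zero additive_add.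
Proof. by move=> f; apply: additive_ext => x /=; rewrite add0r. Qed.
Fact additive_addN : left_inverse additive_zero additive_opp additive_add.
Proof. by move=> f; apply: additive_ext => x /=; rewrite addNr. Qed.

HB.instance Definition _ := GRing.isZmodule.Build {additive U -> V}
  additive_addA additive_addC additive_add0 additive_addN.
End AdditiveZmod.

(** [Num.int_num_subdef] is the boolean predicate underlying [Num.int]. *)
Definition QmodZ : zmodType := Quotient.quot (Num.int_num_subdef : {pred rat}).

Definition lchar_sort (T : pzRingType) (X : lmodType T) : Type :=
  {additive X -> QmodZ}.
Definition rchar_sort (T : pzRingType) (X : lmodType T^c) : Type :=
  {additive X -> QmodZ}.

Section LeftCharacter.
Variables (T : pzRingType) (X : lmodType T).
HB.instance Definition _ := GRing.Zmodule.on (lchar_sort X).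

Definition lchar_scale (t : T^c) (f : lchar_sort X) : lchar_sort X :=
  (f : {additive X -> QmodZ}) \o ( *:%R (t : T)).

Fact lchar_scaleA (a b : T^c) (f : lchar_sort X) :
  lchar_scale a (lchar_scale b f) = lchar_scale (a * b) f.
Proof. by apply: additive_ext => x /=; rewrite scalerA. Qed.
Fact lchar_scale1 : left_id 1 lchar_scale.
Proof. by move=> f; apply: additive_ext => x /=; rewrite scale1r. Qed.
Fact lchar_scaleDr : right_distributive lchar_scale +%R.
Proof. by move=> a f g; apply: additive_ext. Qed.
Fact lchar_scaleDl f : {morph lchar_scale^~ f : a b / a + b}.
Proof. by move=> a b; apply: additive_ext => x /=; rewrite scalerDl raddfD. Qed.

HB.instance Definition _ := GRing.Zmodule_isLmodule.Build T^c (lchar_sort X)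
  lchar_scaleA lchar_scale1 lchar_scaleDr lchar_scaleDl.
Definition lchar : lmodType T^c := lchar_sort X.
End LeftCharacter.

Section RightCharacter.
Variables (T : pzRingType) (X : lmodType T^c).
HB.instance Definition _ := GRing.Zmodule.on (rchar_sort X).

Definition rchar_scale (t : T) (f : rchar_sort X) : rchar_sort X :=
  (f : {additive X -> QmodZ}) \o ( *:%R (t : T^c)).

Fact rchar_scaleA (a b : T) (f : rchar_sort X) :
  rchar_scale a (rchar_scale b f) = rchar_scale (a * b) f.
Proof. by apply: additive_ext => x /=; rewrite scalerA. Qed.
Fact rchar_scale1 : left_id 1 rchar_scale.
Proof. by move=> f; apply: additive_ext => x /=; rewrite scale1r. Qed.
Fact rchar_scaleDr : right_distributive rchar_scale +%R.
Proof. by move=> a f g; apply: additive_ext. Qed.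
Fact rchar_scaleDl f : {morph rchar_scale^~ f : a b / a + b}.
Proof.
by move=> a b; apply: additive_ext => x /=; rewrite [_ *: x]scalerDl raddfD.
Qed.

HB.instance Definition _ := GRing.Zmodule_isLmodule.Build T (rchar_sort X)
  rchar_scaleA rchar_scale1 rchar_scaleDr rchar_scaleDl.
Definition rchar : lmodType T := rchar_sort X.
End RightCharacter.

Definition dprod_mod (T : pzRingType) (I : Type) (M : I -> lmodType T) : Type :=
  forall i, M i.

Section Product.
Variables (T : pzRingType) (I : Type) (M : I -> lmodType T).
Implicit Types x y z : dprod_mod M.

HB.instance Definition _ := gen_eqMixin (dprod_mod M).
HB.instance Definition _ := gen_choiceMixin (dprod_mod M).

Definition dprod_zero : dprod_mod M := fun i => 0.
Definition dprod_add x y : dprod_mod M := fun i => x i + y i.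
Definition dprod_opp x : dprod_mod M := fun i => - x i.
Definition dprod_scale (t : T) x : dprod_mod M := fun i => t *: x i.

Fact dprod_addA : associative dprod_add.
Proof. by move=> x y z; apply: functional_extensionality_dep => i; exact: addrA. Qed.
Fact dprod_addC : commutative dprod_add.
Proof. by move=> x y; apply: functional_extensionality_dep => i; exact: addrC. Qed.
Fact dprod_add0 : left_id dprod_zero dprod_add.
Proof. by move=> x; apply: functional_extensionality_dep => i; exact: add0r. Qed.
Fact dprod_addN : left_inverse dprod_zero dprod_opp dprod_add.
Proof. by move=> x; apply: functional_extensionality_dep => i; exact: addNr. Qed.

HB.instance Definition _ := GRing.isZmodule.Build (dprod_mod M)
  dprod_addA dprod_addC dprod_add0 dprod_addN.

Fact dprod_scaleA a b x : dprod_scale a (dprod_scale b x) = dprod_scale (a * b) x.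
Proof. by apply: functional_extensionality_dep => i; exact: scalerA. Qed.
Fact dprod_scale1 : left_id 1 dprod_scale.
Proof. by move=> x; apply: functional_extensionality_dep => i; exact: scale1r. Qed.
Fact dprod_scaleDr : right_distributive dprod_scale +%R.
Proof. by move=> a x y; apply: functional_extensionality_dep => i; exact: scalerDr. Qed.
Fact dprod_scaleDl x : {morph dprod_scale^~ x : a b / a + b}.
Proof. by move=> a b; apply: functional_extensionality_dep => i; exact: scalerDl. Qed.

HB.instance Definition _ := GRing.Zmodule_isLmodule.Build T (dprod_mod M)
  dprod_scaleA dprod_scale1 dprod_scaleDr dprod_scaleDl.

Definition finite_support : {pred dprod_mod M} :=
  fun x => `[< finite_set [set i | x i <> 0] >].

Fact finite_support_submod_closed : submod_closed finite_support.
Proof.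
split=> [|a x y /asboolP fx /asboolP fy]; apply/asboolP.
  by rewrite (_ : mkset _ = set0)//; apply/seteqP; split => i /=.
apply: (@sub_finite_set _ _ ([set i | x i <> 0] `|` [set i | y i <> 0])%classic).
  move=> i /= nz; have [x0|] := pselect (x i = 0); last by left.
  right => y0; apply: nz.
  by rewrite /GRing.add/= /dprod_add /GRing.scale/= /dprod_scale x0 y0 scaler0 addr0.
by rewrite finite_setU.
Qed.
HB.instance Definition _ :=
  GRing.isSubmodClosed.Build T (dprod_mod M) finite_support
    finite_support_submod_closed.

Definition dsum_mod : Type := {x : dprod_mod M | finite_support x}.
HB.instance Definition _ := SubChoice.on dsum_mod.
HB.instance Definition _ := [SubChoice_isSubLmodule of dsum_mod by <:].
End Product.

Section Free.
Variables (T : pzRingType) (X : choiceType).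

Definition free_mod : lmodType T := dsum_mod (fun _ : X => T^o).

Definition free_gen_fun (x : X) : dprod_mod (fun _ : X => T^o) :=
  fun y => if y == x then 1 else 0.
Fact free_gen_finite x : finite_support (free_gen_fun x).
Proof.
apply/asboolP; apply: (@sub_finite_set _ _ [set x]%classic) => [y /=|].
  by rewrite /free_gen_fun; case: eqP.
exact: finite_set1.
Qed.
Definition free_gen (x : X) : free_mod :=
  (Sub (free_gen_fun x) (free_gen_finite x) : dsum_mod _).

Definition coef (f : free_mod) (x : X) : T := (val f : dprod_mod _) x.

Lemma coef_finite f : finite_set [set x | coef f x <> 0].
Proof. exact: asboolW (valP f). Qed.

Lemma coefD f h x : coef (f + h) x = coef f x + coef h x.
Proof. by []. Qed.
Lemma coefZ a f x : coef (a *: f) x = a * coef f x.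
Proof. by []. Qed.

Lemma coef_sum I (s : seq I) (F : I -> free_mod) x :
  coef (\sum_(i <- s) F i) x = \sum_(i <- s) coef (F i) x.
Proof. by elim: s => [|i s IH]; rewrite ?big_nil// !big_cons coefD IH. Qed.

Lemma coef_gen x y : coef (free_gen x) y = if y == x then 1 else 0.
Proof. by []. Qed.

Lemma coef_ext f h : coef f =1 coef h -> f = h.
Proof. by move=> fh; apply/val_inj/functional_extensionality_dep. Qed.

Variables (V : lmodType T) (g : X -> V).

(** The linear map extending [g]; the sum is over the support of [f]. *)
Definition free_lift (f : free_mod) : V := \sum_(x \in [set: X]) coef f x *: g x.

Lemma free_liftE (A : set X) (f : free_mod) :
  ([set x | coef f x <> 0] `<=` A)%classic ->
  free_lift f = \sum_(x \in A) coef f x *: g x.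
Proof.
move=> sA; apply/esym/fsbig_widen => // x [_ /= nA].
by have [->|/sA//] := pselect (coef f x = 0); rewrite scale0r.
Qed.

Fact free_lift_linear : linear free_lift.
Proof.
move=> a f h.
set A := ([set x | coef f x <> 0] `|` [set x | coef h x <> 0])%classic.
have fA : finite_set A by rewrite finite_setU; split; exact: coef_finite.
rewrite (@free_liftE A f); last by move=> x; left.
rewrite (@free_liftE A h); last by move=> x; right.
rewrite (@free_liftE A) => [|x /= nz].
  rewrite !fsbig_finite//= scaler_sumr -big_split/=; apply: eq_bigr => x _.
  by rewrite scalerA -scalerDl.
have [x0|] := pselect (coef f x = 0); last by left.
by right => y0; apply: nz; rewrite coefD coefZ x0 y0 mulr0 addr0.
Qed.
HB.instance Definition _ :=
  GRing.isLinear.Build T free_mod V *:%R free_lift free_lift_linear.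

Lemma free_lift_gen x : free_lift (free_gen x) = g x.
Proof.
rewrite (@free_liftE [set x]%classic) ?fsbig_set1 ?coef_gen ?eqxx ?scale1r//.
by move=> y /=; rewrite coef_gen; case: eqP.
Qed.
End Free.

Lemma free_lift_id (T : pzRingType) (X : choiceType) (f : free_mod T X) :
  free_lift (@free_gen T X) f = f.
Proof.
have ff := coef_finite f.
rewrite (@free_liftE _ _ _ _ _ f (fun x => id))// fsbig_finite//=.
apply: coef_ext => y; rewrite coef_sum.
under eq_bigr do rewrite coefZ coef_gen.
have [y0|/eqP ny0] := eqVneq (coef f y) 0.
  rewrite y0 big1// => x _; case: eqP => [<-|_]; last by rewrite mulr0.
  by rewrite y0 mul0r.
rewrite (bigD1_seq y) ?fset_uniq//=; last by rewrite in_fset_set// inE.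
rewrite eqxx mulr1 big1 ?addr0// => x /negPf.
by rewrite eq_sym => ->; rewrite mulr0.
Qed.

Lemma free_ext (T : pzRingType) (X : choiceType) (V : lmodType T)
  (f g : {linear free_mod T X -> V}) :
  (forall x, f (free_gen T x) = g (free_gen T x)) -> f =1 g.
Proof.
move=> fg y; rewrite -(free_lift_id y).
have ff := coef_finite y.
rewrite (@free_liftE _ _ _ _ _ y (fun x => id))// fsbig_finite//= !linear_sum.
by apply: eq_bigr => x _; rewrite !linearZZ fg.
Qed.

(** [tensor N M] is the free abelian group on [N * M] modulo the smallest
    subgroup containing the relators. *)
Section Tensor.
Variables (T : pzRingType) (N : lmodType T^c) (M : lmodType T).

Local Notation F := (free_mod int (N * M)%type).
Local Notation "[ n , m ]" := (free_gen int (n, m) : F).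

Inductive tensor_relator : F -> Prop :=
| tensor_relDl n n' m : tensor_relator ([n + n', m] - [n, m] - [n', m])
| tensor_relDr n m m' : tensor_relator ([n, m + m'] - [n, m] - [n, m'])
| tensor_relZ (t : T) n m :
    tensor_relator ([(t : T^c) *: n, m] - [n, t *: m]).

Definition tensor_relations : {pred F} := fun x =>
  `[< forall A : {pred F}, zmod_closed A ->
        (forall z, tensor_relator z -> z \in A) -> x \in A >].

Fact tensor_relations_zmod_closed : zmod_closed tensor_relations.
Proof.
split=> [|x y /asboolP hx /asboolP hy]; apply/asboolP => A cA hA.
  by case: cA.
by case: (cA) => _; apply; [exact: hx | exact: hy].
Qed.
HB.instance Definition _ :=
  GRing.isZmodClosed.Build F tensor_relations tensor_relations_zmod_closed.

Definition tensor : zmodType := Quotient.quot tensor_relations.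

Definition tens (n : N) (m : M) : tensor := \pi_tensor%qT [n, m].

Lemma tensor_eq (x y : F) :
  x - y \in tensor_relations -> \pi_tensor%qT x = \pi_tensor%qT y.
Proof. by move=> h; apply/eqP; rewrite -Quotient.idealrBE. Qed.

Lemma tensor_rel z : tensor_relator z -> z \in tensor_relations.
Proof. by move=> hz; apply/asboolP => A _; apply. Qed.

Lemma tensDl n n' m : tens (n + n') m = tens n m + tens n' m.
Proof.
rewrite /tens -raddfD; apply: tensor_eq.
by rewrite opprD addrA; apply/tensor_rel/tensor_relDl.
Qed.
Lemma tensDr n m m' : tens n (m + m') = tens n m + tens n m'.
Proof.
rewrite /tens -raddfD; apply: tensor_eq.
by rewrite opprD addrA; apply/tensor_rel/tensor_relDr.
Qed.
Lemma tensZ (t : T) n m : tens ((t : T^c) *: n) m = tens n (t *: m).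
Proof. by apply/tensor_eq/tensor_rel/tensor_relZ. Qed.

Lemma tensor_ext (G : zmodType) (f g : {additive tensor -> G}) :
  (forall n m, f (tens n m) = g (tens n m)) -> f =1 g.
Proof.
move=> fg x; rewrite -[x]reprK.
pose h (k : {additive tensor -> G}) (y : F) : zmodule G := k (\pi_tensor%qT y).
have hl k : linear (h k).
  move=> a y z; rewrite /h !raddfD -[a *: y]/(_ *: _) -[a in LHS]intz scaler_int.
  by rewrite !raddfMz.
pose hh k : {linear F -> zmodule G} :=
  HB.pack (h k) (GRing.isLinear.Build int F (zmodule G) *:%R (h k) (hl k)).
by apply: (@free_ext _ _ _ (hh f) (hh g)) => -[n m]; exact: fg.
Qed.

Definition balanced (G : zmodType) (b : N -> M -> G) : Prop :=
  [/\ forall n n' m, b (n + n') m = b n m + b n' m,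
      forall n m m', b n (m + m') = b n m + b n m'
    & forall (t : T) n m, b ((t : T^c) *: n) m = b n (t *: m)].
End Tensor.
Arguments tensor_relations {T} N M.

Section TensorLift.
Variables (T : pzRingType) (N : lmodType T^c) (M : lmodType T) (G : zmodType).
Variables (b : N -> M -> G) (bP : balanced b).
Local Notation F := (free_mod int (N * M)%type).

Definition tensor_free_lift : F -> zmodule G :=
  free_lift (V := zmodule G) (fun p => b p.1 p.2).

Lemma tensor_free_lift_gen n m : tensor_free_lift (free_gen int (n, m)) = b n m.
Proof. exact: free_lift_gen. Qed.

Lemma tensor_free_lift_rel z : z \in tensor_relations N M ->
  tensor_free_lift z = 0.
Proof.
move=> /asboolP/(_ [pred y | tensor_free_lift y == 0]) h; apply/eqP/h.
  split=> [|x y /eqP x0 /eqP y0]; apply/eqP; first exact: raddf0.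
  by rewrite [LHS]raddfB [X in X - _]x0 [X in _ - X]y0 subr0.
have [bDl bDr bZ] := bP.
move=> _ [n n' m|n m m'|t n m]; rewrite inE /tensor_free_lift !raddfB/=;
  rewrite !free_lift_gen /=.
- by rewrite bDl addrAC addrK subrr.
- by rewrite bDr addrAC addrK subrr.
- by rewrite bZ subrr.
Qed.

Definition tensor_lift of balanced b := fun x : tensor N M =>
  tensor_free_lift (repr x) : G.

Lemma tensor_lift_pi y :
  tensor_lift bP (\pi_(tensor N M)%qT y) = tensor_free_lift y.
Proof.
apply/eqP; rewrite -subr_eq0 -[X in X == _]raddfB; apply/eqP.
by apply: tensor_free_lift_rel; rewrite Quotient.idealrBE reprK.
Qed.

Fact tensor_lift_zmod_morphism : zmod_morphism (tensor_lift bP).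
Proof.
move=> x y; rewrite -[x]reprK -[y]reprK -raddfB !tensor_lift_pi.
by rewrite /tensor_free_lift raddfB.
Qed.

HB.instance Definition _ := GRing.isZmodMorphism.Build (tensor N M) G
  (tensor_lift bP) tensor_lift_zmod_morphism.

Lemma tensor_lift_tens n m : tensor_lift bP (tens n m) = b n m.
Proof. by rewrite tensor_lift_pi tensor_free_lift_gen. Qed.
End TensorLift.

Section TensorMap.
Variables (T : pzRingType) (N N' : lmodType T^c) (M M' : lmodType T).
Variables (f : {linear N -> N'}) (g : {linear M -> M'}).

Fact tensor_map_balanced : balanced (fun n m => tens (f n) (g m)).
Proof.
split=> [n n' m|n m m'|t n m]; first by rewrite raddfD tensDl.
  by rewrite raddfD tensDr.
by rewrite !linearZZ tensZ.
Qed.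

Definition tensor_map : tensor N M -> tensor N' M' :=
  tensor_lift tensor_map_balanced.
HB.instance Definition _ :=
  GRing.Additive.copy tensor_map (tensor_lift tensor_map_balanced).

Lemma tensor_map_tens n m : tensor_map (tens n m) = tens (f n) (g m).
Proof. exact: tensor_lift_tens. Qed.
End TensorMap.

Section Homology.
Variables (U V W : zmodType) (f : {additive U -> V}) (g : {additive V -> W}).

Definition cycle_pred : {pred V} := fun x => g x == 0.
Fact cycle_zmod_closed : zmod_closed cycle_pred.
Proof.
split=> [|x y /eqP x0 /eqP y0]; apply/eqP; first exact: raddf0.
by rewrite raddfB x0 y0 subr0.
Qed.
HB.instance Definition _ := GRing.isZmodClosed.Build V cycle_pred cycle_zmod_closed.

Definition cycles : Type := {x : V | cycle_pred x}.
HB.instance Definition _ := SubChoice.on cycles.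
HB.instance Definition _ := [SubChoice_isSubZmodule of cycles by <:].

Definition boundary_pred : {pred cycles} := fun z => `[< exists u, f u = val z >].
Fact boundary_zmod_closed : zmod_closed boundary_pred.
Proof.
split=> [|x y /asboolP[u fu] /asboolP[v fv]]; apply/asboolP.
  by exists 0; rewrite !raddf0.
by exists (u - v); rewrite !raddfB fu fv.
Qed.
HB.instance Definition _ :=
  GRing.isZmodClosed.Build cycles boundary_pred boundary_zmod_closed.

(** [ker g / (im f :&: ker g)] *)
Definition homology : zmodType := Quotient.quot boundary_pred.
End Homology.

Definition is_trivial (V : zmodType) : Prop := forall x : V, x = 0.

Section Kernel.
Variables (T : pzRingType) (U V : lmodType T) (g : {linear U -> V}).

Definition ker_pred : {pred U} := fun x => g x == 0.
Fact ker_submod_closed : submod_closed ker_pred.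
Proof.
split=> [|a x y /eqP x0 /eqP y0]; apply/eqP; first exact: raddf0.
by rewrite linearP x0 y0 scaler0 addr0.
Qed.
HB.instance Definition _ := GRing.isSubmodClosed.Build T U ker_pred ker_submod_closed.

Definition ker : Type := {x : U | ker_pred x}.
HB.instance Definition _ := SubChoice.on ker.
HB.instance Definition _ := [SubChoice_isSubLmodule of ker by <:].
End Kernel.

(** The functorial free resolution
    [... -> res M 1 -> res M 0 -> M -> 0], where [res M n] is free on the
    underlying set of the [n]-th syzygy. *)
Section FreeResolution.
Variables (T : pzRingType) (M : lmodType T).

Definition free_cover (K : lmodType T) : {linear free_mod T K -> K} :=
  free_lift (fun x => x).

Fixpoint syzygy (n : nat) : lmodType T :=
  if n is n'.+1 then ker (free_cover (syzygy n')) else M.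

Definition res (n : nat) : lmodType T := free_mod T (syzygy n).

Definition res_d (n : nat) : {linear res n.+1 -> res n} :=
  (val : ker (free_cover (syzygy n)) -> res n) \o free_cover (syzygy n.+1).
End FreeResolution.

Section Ext.
Variables (T : pzRingType).

Section Precomp.
Variables (A B N : lmodType T) (d : {linear A -> B}).
Definition precomp (f : {linear B -> N}) : {linear A -> N} := f \o d.
Fact precomp_zmod_morphism : zmod_morphism precomp.
Proof. by move=> f g; apply: linear_ext. Qed.
HB.instance Definition _ :=
  GRing.isZmodMorphism.Build {linear B -> N} {linear A -> N} precomp
    precomp_zmod_morphism.
End Precomp.
Arguments precomp {A B} N d f.

Definition Ext (n : nat) (M N : lmodType T) : zmodType :=
  match n with
  | 0 => homology (\0 : {additive {linear res M 0 -> N} -> {linear res M 0 -> N}})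
           (precomp N (res_d M 0))
  | n'.+1 => homology (precomp N (res_d M n')) (precomp N (res_d M n'.+1))
  end.

Definition Tor (n : nat) (N : lmodType T^c) (M : lmodType T) : zmodType :=
  match n with
  | 0 => homology (tensor_map (res_d N 0) (idfun : {linear M -> M}))
           (\0 : {additive tensor (res N 0) M -> tensor (res N 0) M})
  | n'.+1 => homology (tensor_map (res_d N n'.+1) (idfun : {linear M -> M}))
           (tensor_map (res_d N n') (idfun : {linear M -> M}))
  end.
End Ext.
Arguments Ext T n M N : clear implicits.
Arguments Tor T n N M : clear implicits.

Record bimodule (R S : pzRingType) := Bimodule {
  bim_sort :> lmodType R;
  bim_act : bim_sort -> S -> bim_sort;
  bim_actDl : forall c c' s, bim_act (c + c') s = bim_act c s + bim_act c' s;
  bim_actDr : forall c s s', bim_act c (s + s') = bim_act c s + bim_act c s';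
  bim_actA : forall c s s', bim_act (bim_act c s) s' = bim_act c (s * s');
  bim_act1 : forall c, bim_act c 1 = c;
  bim_actZ : forall (r : R) c s, bim_act (r *: c) s = r *: bim_act c s
}.

Definition bim_right (R S : pzRingType) (C : bimodule R S) : Type := C.

Section Bimodule.
Variables (R S : pzRingType) (C : bimodule R S).

HB.instance Definition _ := GRing.Zmodule.on (bim_right C).

Definition bim_right_scale (s : S^c) (c : bim_right C) : bim_right C :=
  bim_act c s.

Fact bim_right_scaleA (a b : S^c) (c : bim_right C) :
  bim_right_scale a (bim_right_scale b c) = bim_right_scale (a * b) c.
Proof. exact: bim_actA. Qed.
Fact bim_right_scale1 : left_id 1 bim_right_scale.
Proof. by move=> c; exact: bim_act1. Qed.
Fact bim_right_scaleDr : right_distributive bim_right_scale +%R.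
Proof. by move=> s c c'; exact: bim_actDl. Qed.
Fact bim_right_scaleDl c : {morph bim_right_scale^~ c : a b / a + b}.
Proof. by move=> s s'; exact: bim_actDr. Qed.

HB.instance Definition _ := GRing.Zmodule_isLmodule.Build S^c (bim_right C)
  bim_right_scaleA bim_right_scale1 bim_right_scaleDr bim_right_scaleDl.

Definition lmul (r : R) (c : bim_right C) : bim_right C := r *: (c : C).
Fact lmul_linear r : linear (lmul r).
Proof.
by move=> s c c'; rewrite /lmul scalerDr; congr (_ + _); rewrite -bim_actZ.
Qed.
HB.instance Definition _ (r : R) := GRing.isLinear.Build S^c (bim_right C)
  (bim_right C) *:%R (lmul r) (lmul_linear r).

Definition rmul (s : S) (c : C) : C := bim_act c s.
Fact rmul_linear s : linear (rmul s).
Proof. by move=> r c c'; rewrite /rmul bim_actDl bim_actZ. Qed.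
HB.instance Definition _ (s : S) :=
  GRing.isLinear.Build R C C *:%R (rmul s) (rmul_linear s).

Definition homothetyR (r : R) : {linear bim_right C -> bim_right C} := lmul r.
Definition homothetyS (s : S) : {linear C -> C} := rmul s.
End Bimodule.

(** [N (x)_R C], a right [S]-module via [(x (x) c) s = x (x) (c s)]. *)
Definition tensC (R S : pzRingType) (C : bimodule R S) (N : lmodType R^c) : Type :=
  tensor N C.

(** [Hom_R(C, M)], a left [S]-module via [(s f)(c) = f (c s)]. *)
Definition homC (R S : pzRingType) (C : bimodule R S) (M : lmodType R) : Type :=
  {linear C -> M}.

Section TensC.
Variables (R S : pzRingType) (C : bimodule R S) (N : lmodType R^c).

HB.instance Definition _ := GRing.Zmodule.on (tensC C N).

Definition tensC_scale (s : S^c) : tensC C N -> tensC C N :=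
  tensor_map (idfun : {linear N -> N}) (homothetyS C s).

Lemma tensC_scale_tens (s : S) x (c : C) :
  tensC_scale s (tens x c) = tens x (bim_act c s).
Proof. exact: tensor_map_tens. Qed.

Fact tensC_scaleA (a b : S^c) (z : tensC C N) :
  tensC_scale a (tensC_scale b z) = tensC_scale (a * b) z.
Proof.
pose m (s : S) : {additive tensor N C -> tensor N C} :=
  tensor_map (idfun : {linear N -> N}) (homothetyS C s).
apply: (tensor_ext (f := m a \o m b) (g := m (a * b : S^c))) => x c /=.
by rewrite /m !tensor_map_tens /= /rmul bim_actA.
Qed.
Fact tensC_scale1 : left_id 1 tensC_scale.
Proof.
pose m (s : S) : {additive tensor N C -> tensor N C} :=
  tensor_map (idfun : {linear N -> N}) (homothetyS C s).
apply: (tensor_ext (f := m 1) (g := idfun)) => x c /=.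
by rewrite /m tensor_map_tens /= /rmul bim_act1.
Qed.
Fact tensC_scaleDr : right_distributive tensC_scale +%R.
Proof. by move=> s; exact: raddfD. Qed.
Fact tensC_scaleDl z : {morph tensC_scale^~ z : a b / a + b}.
Proof.
pose m (s : S) : {additive tensor N C -> tensor N C} :=
  tensor_map (idfun : {linear N -> N}) (homothetyS C s).
move=> a b; apply: (tensor_ext (f := m (a + b)) (g := m a \+ m b)) => x c /=.
by rewrite /m !tensor_map_tens /= /rmul bim_actDr tensDr.
Qed.
HB.instance Definition _ := GRing.Zmodule_isLmodule.Build S^c (tensC C N)
  tensC_scaleA tensC_scale1 tensC_scaleDr tensC_scaleDl.
End TensC.

Section HomC.
Variables (R S : pzRingType) (C : bimodule R S) (M : lmodType R).

HB.instance Definition _ := GRing.Zmodule.on (homC C M).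

Definition homC_scale (s : S) (f : homC C M) : homC C M :=
  (f : {linear C -> M}) \o homothetyS C s.

Fact homC_scaleA a b f : homC_scale a (homC_scale b f) = homC_scale (a * b) f.
Proof. by apply: linear_ext => c /=; rewrite /rmul bim_actA. Qed.
Fact homC_scale1 : left_id 1 homC_scale.
Proof. by move=> f; apply: linear_ext => c /=; rewrite /rmul bim_act1. Qed.
Fact homC_scaleDr : right_distributive homC_scale +%R.
Proof. by move=> a f g; apply: linear_ext. Qed.
Fact homC_scaleDl f : {morph homC_scale^~ f : a b / a + b}.
Proof.
by move=> a b; apply: linear_ext => c /=; rewrite /rmul bim_actDr raddfD.
Qed.
HB.instance Definition _ := GRing.Zmodule_isLmodule.Build S (homC C M)
  homC_scaleA homC_scale1 homC_scaleDr homC_scaleDl.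
End HomC.

Section Mu.
Variables (R S : pzRingType) (C : bimodule R S) (N : lmodType R^c).

Definition mu_fun (x : N) (c : bim_right C) : tensC C N := tens x (c : C).
Fact mu_fun_linear x : linear (mu_fun x).
Proof.
move=> s c c'; rewrite /mu_fun -[X in tens _ X]/(bim_act (c : C) s + (c' : C)).
by rewrite tensDr; congr (_ + _); rewrite -[RHS]/(tensC_scale _ _) tensC_scale_tens.
Qed.
HB.instance Definition _ (x : N) := GRing.isLinear.Build S^c (bim_right C)
  (tensC C N) *:%R (mu_fun x) (mu_fun_linear x).

Definition mu (x : N) : {linear bim_right C -> tensC C N} := mu_fun x.
End Mu.

Section Theta.
Variables (R S : pzRingType) (C : bimodule R S) (M : lmodType R).

Definition theta_fun (c : bim_right C) (f : homC C M) : M :=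
  (f : {linear C -> M}) c.
Fact theta_balanced : balanced theta_fun.
Proof. by split=> // c c' f; exact: raddfD. Qed.

Definition theta : tensor (bim_right C) (homC C M) -> M :=
  tensor_lift theta_balanced.
End Theta.

Definition surjective (U V : Type) (f : U -> V) : Prop := forall y, exists x, f x = y.

Definition exact_at (U V W : zmodType) (f : U -> V) (g : V -> W) : Prop :=
  forall y, g y = 0 <-> exists x, f x = y.

Definition projective (T : pzRingType) (P : lmodType T) : Prop :=
  forall (A B : lmodType T) (g : {linear A -> B}) (f : {linear P -> B}),
    surjective g -> exists h : {linear P -> A}, forall x, g (h x) = f x.

Definition finitely_generated (T : pzRingType) (M : lmodType T) : Prop :=
  exists n (v : 'I_n -> M), forall x, exists a : 'I_n -> T,
    x = \sum_(i < n) a i *: v i.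

Record projective_resolution (T : pzRingType) (M : lmodType T) := {
  pres :> nat -> lmodType T;
  pres_d : forall n, {linear pres n.+1 -> pres n};
  pres_aug : {linear pres 0 -> M};
  pres_projective : forall n, projective (pres n);
  pres_surjective : surjective pres_aug;
  pres_exact0 : exact_at (pres_d 0) pres_aug;
  pres_exactS : forall n, exact_at (pres_d n.+1) (pres_d n)
}.

Definition has_fg_projective_resolution (T : pzRingType) (M : lmodType T) : Prop :=
  exists P : projective_resolution M, forall n, finitely_generated (P n).

Record semidualizing (R S : pzRingType) (C : bimodule R S) : Prop := {
  semidualizing_a1 : has_fg_projective_resolution (C : lmodType R);
  semidualizing_a2 : has_fg_projective_resolution (bim_right C : lmodType S^c);
  semidualizing_b1 : bijective (homothetyR C);
  semidualizing_b2 : bijective (homothetyS C);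
  semidualizing_c1 : forall i, (1 <= i)%N -> is_trivial (Ext R i C C);
  semidualizing_c2 : forall i, (1 <= i)%N ->
    is_trivial (Ext S^c i (bim_right C) (bim_right C))
}.

Record auslander_class (R S : pzRingType) (C : bimodule R S)
    (N : lmodType R^c) : Prop := {
  auslander_Tor : forall i, (1 <= i)%N -> is_trivial (Tor R i N C);
  auslander_Ext : forall i, (1 <= i)%N ->
    is_trivial (Ext S^c i (bim_right C) (tensC C N));
  auslander_mu : bijective (@mu R S C N)
}.

Record bass_class (R S : pzRingType) (C : bimodule R S)
    (M : lmodType R) : Prop := {
  bass_Ext : forall i, (1 <= i)%N -> is_trivial (Ext R i C M);
  bass_Tor : forall i, (1 <= i)%N ->
    is_trivial (Tor S i (bim_right C) (homC C M));
  bass_theta : bijective (@theta R S C M)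
}.

Section ModuleClasses.
Variables (T : pzRingType) (X : lmodType T -> Prop).

Definition coproduct_closed : Prop :=
  forall (I : Type) (M : I -> lmodType T), (forall i, X (M i)) -> X (dsum_mod M).

Definition product_closed : Prop :=
  forall (I : Type) (M : I -> lmodType T), (forall i, X (M i)) -> X (dprod_mod M).

Definition finite_sum_closed : Prop :=
  forall n (M : 'I_n -> lmodType T), (forall i, X (M i)) -> X (dsum_mod M).

Definition summand_closed : Prop :=
  forall (M N Y : lmodType T) (f : {linear (M * N)%type -> Y}),
    bijective f -> X Y -> X M.

Definition extension_closed : Prop :=
  forall (A B C : lmodType T) (f : {linear A -> B}) (g : {linear B -> C}),
    injective f -> exact_at f g -> surjective g -> X A -> X C -> X B.

Definition precover (A Y : lmodType T) (f : {linear A -> Y}) : Prop :=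
  X A /\ forall A', X A' -> forall g : {linear A' -> Y},
    exists h : {linear A' -> A}, forall x, f (h x) = g x.

Definition cover (A Y : lmodType T) (f : {linear A -> Y}) : Prop :=
  precover f /\
  forall h : {linear A -> A}, (forall x, f x = f (h x)) -> bijective h.

Definition preenvelope (Y A : lmodType T) (f : {linear Y -> A}) : Prop :=
  X A /\ forall A', X A' -> forall g : {linear Y -> A'},
    exists h : {linear A -> A'}, forall x, h (f x) = g x.

Definition covering : Prop :=
  forall Y : lmodType T, exists (A : lmodType T) (f : {linear A -> Y}), cover f.

Definition preenveloping : Prop :=
  forall Y : lmodType T, exists (A : lmodType T) (f : {linear Y -> A}), preenvelope f.
End ModuleClasses.

(** [T'] is the opposite ring of [T] and [dual] is [X |-> X^+].  As [R^c^c] is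
    not convertible to [R], the two cases [T = R] (with [dual := lchar]) and
    [T = R^c] (with [dual := rchar]) are instances of one parametric notion. *)
Section DualityPairs.
Variables (T T' : pzRingType) (dual : lmodType T -> lmodType T').
Variables (X : lmodType T -> Prop) (Y : lmodType T' -> Prop).

Definition duality_pair : Prop :=
  [/\ forall M, X M <-> Y (dual M), summand_closed Y & finite_sum_closed Y].

Definition coproduct_closed_duality_pair : Prop :=
  duality_pair /\ coproduct_closed X.

Definition product_closed_duality_pair : Prop :=
  duality_pair /\ product_closed X.

Definition perfect_duality_pair : Prop :=
  [/\ coproduct_closed_duality_pair, X T^o & extension_closed X].
End DualityPairs.

(* Main.v *)
(** The two classes are dual to each other because [Tor] and tensor products become
    [Ext] and [Hom] under [X |-> X^+]: [(N (x) C)^+ = Hom(C, N^+)] always, and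
    [Hom(C, X)^{++} = Hom(C, X^{++})] since [C] has a resolution by finitely generated
    projectives, so [N] is in the Auslander class iff [N^+] is in the Bass class, and
    vice versa.  A pure monomorphism has a split dual; as both classes are closed under
    retracts, they are closed under pure submodules and pure quotients.  Coproducts are
    handled directly, and [prod N_i] is pure in [(sum N_i^+)^+].

    For the approximations: every map [Y -> A] factors through a pure submodule of [A] of
    bounded size, which gives preenvelopes; every [A -> Y] factors through a pure quotient
    of [A] of bounded size (Bican-El Bashir-Enochs), which gives precovers; and a precover
    for a class closed under directed colimits yields a cover (Enochs), by Zorn's lemma
    applied to chains of endomorphisms over [Y]. *)

Require Import Defs.
From HB Require Import structures.
From mathcomp Require Import all_boot all_algebra.
From mathcomp Require Import all_classical.

Set Implicit Arguments.
Unset Strict Implicit.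
Unset Printing Implicit Defensive.
Import GRing.Theory Num.Theory.
Local Open Scope ring_scope.
Local Open Scope classical_set_scope.

(** * Characters of abelian groups *)

(** [Ext] and [Tor] are defined by the functorial free resolution, and [Tor] resolves its first
    variable, whereas finiteness is known only for some projective resolution of [C]. To change
    resolutions without comparison maps, Ext^{n+1}(M, N) = 0 is rewritten as Ext^1(M, -) = 0 on the
    n-th cosyzygy of N, a statement about extending homomorphisms in which no resolution of M
    occurs; every projective resolution of M computes it. The Tor conditions are likewise turned
    into Ext conditions on maps out of [C]. Size bounds are expressed without cardinals: a bounded
    module is a quotient of the free module on an inductive type of terms fixed by the ring and Y,
    so the submodules of that free module index a product or a coproduct chosen in advance. For
    precovers Y supplies no generators of the source, which is why the terms there describe elements
    by their linear relations and their images in Y. *)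

Lemma Zorn_above (T : Type) (P : set (set T)) (A0 : set T) :
    P A0 ->
    (forall F : set (set T), F `<=` P -> F !=set0 -> total_on F subset ->
      P (\bigcup_(X in F) X)) ->
  exists A, [/\ P A, A0 `<=` A & forall B, A `<=` B -> P B -> B = A].
Proof.
(* The union of the empty chain must satisfy the predicate too. With [A0] built into [Q], that union
   corresponds to [A0] itself. *)
move=> P0 Pchain; pose Q : set (set T) := fun X => P (A0 `|` X).
have [F FQ Ftot|X [QX Xmax]] := @Zorn_bigcup T Q.
  have [->|/set0P[X0 FX0]] := eqVneq F set0; first by rewrite /Q bigcup_set0 setU0.
  rewrite /Q (_ : _ `|` _ = \bigcup_(Y in [set A0 `|` X | X in F]) Y).
    apply: Pchain => [_ [X FX <-]||_ _ [X FX <-] [Y FY <-]]; first exact: FQ.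
      by exists (A0 `|` X0); exists X0.
    by have [h|h] := Ftot _ _ FX FY; [left|right]; apply: setUS.
  rewrite eqEsubset; split=> x.
    case=> [Ax|[X FX Xx]].
      by exists (A0 `|` X0); [exact: (ex_intro2 _ _ X0)|left].
    by exists (A0 `|` X); [exact: (ex_intro2 _ _ X)|right].
  by case=> _ [X FX <-] [Ax|Xx]; [left|right; exists X].
exists (A0 `|` X); split=> // B AXB PB.
apply: contrapT => nB; apply: (Xmax B); last first.
  rewrite /Q (_ : _ `|` B = B)//; apply/setUidPr => x Ax.
  by apply: AXB; left.
split=> [x Xx|BX]; first by apply: AXB; right.
by apply: nB; rewrite eqEsubset; split=> // x /BX; right.
Qed.

Definition mklin (T : pzRingType) (U V : lmodType T) (f : U -> V)
    (hf : linear f) : {linear U -> V} :=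
  HB.pack f (GRing.isLinear.Build T U V *:%R f hf).

Definition mkadd (U V : zmodType) (f : U -> V) (hf : zmod_morphism f) :
    {additive U -> V} :=
  HB.pack f (GRing.isZmodMorphism.Build U V f hf).

Section Subgroups.
Variable V : zmodType.

Definition is_subgroup (H : set V) : Prop :=
  H 0 /\ forall x y, H x -> H y -> H (x - y).

Variables (H : set V) (HP : is_subgroup H).
Lemma subgroupN x : H x -> H (- x).
Proof. by case: HP => H0 HB Hx; rewrite -sub0r; apply: HB. Qed.
Lemma subgroupD x y : H x -> H y -> H (x + y).
Proof. by move=> Hx Hy; rewrite -[y]opprK; case: HP => _; apply => //; apply: subgroupN. Qed.
Lemma subgroupMn x n : H x -> H (x *+ n).
Proof. by move=> Hx; elim: n => [|n IH]; [case: HP|rewrite mulrS; apply: subgroupD]. Qed.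
Lemma subgroupMz x n : H x -> H (x *~ n).
Proof. by case: n => n Hx; [|apply: subgroupN]; apply: subgroupMn. Qed.
End Subgroups.

Notation char V := {additive V -> QmodZ}.

Section QZ.
Definition toQZ (q : rat) : QmodZ := \pi_QmodZ%qT q.

Lemma toQZ_eq0 q : (toQZ q = 0) <-> q \is a Num.int.
Proof.
rewrite /toQZ -[0](raddf0 (\pi_QmodZ%qT)); split.
  by move/eqP; rewrite -Quotient.idealrBE subr0.
by move=> h; apply/eqP; rewrite -Quotient.idealrBE subr0.
Qed.

Lemma QZ_div (d : int) (q : QmodZ) : d != 0 -> exists q', q' *~ d = q.
Proof.
move=> d0; rewrite -[q]reprK; exists (toQZ (repr q / d%:~R)).
rewrite /toQZ -raddfMz -mulrzl mulrC divfK//.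
by rewrite intr_eq0.
Qed.
End QZ.

Section CharExtension.
Variable V : zmodType.
Local Notation VQ := (V * QmodZ)%type.

(** Euclidean division by the least positive element of [D]; [d] is 0 when [D] contains only 0. *)
Lemma subgroup_int_gen (D : set int) : is_subgroup D ->
  exists d, D d /\ forall n, D n -> exists m, n = d * m.
Proof.
move=> DP; have [D0 DB] := DP.
have [[n [n0 Dn]]|nD] := pselect (exists n, n != 0 /\ D n); last first.
  exists 0; split=> // n Dn; exists 0; rewrite mul0r.
  by apply: contrapT => /eqP n0; apply: nD; exists n.
have ex : exists k : nat, `[< (0 < k)%N /\ D k%:Z >].
  exists `|n|%N; apply/asboolP; rewrite absz_gt0; split=> //.
  by rewrite abszE; case: (ger0P n) => _ //; apply: subgroupN.
case: (ex_minnP ex) => d /asboolP[d0 Dd] dmin.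
exists d%:Z; split=> // m Dm; exists (m %/ d)%Z; rewrite mulrC.
rewrite {1}(divz_eq m d) -[RHS]addr0; congr (_ + _).
have dn0 : d%:Z != 0 by rewrite eqz_nat -lt0n.
have : D (m %% d)%Z.
  rewrite (_ : (m %% d)%Z = m - d%:Z *~ (m %/ d)%Z); last first.
    by rewrite -mulrzr intz mulrC.
  by apply: DB => //; apply: subgroupMz.
move: (modz_ge0 m dn0) (ltz_pmod m (d0 : 0 < d%:Z)).
case: (m %% d)%Z => // -[|k] // _ kd Dk.
have /dmin : `[< (0 < k.+1)%N /\ D k.+1%:Z >] by apply/asboolP.
by rewrite leqNgt -ltz_nat kd.
Qed.

(** A subgroup with this property is the graph of a homomorphism to Q/Z defined on a subgroup of
    [V]. Graphs make unions of chains of partial characters immediate. *)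
Definition functional (G : set VQ) : Prop := forall p, G (0, p) -> p = 0.

Lemma graphB (G : set VQ) u p w q : is_subgroup G -> G (u, p) -> G (w, q) ->
  G (u - w, p - q).
Proof. by case=> _ GB Gu Gw; exact: GB _ _ Gu Gw. Qed.

(** One step of Baer's argument. The integers [n] with [v *~ n] in the domain form the ideal
    generated by some [d]; dividing the value at [v *~ d] by [d] gives a consistent value at [v]. *)
Lemma functional_extend1 (G : set VQ) v : is_subgroup G -> functional G ->
  exists G', [/\ is_subgroup G', functional G', G `<=` G' & exists p, G' (v, p)].
Proof.
move=> GP Gf.
have pairMz (x : VQ) (n : int) : x *~ n = (x.1 *~ n, x.2 *~ n).
  by rewrite [LHS]surjective_pairing !raddfMz.
have [d [[q Gq] dgen]] : exists d, (exists p, G (v *~ d, p)) /\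
    forall n, (exists p, G (v *~ n, p)) -> exists m, n = d * m.
  apply: (@subgroup_int_gen [set n | exists p, G (v *~ n, p)]); split=> [|x y [p Gp] [p' Gp']].
    by exists 0; case: GP.
  by exists (p - p'); rewrite mulrzBr; exact: graphB.
have [q' q'P] : exists q', forall n p, G (v *~ n, p) -> p = q' *~ n.
  have [q' q'd] : exists q', q' *~ d = q.
    have [d0|/QZ_div//] := eqVneq d 0; exists 0; rewrite mul0rz.
    by apply/esym/Gf; move: Gq; rewrite d0 mulr0z.
  exists q' => n p Gp; have [m nE] : exists m, n = d * m by apply: dgen; exists p.
  rewrite nE mulrzA q'd; apply/eqP; rewrite -subr_eq0; apply/eqP/Gf.
  have := subgroupMz GP m Gq; rewrite pairMz/= -mulrzA -nE => Gqm.
  by have := graphB GP Gp Gqm; rewrite subrr.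
exists [set x | exists u n, G u /\ x = u + (v, q') *~ n]; split.
- split=> [|_ _ [u [n [Gu ->]]] [w [m [Gw ->]]]].
    by exists 0, 0; rewrite mulr0z addr0; split=> //; case: GP.
  exists (u - w), (n - m); split; first by case: GP => _; apply.
  by rewrite mulrzBr opprD addrACA.
- move=> p [[u q1] [n [Gu]]]; rewrite pairMz => -[/= uE ->].
  have /q'P : G (v *~ - n, q1).
    by move: Gu; rewrite mulrNz -(_ : u = - (v *~ n))//; apply/eqP; rewrite -addr_eq0 -uE.
  by move=> ->; rewrite mulrNz addNr.
- by move=> u Gu; exists u, 0; rewrite mulr0z addr0.
- by exists q', 0, 1; rewrite mulr1z add0r; split=> //; case: GP.
Qed.

(** Injectivity of Q/Z: a maximal partial character is total by [functional_extend1]. *)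
Lemma char_of_functional (G : set VQ) : is_subgroup G -> functional G ->
  exists chi : char V, forall v p, G (v, p) -> chi v = p.
Proof.
move=> GP Gf.
have [|A [[AP Af] GA Amax]] := @Zorn_above _ (fun A => is_subgroup A /\ functional A) G (conj GP Gf).
  move=> F FP [X0 FX0] Ftot; split; first split.
  - by exists X0 => //; case: (FP _ FX0) => -[].
  - move=> x y [X FX Xx] [Y FY Yy]; have [XY|YX] := Ftot _ _ FX FY.
      by exists Y => //; have [[_ h] _] := FP _ FY; apply: h => //; apply: XY.
    by exists X => //; have [[_ h] _] := FP _ FX; apply: h => //; apply: YX.
  - by move=> p [X FX Xp]; have [_ h] := FP _ FX; apply: h.
have /choice[c cP] : forall v, exists p, A (v, p).
  move=> v; have [B [BP Bf AB [p Bp]]] := functional_extend1 v AP Af.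
  by exists p; rewrite -(Amax B AB).
have cE v p : A (v, p) -> c v = p.
  move=> Ap; apply/eqP; rewrite -subr_eq0; apply/eqP/Af.
  by have := graphB AP (cP v) Ap; rewrite subrr.
have cB : zmod_morphism c.
  by move=> x y; apply: cE; exact: graphB.
by exists (mkadd cB) => v p /GA/cE.
Qed.

Lemma char_sep (H : set V) v : is_subgroup H -> ~ H v ->
  exists chi : char V, (forall x, H x -> chi x = 0) /\ chi v <> 0.
Proof.
move=> HP nHv.
have [d [Hd dgen]] : exists d, H (v *~ d) /\
    forall n, H (v *~ n) -> exists m, n = d * m.
  apply: (@subgroup_int_gen [set n | H (v *~ n)]); split=> /= [|x y Hx Hy].
    by rewrite mulr0z; case: HP.
  by rewrite mulrzBr; case: HP => _; apply.
have [q [qd q0]] : exists q : QmodZ, q *~ d = 0 /\ q <> 0.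
  have half (k : int) : k != 1 -> k != -1 -> k != 0 -> toQZ (k%:~R^-1) <> 0.
    move=> k1 kN1 k0 /toQZ_eq0/intrP[m].
    move/(congr1 (fun x => x * k%:~R)); rewrite mulVf ?intr_eq0// -intrM => /esym/eqP.
    rewrite -[1]/(1%:~R) eqr_int => /eqP mk.
    have : (absz m * absz k == 1)%N by rewrite -abszM mk.
    rewrite muln_eq1 => /andP[_ /eqP ak].
    by move: k1 kN1 k0; case: (intP k) ak => // n; rewrite ?abszN => -[->].
  (* Up to sign [d] is the order of [v] modulo [H], with 0 for infinite order. The value at [v] is
     1/2 in that case and 1/d otherwise; the latter is nonzero in Q/Z since [d] = 1 or -1 would put
     [v] in [H]. *)
  have [d0|d0] := eqVneq d 0; first by exists (toQZ (2%:~R^-1)); rewrite d0 mulr0z; split=> //;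
      exact: half.
  exists (toQZ (d%:~R^-1)); split; last first.
    apply: half => //; apply/eqP => dE; apply: nHv; move: Hd; rewrite dE ?mulr1z// mulrN1z.
    by move/(subgroupN HP); rewrite opprK.
  rewrite /toQZ -raddfMz -mulrzl mulfV ?intr_eq0//.
  by apply/toQZ_eq0; exact: rpred1.
have pairMz (x : VQ) (n : int) : x *~ n = (x.1 *~ n, x.2 *~ n).
  by rewrite [LHS]surjective_pairing !raddfMz.
have [||chi chiP] := @char_of_functional [set x | exists n, H (x.1 - v *~ n) /\ x.2 = q *~ n].
- split=> [|x y [n [Hx xE]] [m [Hy yE]]].
    by exists 0; rewrite !mulr0z subrr; split=> //; case: HP.
  exists (n - m); rewrite !mulrzBr -xE -yE; split=> //.
  by rewrite opprD addrACA -opprD; case: HP => _; apply.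
- move=> p /= [n [+ ->]]; rewrite sub0r => /(subgroupN HP); rewrite opprK => /dgen[m ->].
  by rewrite mulrzA qd mul0rz.
exists chi; split=> [x Hx|]; first by apply: chiP; exists 0; rewrite !mulr0z subr0.
rewrite (chiP v q)//; exists 1; rewrite !mulr1z subrr; split=> //; by case: HP.
Qed.
End CharExtension.

Lemma image_subgroup (U V : zmodType) (f : {additive U -> V}) :
  is_subgroup [set v | exists u, f u = v].
Proof.
split=> [|_ _ [u <-] [w <-]]; first by exists 0; rewrite raddf0.
by exists (u - w); rewrite raddfB.
Qed.

Section Duality.
Variables (U V W : zmodType) (f : {additive U -> V}) (g : {additive V -> W}).

(** Extension of characters gives one direction; separating a point from the image of [f] gives the
    other. *)
Lemma char_exact :
  (forall v, g v = 0 -> exists u, f u = v) <->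
  (forall chi : char V, (forall u, chi (f u) = 0) ->
     exists psi : char W, forall v, psi (g v) = chi v).
Proof.
split=> [ex chi chi0|ex v gv].
  have [||psi psiP] := @char_of_functional W [set x | exists v, x = (g v, chi v)].
  - split=> [|_ _ [v ->] [w ->]]; first by exists 0; rewrite !raddf0.
    by exists (v - w); rewrite !raddfB.
  - by move=> p [v [/esym/ex[u <-] ->]].
  by exists psi => v; apply: psiP; exists v.
apply: contrapT => nv.
have [chi [chi0 []]] := char_sep (image_subgroup f) nv.
have [|psi psiE] := ex chi; first by move=> u; apply: chi0; exists u.
by rewrite -psiE gv raddf0.
Qed.
End Duality.

Lemma char_inj (U V : zmodType) (f : {additive U -> V}) :
  injective f <-> forall chi : char U, exists psi : char V, forall u, psi (f u) = chi u.
Proof.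
have [h1 h2] := @char_exact QmodZ _ _ (\0 : {additive QmodZ -> U}) f.
split=> [fi chi|ex].
  apply: h1 => [v fv|u]; last by rewrite /= raddf0.
  by exists 0; apply: fi; rewrite /= fv raddf0.
move=> x y fxy; apply/eqP; rewrite -subr_eq0; apply/eqP.
by have [|u <-//] := h2 (fun chi _ => ex chi) (x - y); rewrite raddfB fxy subrr.
Qed.

Lemma char_surj (U V : zmodType) (f : {additive U -> V}) :
  surjective f <-> forall chi : char V, (forall u, chi (f u) = 0) -> forall v, chi v = 0.
Proof.
have [h1 h2] := @char_exact _ _ QmodZ f (\0 : {additive V -> QmodZ}).
split=> [fs chi chi0 v|ex v]; first by have [u <-] := fs v.
by apply: h2 => // chi /ex chi0; exists (\0 : char QmodZ) => w; rewrite chi0.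
Qed.

Lemma char_eq (V : zmodType) (x y : V) : (forall chi : char V, chi x = chi y) -> x = y.
Proof.
move=> e; apply: contrapT => xy.
have [||chi [_ []]] := @char_sep V [set 0] (x - y).
- by split=> // _ _ -> ->; rewrite subrr.
- by move/eqP; rewrite subr_eq0 => /eqP.
by rewrite raddfB e subrr.
Qed.

(** * Submodules, adjunctions and Ext^1 *)

Section Submodules.
Variables (T : pzRingType) (U : lmodType T).

Definition is_submod (P : set U) : Prop :=
  P 0 /\ forall a x y, P x -> P y -> P (a *: x + y).

Record submod := Submod { submod_set :> U -> Prop; submodP : is_submod submod_set }.

Variable P : submod.

Lemma submod0 : P 0. Proof. by case: (submodP P). Qed.
Lemma submodZD a x y : P x -> P y -> P (a *: x + y).
Proof. by case: (submodP P) => _; apply. Qed.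
Lemma submodD x y : P x -> P y -> P (x + y).
Proof. by move=> Px Py; rewrite -[x]scale1r; apply: submodZD. Qed.
Lemma submodZ a x : P x -> P (a *: x).
Proof. by move=> Px; rewrite -[_ *: _]addr0; apply: submodZD => //; apply: submod0. Qed.
Lemma submodN x : P x -> P (- x).
Proof. by move=> Px; rewrite -scaleN1r; apply: submodZ. Qed.

Definition submod_pred : {pred U} := fun x => `[< P x >].
Fact submod_pred_closed : submod_closed submod_pred.
Proof.
split=> [|a x y /asboolP Px /asboolP Py]; apply/asboolP; first exact: submod0.
exact: submodZD.
Qed.
HB.instance Definition _ :=
  GRing.isSubmodClosed.Build T U submod_pred submod_pred_closed.

Definition submod_type : Type := {x : U | submod_pred x}.
HB.instance Definition _ := SubChoice.on submod_type.
HB.instance Definition _ := [SubChoice_isSubLmodule of submod_type by <:].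

Definition sincl : {linear submod_type -> U} := val.
Lemma sincl_inj : injective sincl. Proof. exact: val_inj. Qed.
Lemma sinclP x : P (sincl x). Proof. exact/asboolP/(valP x). Qed.
Lemma sincl_surj x : P x -> exists y, sincl y = x.
Proof. by move=> Px; exists (exist _ x (asboolT Px)). Qed.

Definition quo_type : Type := Quotient.quot submod_pred.
HB.instance Definition _ := GRing.Zmodule.on quo_type.

Definition proj_fun (x : U) : quo_type := \pi_(Quotient.quot submod_pred)%qT x.

Lemma proj_fun_eq x y : P (x - y) -> proj_fun x = proj_fun y.
Proof. by move=> Pxy; apply/eqP; rewrite -Quotient.idealrBE; apply/asboolP. Qed.
Lemma proj_fun_eqP x y : proj_fun x = proj_fun y -> P (x - y).
Proof. by move/eqP; rewrite -Quotient.idealrBE => /asboolP. Qed.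
Lemma proj_fun_repr (q : quo_type) : proj_fun (repr (q : Quotient.quot submod_pred)) = q.
Proof. exact: reprK. Qed.
Lemma proj_funD x y : proj_fun (x + y) = proj_fun x + proj_fun y.
Proof. exact: raddfD. Qed.

Definition quo_scale (a : T) (q : quo_type) : quo_type :=
  proj_fun (a *: repr (q : Quotient.quot submod_pred)).
Lemma quo_scale_proj a x : quo_scale a (proj_fun x) = proj_fun (a *: x).
Proof.
apply: proj_fun_eq; rewrite -scalerBr; apply: submodZ.
by apply: proj_fun_eqP; rewrite proj_fun_repr.
Qed.
Fact quo_scaleA a b q : quo_scale a (quo_scale b q) = quo_scale (a * b) q.
Proof. by rewrite -[q]proj_fun_repr !quo_scale_proj scalerA. Qed.
Fact quo_scale1 : left_id 1 quo_scale.
Proof. by move=> q; rewrite -[q]proj_fun_repr quo_scale_proj scale1r. Qed.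
Fact quo_scaleDr : right_distributive quo_scale +%R.
Proof.
move=> a p q; rewrite -[p]proj_fun_repr -[q]proj_fun_repr.
by rewrite -proj_funD !quo_scale_proj scalerDr proj_funD.
Qed.
Fact quo_scaleDl q : {morph quo_scale^~ q : a b / a + b}.
Proof.
by move=> a b; rewrite -[q]proj_fun_repr !quo_scale_proj scalerDl proj_funD.
Qed.
HB.instance Definition _ := GRing.Zmodule_isLmodule.Build T quo_type
  quo_scaleA quo_scale1 quo_scaleDr quo_scaleDl.

Fact proj_linear : linear proj_fun.
Proof. by move=> a x y; rewrite proj_funD; congr (_ + _); rewrite -quo_scale_proj. Qed.
Definition sproj : {linear U -> quo_type} := mklin proj_linear.

Lemma sproj_surj : surjective sproj.
Proof. by move=> q; exists (repr (q : Quotient.quot submod_pred)); exact: proj_fun_repr. Qed.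
Lemma sproj_eq0 x : sproj x = 0 <-> P x.
Proof.
rewrite -[0](raddf0 sproj); split=> [/proj_fun_eqP|Px]; first by rewrite subr0.
by apply: proj_fun_eq; rewrite subr0.
Qed.
End Submodules.

Lemma is_submod_range (T : pzRingType) (U V : lmodType T) (f : {linear U -> V}) :
  is_submod [set v | exists u, f u = v].
Proof.
split=> [|a _ _ [x <-] [y <-]]; first by exists 0; rewrite linear0.
by exists (a *: x + y); rewrite linearP.
Qed.
Definition range_submod (T : pzRingType) (U V : lmodType T) (f : {linear U -> V}) :=
  Submod (is_submod_range f).

Lemma is_submod_ker (T : pzRingType) (U V : lmodType T) (f : {linear U -> V}) :
  is_submod [set u | f u = 0].
Proof.
split=> [|a x y /= x0 y0]; first by rewrite /= linear0.
by rewrite linearP x0 y0 scaler0 addr0.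
Qed.
Definition ker_submod (T : pzRingType) (U V : lmodType T) (f : {linear U -> V}) :=
  Submod (is_submod_ker f).

Lemma linear_inj (T : pzRingType) (U V : lmodType T) (f : {linear U -> V}) :
  (forall x, f x = 0 -> x = 0) -> injective f.
Proof.
move=> f0 x y fxy; apply/eqP; rewrite -subr_eq0; apply/eqP/f0.
by rewrite linearB fxy subrr.
Qed.

Lemma linear_factor_surj (T : pzRingType) (A B V : lmodType T) (p : {linear A -> B})
    (f : {linear A -> V}) :
  surjective p -> (forall x, p x = 0 -> f x = 0) ->
  exists g : {linear B -> V}, forall x, g (p x) = f x.
Proof.
move=> /choice[s sP] pf.
have fE x y : p x = p y -> f x = f y.
  move=> pxy; apply/eqP; rewrite -subr_eq0 -linearB; apply/eqP/pf.
  by rewrite linearB pxy subrr.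
have gl : linear (fun b => f (s b)).
  by move=> a x y; rewrite -linearP; apply: fE; rewrite linearP !sP.
by exists (mklin gl) => x; apply: fE; rewrite sP.
Qed.

Lemma linear_factor_inj (T : pzRingType) (A B V : lmodType T) (i : {linear A -> B})
    (f : {linear V -> B}) :
  injective i -> (forall x, exists a, i a = f x) ->
  exists g : {linear V -> A}, forall x, i (g x) = f x.
Proof.
move=> ii /choice[s sP].
have gl : linear s by move=> a x y; apply: ii; rewrite linearP !sP linearP.
by exists (mklin gl) => x; exact: sP.
Qed.

(** * Tensor-Hom adjunction for character modules *)

Section Adjunction.
Variables (T : pzRingType).

Section Curry.
Variables (N : lmodType T^c) (M : lmodType T).

Lemma rcurry_proof (chi : char (tensor N M)) m : zmod_morphism (fun n => chi (tens n m)).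
Proof.
move=> x y; rewrite -raddfB; congr (chi _).
by apply/eqP; rewrite eq_sym subr_eq -tensDl subrK.
Qed.
Lemma rcurry_linear (chi : char (tensor N M)) :
  linear (fun m => mkadd (rcurry_proof chi m) : rchar N).
Proof.
by move=> a x y; apply: additive_ext => n /=; rewrite tensDr raddfD -tensZ.
Qed.
Definition rcurry (chi : char (tensor N M)) : {linear M -> rchar N} :=
  mklin (rcurry_linear chi).
Lemma rcurryE chi m n : (rcurry chi m : char N) n = chi (tens n m).
Proof. by []. Qed.

Lemma lcurry_proof (chi : char (tensor N M)) n : zmod_morphism (fun m => chi (tens n m)).
Proof.
move=> x y; rewrite -raddfB; congr (chi _).
by apply/eqP; rewrite eq_sym subr_eq -tensDr subrK.
Qed.
Lemma lcurry_linear (chi : char (tensor N M)) :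
  linear (fun n => mkadd (lcurry_proof chi n) : lchar M).
Proof.
by move=> a x y; apply: additive_ext => m /=; rewrite tensDl raddfD tensZ.
Qed.
Definition lcurry (chi : char (tensor N M)) : {linear N -> lchar M} :=
  mklin (lcurry_linear chi).
Lemma lcurryE chi m n : (lcurry chi n : char M) m = chi (tens n m).
Proof. by []. Qed.

Lemma runcurry_balanced (g : {linear M -> rchar N}) :
  balanced (fun n m => (g m : char N) n).
Proof.
split=> [n n' m|n m m'|t n m]; first exact: raddfD.
  by rewrite linearD.
by rewrite linearZ.
Qed.
Definition runcurry (g : {linear M -> rchar N}) : char (tensor N M) :=
  tensor_lift (runcurry_balanced g).
Lemma runcurryE g n m : runcurry g (tens n m) = (g m : char N) n.
Proof. exact: tensor_lift_tens. Qed.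

Lemma luncurry_balanced (g : {linear N -> lchar M}) :
  balanced (fun n m => (g n : char M) m).
Proof.
split=> [n n' m|n m m'|t n m]; [by rewrite linearD|exact: raddfD|].
by rewrite linearZ.
Qed.
Definition luncurry (g : {linear N -> lchar M}) : char (tensor N M) :=
  tensor_lift (luncurry_balanced g).
Lemma luncurryE g n m : luncurry g (tens n m) = (g n : char M) m.
Proof. exact: tensor_lift_tens. Qed.
End Curry.

(** [Hom(M, N^+)] and [Hom(N, M^+)] both consist of the balanced maps
    [N * M -> Q/Z]. *)
Definition flipr (N : lmodType T^c) (M : lmodType T) (g : {linear M -> rchar N}) :
  {linear N -> lchar M} := lcurry (runcurry g).
Definition flipl (N : lmodType T^c) (M : lmodType T) (g : {linear N -> lchar M}) :
  {linear M -> rchar N} := rcurry (luncurry g).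
Lemma fliprE (N : lmodType T^c) (M : lmodType T) (g : {linear M -> rchar N}) n m :
  (flipr g n : char M) m = (g m : char N) n.
Proof. by rewrite /flipr lcurryE runcurryE. Qed.
Lemma fliplE (N : lmodType T^c) (M : lmodType T) (g : {linear N -> lchar M}) n m :
  (flipl g m : char N) n = (g n : char M) m.
Proof. by rewrite /flipl rcurryE luncurryE. Qed.

Section Dual.
Variables (A B : lmodType T) (f : {linear A -> B}).
Lemma ldual_linear : linear (fun chi : lchar B => ((chi : char B) \o f : char A) : lchar A).
Proof. by move=> a x y; apply: additive_ext => u /=; rewrite -linearZ. Qed.
Definition ldual : {linear lchar B -> lchar A} := mklin ldual_linear.
Lemma ldualE chi a : (ldual chi : char A) a = (chi : char B) (f a).
Proof. by []. Qed.
End Dual.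

Section Dualr.
Variables (A B : lmodType T^c) (f : {linear A -> B}).
Lemma rdual_linear : linear (fun chi : rchar B => ((chi : char B) \o f : char A) : rchar A).
Proof. by move=> a x y; apply: additive_ext => u /=; rewrite -linearZ. Qed.
Definition rdual : {linear rchar B -> rchar A} := mklin rdual_linear.
Lemma rdualE chi a : (rdual chi : char A) a = (chi : char B) (f a).
Proof. by []. Qed.
End Dualr.
End Adjunction.

(** * Projectives, injectives and Ext^1 through extension of homomorphisms *)

Lemma free_projective (T : pzRingType) (X : choiceType) : projective (free_mod T X).
Proof.
move=> A B g f /choice[s sP]; exists (free_lift (fun x => s (f (free_gen T x)))).
apply: (@free_ext _ _ _ (g \o free_lift (fun x => s (f (free_gen T x)))) f) => x /=.
by rewrite free_lift_gen.
Qed.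

Lemma free_coverE (T : pzRingType) (M : lmodType T) m :
  @free_cover T M (free_gen T m) = m.
Proof. exact: free_lift_gen. Qed.

Lemma free_cover_surj (T : pzRingType) (M : lmodType T) : surjective (@free_cover T M).
Proof. by move=> m; exists (free_gen T m); exact: free_coverE. Qed.

Definition injective_mod (T : pzRingType) (E : lmodType T) : Prop :=
  forall (A B : lmodType T) (i : {linear A -> B}), injective i ->
  forall g : {linear A -> E}, exists h : {linear B -> E}, forall x, h (i x) = g x.

(** Flipping turns extension along [i] into lifting against the surjection [ldual i], which
    projectivity of [F] solves. *)
Lemma rchar_injective (T : pzRingType) (F : lmodType T^c) :
  projective F -> injective_mod (rchar F).
Proof.
move=> Fp A B i ii g.
have ldual_surj : surjective (ldual i).
  move=> chi; have [psi psiE] := (char_inj i).1 ii chi.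
  by exists psi; apply: additive_ext => x; rewrite ldualE psiE.
have [h hE] := Fp _ _ (ldual i) (flipr g) ldual_surj.
exists (flipl h) => x; apply: additive_ext => n.
by rewrite fliplE -[LHS]/((ldual i (h n) : char A) x) hE fliprE.
Qed.

Section ShortExact.
Variable T : pzRingType.
Implicit Types A B K M N P Q E : lmodType T.

Definition short_exact A B M (i : {linear A -> B}) (p : {linear B -> M}) : Prop :=
  [/\ injective i, exact_at i p & surjective p].

(** Vanishing of Ext^1(M, N), expressed by the extension of homomorphisms. *)
Definition ext1_zero M N : Prop := forall A B (i : {linear A -> B}) (p : {linear B -> M}),
  short_exact i p -> forall g : {linear A -> N},
  exists h : {linear B -> N}, forall x, h (i x) = g x.

(** Lift [h] after [p] to a map from [P] to [B]. On [A] it lands in [N], and subtracting an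
    extension of that map to [P] makes it factor through [M]. One projective presentation of [M]
    thus settles all lifting problems with kernel [N]. *)
Lemma ext1_lift A P M N (i : {linear A -> P}) (p : {linear P -> M}) :
  projective P -> short_exact i p ->
  (forall g : {linear A -> N}, exists h : {linear P -> N}, forall x, h (i x) = g x) ->
  forall B Q (j : {linear N -> B}) (q : {linear B -> Q}), short_exact j q ->
  forall h : {linear M -> Q}, exists k : {linear M -> B}, forall x, q (k x) = h x.
Proof.
move=> Pp [_ ipE ps] ext B Q j q [ji jqE qs] h.
have [k kE] := Pp _ _ q (h \o p) qs.
have [g gE] : exists g : {linear A -> N}, forall x, j (g x) = k (i x).
  apply: (@linear_factor_inj _ _ _ _ j (k \o i)) => // x; apply/jqE; rewrite kE/=.
  by rewrite (_ : p _ = 0) ?linear0//; apply/ipE; exists x.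
have [e eE] := ext g.
have [|k' k'E] := @linear_factor_surj _ _ _ _ p (k - (j \o e : {linear P -> B})) ps.
  by move=> _ /ipE[x <-]; rewrite -[LHS]/(_ - j _) eE gE subrr.
exists k' => x; have [y <-] := ps x; rewrite k'E -[q _]/(q (k y - j (e y))) linearB kE/=.
by rewrite (_ : q (j _) = 0) ?subr0//; apply/jqE; eexists.
Qed.

(** Dual to [ext1_lift]: [g] extends to a map into [E], and lifting the induced map from [M] to [Q]
    gives the correction that brings it back into [N]. *)
Lemma lift_ext1 M N E Q (j : {linear N -> E}) (q : {linear E -> Q}) :
  injective_mod E -> short_exact j q ->
  (forall h : {linear M -> Q}, exists k : {linear M -> E}, forall x, q (k x) = h x) ->
  ext1_zero M N.
Proof.
move=> Ei [ji jqE qs] lft A B i p [ii ipE ps] g.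
have [h hE] := Ei _ _ i ii (j \o g).
have [||h' h'E] := @linear_factor_surj _ _ _ _ p (q \o h) => //.
  by move=> _ /ipE[x <-]/=; rewrite hE; apply/jqE; exists (g x).
have [k kE] := lft h'.
have [|u uE] := @linear_factor_inj _ _ _ _ j (h - (k \o p : {linear B -> E})) ji.
  move=> x; apply/jqE; rewrite -[q _]/(q (h x - k (p x))) linearB kE h'E.
  by rewrite subrr.
exists u => x; apply: ji; rewrite uE -[LHS]/(h (i x) - k (p (i x))) hE/=.
have -> : p (i x) = 0 by apply/ipE; exists x.
by rewrite linear0 subr0.
Qed.

Lemma enough_projectives M : exists (P K : lmodType T) (i : {linear K -> P}) (p : {linear P -> M}),
  projective P /\ short_exact i p.
Proof.
exists (free_mod T M), (ker (free_cover M)), val, (free_cover M).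
split; first exact: free_projective; split; first exact: val_inj.
  move=> x; split=> [x0|[y <-]]; first by exists (exist _ x (introT eqP x0)).
  by apply/eqP; exact: (valP y).
exact: free_cover_surj.
Qed.

(** The character module of a free module mapping onto [lchar N]. Despite the name, the embedding
    [inj_emb] need not be essential. *)
Definition inj_hull N : lmodType T := rchar (free_mod T^c (lchar N)).
Definition inj_emb N : {linear N -> inj_hull N} := flipl (free_cover (lchar N)).
Definition cosyz N : lmodType T := quo_type (range_submod (inj_emb N)).

Lemma inj_hull_injective N : injective_mod (inj_hull N).
Proof. exact/rchar_injective/free_projective. Qed.

Lemma cosyz_exact N : short_exact (inj_emb N) (sproj (range_submod (inj_emb N))).
Proof.
split; [apply: linear_inj => x x0|by move=> x; exact: sproj_eq0|exact: sproj_surj].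
apply: char_eq => chi; rewrite raddf0.
have := congr1 (fun g : char _ => g (free_gen T^c (chi : lchar N))) x0.
by rewrite fliplE free_coverE.
Qed.

(** Dimension shift: both sides express Ext^2(M, N) = 0. One says that maps from [K] to [N'] lift to
    [E], the other that they extend to [P]; injectivity of [E] and projectivity of [P] exchange the
    two. *)
Lemma ext1_shift K P M N E (N' : lmodType T) (i : {linear K -> P}) (p : {linear P -> M})
    (j : {linear N -> E}) (q : {linear E -> N'}) :
  projective P -> short_exact i p -> injective_mod E -> short_exact j q ->
  ext1_zero K N <-> ext1_zero M N'.
Proof.
move=> Pp ip Ei jq.
suff -> : ext1_zero K N <-> forall h : {linear K -> N'},
    exists k : {linear K -> E}, forall x, q (k x) = h x.
  suff -> : ext1_zero M N' <-> forall g : {linear K -> N'},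
      exists h : {linear P -> N'}, forall x, h (i x) = g x.
    have [_ _ qs] := jq; have [ii _ _] := ip; split=> lft h.
      have [k kE] := lft h; have [l lE] := Ei _ _ i ii k.
      by exists (q \o l) => x /=; rewrite lE kE.
    have [k kE] := lft h; have [l lE] := Pp _ _ q k qs.
    by exists (l \o i) => x /=; rewrite lE kE.
  split=> [MN' g|ext]; first exact: MN' ip g.
  exact: lift_ext1 (@inj_hull_injective N') (cosyz_exact N')
    (ext1_lift Pp ip ext (cosyz_exact N')).
split=> [KN h|lft]; last exact: lift_ext1 Ei jq lft.
have [P' [K' [i' [p' [Pp' ip']]]]] := enough_projectives K.
have e := KN _ _ i' p' ip'; exact: (ext1_lift Pp' ip' e jq h).
Qed.
End ShortExact.

(** * Vanishing of Ext *)

Lemma homology_trivial (U V W : zmodType) (f : {additive U -> V}) (g : {additive V -> W}) :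
  is_trivial (homology f g) <-> forall v, g v = 0 -> exists u, f u = v.
Proof.
split=> [h v gv|ex x].
  have cv : cycle_pred g v by apply/eqP.
  pose z : cycles g := exist _ v cv.
  have := h (\pi_(homology f g)%qT z); rewrite -[0](raddf0 (\pi_(homology f g)%qT)).
  by move/eqP; rewrite -Quotient.idealrBE subr0 => /asboolP[u uv]; exists u.
rewrite -[x]reprK -[RHS](raddf0 (\pi_(homology f g)%qT)).
apply/eqP; rewrite -Quotient.idealrBE subr0; apply/asboolP/ex.
exact/eqP/(valP (repr x)).
Qed.

Section Ext.
Variable T : pzRingType.
Implicit Types M N K P : lmodType T.

Definition hom_exact_at (A B D N : lmodType T) (d : {linear A -> B}) (e : {linear B -> D}) :=
  forall f : {linear B -> N}, (forall x, f (d x) = 0) ->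
  exists g : {linear D -> N}, forall x, g (e x) = f x.

(** [Ext^i(M, N) = 0] for all [i >= 1], computed from an injective coresolution of [N]. *)
Definition ext_zero M N : Prop := forall n, ext1_zero M (iter n (@cosyz T) N).

Lemma ext_zero_shift K P M N (i : {linear K -> P}) (p : {linear P -> M}) n :
  projective P -> short_exact i p ->
  ext1_zero K (iter n (@cosyz T) N) <-> ext1_zero M (iter n.+1 (@cosyz T) N).
Proof. by move=> Pp ip; apply: ext1_shift Pp ip (@inj_hull_injective _ _) (cosyz_exact _). Qed.

Lemma ker_exact (U V : lmodType T) (g : {linear U -> V}) : surjective g ->
  short_exact (val : {linear ker g -> U}) g.
Proof.
move=> gs; split=> // x. split=> [x0|[y <-]]; first by exists (exist _ x (introT eqP x0)).
by apply/eqP; exact: (valP y).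
Qed.

Section Resolution.
Variables (M : lmodType T) (P : projective_resolution M).

Local Notation K1 := (ker (pres_aug P)).

Fact tail_aug_exists : exists a : {linear P 1 -> K1}, forall x, val (a x) = pres_d P 0%N x.
Proof.
have [|x|a aE] := @linear_factor_inj _ _ _ _ (val : {linear K1 -> P 0%N}) (pres_d P 0%N).
- exact: val_inj.
- have [_ /(_ (ex_intro _ x erefl)) h] := @pres_exact0 _ _ P (pres_d P 0%N x).
  by exists (exist _ (pres_d P 0%N x) (introT eqP h)).
- by exists a.
Qed.
Definition tail_aug := projT1 (cid tail_aug_exists).
Lemma tail_augE x : val (tail_aug x) = pres_d P 0%N x.
Proof. exact: (projT2 (cid tail_aug_exists)). Qed.

Fact tail_surj : surjective tail_aug.
Proof.
move=> [x x0]; have [y yx] := (@pres_exact0 _ _ P x).1 (eqP x0).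
by exists y; apply: val_inj; rewrite tail_augE.
Qed.
Fact tail_exact0 : exact_at (pres_d P 1%N) tail_aug.
Proof.
move=> y; split=> [y0|/(@pres_exactS _ _ P _ _)y0].
  by apply/(@pres_exactS _ _ P _ _); rewrite -tail_augE y0.
by apply: val_inj; rewrite tail_augE.
Qed.
Definition tail : projective_resolution K1 :=
  @Build_projective_resolution T K1 (fun n => P n.+1) (fun n => pres_d P n.+1) tail_aug
    (fun n => @pres_projective _ _ P n.+1) tail_surj tail_exact0
    (fun n => @pres_exactS _ _ P n.+1).
End Resolution.

(** The right side does not mention [P], so vanishing of Ext can be read off from any projective
    resolution. The induction passes to [tail], which resolves the first syzygy, and moves the
    degree into [N]. *)
Lemma hom_exact_ext1 M (P : projective_resolution M) N n :
  hom_exact_at N (pres_d P n.+1) (pres_d P n) <->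
  ext1_zero M (iter n (@cosyz T) N).
Proof.
elim: n M P => [|n IH] M P; last first.
  rewrite -(ext_zero_shift N n (@pres_projective _ _ P 0%N) (ker_exact (@pres_surjective _ _ P))).
  exact: IH _ (tail P).
have ip := ker_exact (@pres_surjective _ _ P).
split=> [ex|/= MN f f0].
  apply: lift_ext1 (@inj_hull_injective _ N) (cosyz_exact N) _.
  apply: ext1_lift (@pres_projective _ _ P 0%N) ip _ _ _ _ _ (cosyz_exact N) => g.
  have [|h hE] := ex (g \o tail_aug P).
    move=> x /=; suff -> : tail_aug P (pres_d P 1%N x) = 0 by rewrite linear0.
    by apply/tail_exact0; exists x.
  exists h => x; have [y <-] := tail_surj x.
  by rewrite /= tail_augE hE.
have [|g gE] := @linear_factor_surj _ _ _ _ (tail_aug P) f (@tail_surj _ P).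
  by move=> x /tail_exact0[y <-].
have [h hE] := MN _ _ _ _ ip g.
by exists h => x; rewrite -tail_augE hE gE.
Qed.

Section FreeResolution.
Variable M : lmodType T.

Lemma cover_exact (K : lmodType T) :
  short_exact (val : {linear ker (@free_cover T K) -> free_mod T K}) (@free_cover T K).
Proof. exact/ker_exact/free_cover_surj. Qed.

Fact res_exactS n : exact_at (res_d M n.+1) (res_d M n).
Proof.
move=> y; rewrite /res_d/=; have [_ ex _] := cover_exact (syzygy M n.+1).
have [vi _ _] := cover_exact (syzygy M n).
split=> [y0|[x <-]].
  have /ex[z zy] : free_cover (syzygy M n.+1) y = 0 by apply: vi; rewrite linear0.
  by have [x zx] := free_cover_surj z; exists x => /=; rewrite zx.
rewrite (_ : free_cover _ _ = 0) ?linear0//=.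
by apply/ex; eexists.
Qed.
Fact res_exact0 : exact_at (res_d M 0%N) (free_cover M).
Proof.
move=> y; have [_ ex _] := cover_exact M; split=> [/ex[z zy]|[x <-]].
  by have [x zx] := free_cover_surj z; exists x => /=; rewrite zx.
by apply/ex; eexists.
Qed.
Definition free_resolution : projective_resolution M :=
  @Build_projective_resolution T M (res M) (res_d M) (free_cover M)
    (fun n => @free_projective T (syzygy M n)) (@free_cover_surj T M) res_exact0 res_exactS.
End FreeResolution.

Lemma Ext_trivial M N n :
  is_trivial (Ext T n.+1 M N) <-> ext1_zero M (iter n (@cosyz T) N).
Proof.
rewrite -(hom_exact_ext1 (free_resolution M)) homology_trivial; split=> ex f f0.
  have [|g gE] := ex f; first by apply: linear_ext => x; rewrite /= f0.
  by exists g => x; rewrite -gE.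
have [|g gE] := ex f; first by move=> x; exact: (congr1 (fun h : {linear _ -> _} => h x) f0).
by exists g; apply: linear_ext => x; rewrite -gE.
Qed.

Lemma Ext_zeroP M N :
  (forall i, (1 <= i)%N -> is_trivial (Ext T i M N)) <-> ext_zero M N.
Proof.
split=> [h n|h [//|n] _]; first exact/Ext_trivial/h.
exact/Ext_trivial/h.
Qed.

Lemma ext_zero_resolution M (P : projective_resolution M) N :
  ext_zero M N <-> forall n, hom_exact_at N (pres_d P n.+1) (pres_d P n).
Proof. by split=> h n; apply/hom_exact_ext1/h. Qed.
End Ext.

(** * Balance of Tor *)

Lemma bij_inj_surj (U V : Type) (f : U -> V) : bijective f <-> injective f /\ surjective f.
Proof.
split=> [[g fK gK]|[fi /choice[g gK]]]; first by split; [exact: can_inj fK|move=> y; exists (g y)].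
by exists g => // x; apply: fi; rewrite gK.
Qed.

Section Cdual.
Variables (U V : zmodType) (f : {additive U -> V}).
Definition cdual_fun (chi : char V) : char U := chi \o f.
Lemma cdual_additive : zmod_morphism cdual_fun.
Proof. by move=> x y; apply: additive_ext. Qed.
Definition cdual : {additive char V -> char U} := mkadd cdual_additive.
Lemma cdualE chi u : cdual chi u = chi (f u). Proof. by []. Qed.

Lemma cdual_bij : bijective cdual <-> bijective f.
Proof.
have Ep : surjective cdual <-> injective f.
  rewrite char_inj; split=> s chi; have [psi h] := s chi; exists psi.
    by move=> u; rewrite -h.
  by apply: additive_ext => u; rewrite cdualE.
have Mo : injective cdual <-> surjective f.
  rewrite char_surj; split=> i.
    move=> chi chi0 v; have -> : chi = 0 by apply: i; rewrite raddf0; apply: additive_ext.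
    by [].
  move=> x y xy; apply/eqP; rewrite -subr_eq0; apply/eqP; apply: additive_ext.
  by apply: i => u; rewrite -cdualE raddfB xy subrr.
by rewrite !bij_inj_surj Ep Mo; split=> -[].
Qed.
End Cdual.

Definition exact_mid (U V W : zmodType) (f : {additive U -> V}) (g : {additive V -> W}) :=
  forall v, g v = 0 -> exists u, f u = v.

Lemma exact_cdual (U V W : zmodType) (f : {additive U -> V}) (g : {additive V -> W}) :
  exact_mid f g <-> exact_mid (cdual g) (cdual f).
Proof.
rewrite [exact_mid f g]char_exact; split=> ex chi chi0.
  have [|psi h] := ex chi; first by move=> u; rewrite -cdualE chi0.
  by exists psi; apply: additive_ext => v; rewrite cdualE h.
have [|psi <-] := ex chi; first by apply: additive_ext => u; rewrite cdualE chi0.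
by exists psi.
Qed.

Lemma ext1_zero_lift (T : pzRingType) (M N : lmodType T) : ext1_zero M N ->
  forall (B Q : lmodType T) (j : {linear N -> B}) (q : {linear B -> Q}), short_exact j q ->
  forall h : {linear M -> Q}, exists k : {linear M -> B}, forall x, q (k x) = h x.
Proof.
move=> MN; have [P [K [i [p [Pp ip]]]]] := enough_projectives M.
have e := MN _ _ i p ip; exact: ext1_lift Pp ip e.
Qed.

Section Balance.
Variable T : pzRingType.

Lemma short_exact_ldual (A B M : lmodType T) (i : {linear A -> B}) (p : {linear B -> M}) :
  short_exact i p -> short_exact (ldual p) (ldual i).
Proof.
move=> [ii ipE ps]; split.
- apply: linear_inj => chi chi0; apply: additive_ext => m; have [x <-] := ps m.
  by rewrite -[LHS]ldualE chi0.
- move=> chi; split=> [chi0|[psi <-]]; last first.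
    apply: additive_ext => x; rewrite !ldualE.
    by rewrite (_ : p _ = 0) ?raddf0//; apply/ipE; exists x.
  have [psi psiE] : exists psi : char M, forall b, psi (p b) = (chi : char B) b.
    apply: (char_exact i p).1 => [v /ipE//|u].
    by rewrite -[LHS]ldualE chi0.
  by exists psi; apply: additive_ext => b; rewrite ldualE psiE.
- move=> chi; have [psi psiE] := (char_inj i).1 ii chi.
  by exists psi; apply: additive_ext => x; rewrite ldualE psiE.
Qed.

Lemma short_exact_rdual (A B M : lmodType T^c) (i : {linear A -> B}) (p : {linear B -> M}) :
  short_exact i p -> short_exact (rdual p) (rdual i).
Proof.
move=> [ii ipE ps]; split.
- apply: linear_inj => chi chi0; apply: additive_ext => m; have [x <-] := ps m.
  by rewrite -[LHS]rdualE chi0.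
- move=> chi; split=> [chi0|[psi <-]]; last first.
    apply: additive_ext => x; rewrite !rdualE.
    by rewrite (_ : p _ = 0) ?raddf0//; apply/ipE; exists x.
  have [psi psiE] : exists psi : char M, forall b, psi (p b) = (chi : char B) b.
    apply: (char_exact i p).1 => [v /ipE//|u].
    by rewrite -[LHS]rdualE chi0.
  by exists psi; apply: additive_ext => b; rewrite rdualE psiE.
- move=> chi; have [psi psiE] := (char_inj i).1 ii chi.
  by exists psi; apply: additive_ext => x; rewrite rdualE psiE.
Qed.

(** Both sides express Tor_1(N, M) = 0. Dualizing the short exact sequence and flipping the map
    turns extension along [i] into lifting against its dual. *)
Lemma ext1_balance (N : lmodType T^c) (M : lmodType T) :
  ext1_zero N (lchar M) <-> ext1_zero M (rchar N).
Proof.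
split=> ext A B i p ip g.
  have [h hE] := ext1_zero_lift ext (short_exact_ldual ip) (flipr g).
  exists (flipl h) => x; apply: additive_ext => n.
  by rewrite fliplE -[LHS]ldualE hE fliprE.
have [h hE] := ext1_zero_lift ext (short_exact_rdual ip) (flipl g).
exists (flipr h) => x; apply: additive_ext => n.
by rewrite fliprE -[LHS]rdualE hE fliplE.
Qed.
End Balance.

Lemma ext1_syzygy (T : pzRingType) (M N : lmodType T) n :
  ext1_zero (syzygy M n) N <-> ext1_zero M (iter n (@cosyz T) N).
Proof.
elim: n N => [//|n IH] N; rewrite iterSr -IH.
exact: (ext_zero_shift N 0 (@free_projective _ _) (cover_exact (syzygy M n))).
Qed.

Lemma ext_balance (T : pzRingType) (N : lmodType T^c) (M : lmodType T) :
  ext_zero N (lchar M) <-> ext_zero M (rchar N).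
Proof.
(* The dual of the free cover of [syzygy N n] has an injective middle term. A syzygy taken in [N] is
   therefore a cosyzygy of the character module, and can be traded for a syzygy taken in [M]. *)
have shift n k : ext1_zero (syzygy M k) (rchar (syzygy N n)) <->
    ext1_zero (syzygy M (n + k)) (rchar N).
  elim: n k => [//|n IH] k; rewrite addSnnS -IH.
  have ip := short_exact_rdual (cover_exact (syzygy N n)).
  rewrite -(ext1_shift (@free_projective _ _) (cover_exact (syzygy M k)) _ ip)//.
  exact/rchar_injective/free_projective.
split=> h n.
  rewrite -ext1_syzygy -[n]addn0 -shift/= -ext1_balance.
  exact/ext1_syzygy.
by rewrite -ext1_syzygy ext1_balance (shift n 0)%N addn0 ext1_syzygy.
Qed.

(** The character group of Tor is Ext(N, M^+), by the adjunction applied to the resolving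
    complex. *)
Lemma Tor_trivial (T : pzRingType) (N : lmodType T^c) (M : lmodType T) n :
  is_trivial (Tor T n.+1 N M) <-> hom_exact_at (lchar M) (res_d N n.+1) (res_d N n).
Proof.
rewrite homology_trivial char_exact; split=> ex f f0.
  have [|psi psiE] := ex (luncurry f).
    apply: (@tensor_ext _ _ _ _ (luncurry f \o tensor_map (res_d N n.+1) (idfun : {linear M -> M})) \0).
    by move=> x m; rewrite /= tensor_map_tens luncurryE f0.
  exists (lcurry psi) => x; apply: additive_ext => m; rewrite lcurryE.
  by rewrite -luncurryE -psiE /= tensor_map_tens.
have [|g gE] := ex (lcurry f).
  by move=> x; apply: additive_ext => m; rewrite lcurryE -[m]/(idfun m) -tensor_map_tens f0.
exists (luncurry g).
apply: (@tensor_ext _ _ _ _ (luncurry g \o tensor_map (res_d N n) (idfun : {linear M -> M})) f).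
by move=> x m; rewrite /= tensor_map_tens luncurryE gE.
Qed.

Lemma Tor_zeroP (T : pzRingType) (N : lmodType T^c) (M : lmodType T) :
  (forall i, (1 <= i)%N -> is_trivial (Tor T i N M)) <-> ext_zero N (lchar M).
Proof.
rewrite (ext_zero_resolution (free_resolution N)).
by split=> [h n|h [//|n] _]; apply/Tor_trivial/h.
Qed.

(** * Double duals *)

Lemma bijective_compl (U V W : Type) (g : V -> W) (f : U -> V) (h : U -> W) :
  bijective g -> (forall x, g (f x) = h x) -> bijective h <-> bijective f.
Proof.
move=> gb gf; have [k kK gK] := gb; split=> [hb|fb].
  by apply: (@eq_bij _ _ (k \o h)) => [|x /=]; [apply: bij_comp => //; exists g|rewrite -gf kK].
by apply: (@eq_bij _ _ (g \o f)) => [|x /=]; [exact: bij_comp|rewrite gf].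
Qed.

Section DoubleDual.
Variables (T : pzRingType) (X : lmodType T).

(** Stated for an arbitrary ring so as to serve left and right modules alike: [ddual_rl] and
    [ddual_lr], both the identity on functions, identify it with [rchar (lchar M)] and
    [lchar (rchar M)]. *)
Definition ddual_type : Type := {additive char X -> QmodZ}.
HB.instance Definition _ := GRing.Zmodule.on ddual_type.

Fact scale_additive (t : T) : zmod_morphism ( *:%R t : X -> X).
Proof. by move=> x y; rewrite scalerBr. Qed.
Definition cscale (t : T) : {additive char X -> char X} := cdual (mkadd (scale_additive t)).
Lemma cscaleE t chi x : cscale t chi x = chi (t *: x). Proof. by []. Qed.

Definition ddual_scale (t : T) (psi : ddual_type) : ddual_type :=
  (psi : {additive char X -> QmodZ}) \o cscale t.

Fact ddual_scaleA a b psi : ddual_scale a (ddual_scale b psi) = ddual_scale (a * b) psi.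
Proof.
apply: additive_ext => chi /=; congr ((psi : {additive char X -> QmodZ}) _).
by apply: additive_ext => x /=; rewrite scalerA.
Qed.
Fact ddual_scale1 : left_id 1 ddual_scale.
Proof.
move=> psi; apply: additive_ext => chi /=; congr ((psi : {additive char X -> QmodZ}) _).
by apply: additive_ext => x /=; rewrite scale1r.
Qed.
Fact ddual_scaleDr : right_distributive ddual_scale +%R.
Proof. by move=> a f g; apply: additive_ext. Qed.
Fact ddual_scaleDl psi : {morph ddual_scale^~ psi : a b / a + b}.
Proof.
move=> a b; apply: additive_ext => chi /=.
rewrite -[RHS](raddfD (psi : {additive char X -> QmodZ})).
congr ((psi : {additive char X -> QmodZ}) _).
by apply: additive_ext => x /=; rewrite scalerDl raddfD.
Qed.
HB.instance Definition _ := GRing.Zmodule_isLmodule.Build T ddual_type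
  ddual_scaleA ddual_scale1 ddual_scaleDr ddual_scaleDl.
Definition ddual : lmodType T := ddual_type.

Fact ev_additive (x : X) : zmod_morphism (fun chi : char X => chi x).
Proof. by []. Qed.
Fact ddual_ev_linear : linear (fun x : X => mkadd (ev_additive x) : ddual).
Proof. by move=> a x y; apply: additive_ext => chi /=; rewrite raddfD. Qed.
Definition ddual_ev : {linear X -> ddual} := mklin ddual_ev_linear.
Lemma ddual_evE x chi : (ddual_ev x : {additive char X -> QmodZ}) chi = chi x. Proof. by []. Qed.
End DoubleDual.

Section DoubleDualIso.
Variable T : pzRingType.
Fact ddual_rl_linear (M : lmodType T) : linear (fun psi : ddual M => psi : rchar (lchar M)).
Proof.
move=> a x y; apply: additive_ext => chi; congr (_ + _).
by congr ((x : {additive _ -> QmodZ}) _); apply: additive_ext.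
Qed.
Definition ddual_rl M : {linear ddual M -> rchar (lchar M)} := mklin (@ddual_rl_linear M).
Fact ddual_lr_linear (M : lmodType T^c) : linear (fun psi : ddual M => psi : lchar (rchar M)).
Proof.
move=> a x y; apply: additive_ext => chi; congr (_ + _).
by congr ((x : {additive _ -> QmodZ}) _); apply: additive_ext.
Qed.
Definition ddual_lr M : {linear ddual M -> lchar (rchar M)} := mklin (@ddual_lr_linear M).
Lemma ddual_rl_bij M : bijective (ddual_rl M). Proof. by exists id. Qed.
Lemma ddual_lr_bij M : bijective (ddual_lr M). Proof. by exists id. Qed.
End DoubleDualIso.

Lemma ext_zero_retract (T : pzRingType) (M N N' : lmodType T)
    (s : {linear N' -> N}) (r : {linear N -> N'}) :
  (forall x, r (s x) = x) -> ext_zero M N -> ext_zero M N'.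
Proof.
move=> rs; rewrite !(ext_zero_resolution (free_resolution M)) => MN n f f0.
have [|g gE] := MN n (s \o f); first by move=> x; rewrite /= f0 linear0.
by exists (r \o g) => x; rewrite /= gE /= rs.
Qed.

Lemma linear_inverse (T : pzRingType) (N N' : lmodType T) (f : {linear N -> N'}) :
  bijective f -> exists g : {linear N' -> N}, cancel f g /\ cancel g f.
Proof.
case=> g fK gK; have gl : linear g by move=> a x y; apply: (can_inj fK); rewrite linearP !gK.
by exists (mklin gl).
Qed.

Lemma ext_zero_iso (T : pzRingType) (M N N' : lmodType T) (f : {linear N -> N'}) :
  bijective f -> ext_zero M N <-> ext_zero M N'.
Proof.
move=> /linear_inverse[g [fK gK]].
by split; [exact: (@ext_zero_retract _ _ _ _ g f)|exact: (@ext_zero_retract _ _ _ _ f g)].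
Qed.

Lemma postcomp_bij (T : pzRingType) (M N N' : lmodType T) (f : {linear N -> N'}) :
  bijective f -> bijective (fun g : {linear M -> N} => (f \o g : {linear M -> N'})).
Proof.
move=> /linear_inverse[g [fK gK]].
by exists (fun h : {linear M -> N'} => (g \o h : {linear M -> N})) => h;
  apply: linear_ext => x /=; rewrite ?fK ?gK.
Qed.

Lemma luncurry_bij (T : pzRingType) (N : lmodType T^c) (M : lmodType T) :
  bijective (@luncurry T N M).
Proof.
exists (@lcurry T N M) => [g|chi].
  by apply: linear_ext => n; apply: additive_ext => m; rewrite lcurryE luncurryE.
by apply/additive_ext/tensor_ext => n m; rewrite luncurryE lcurryE.
Qed.

Lemma runcurry_bij (T : pzRingType) (N : lmodType T^c) (M : lmodType T) :
  bijective (@runcurry T N M).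
Proof.
exists (@rcurry T N M) => [g|chi].
  by apply: linear_ext => m; apply: additive_ext => n; rewrite rcurryE runcurryE.
by apply/additive_ext/tensor_ext => n m; rewrite runcurryE rcurryE.
Qed.

Section Evaluation.
Variables (T : pzRingType) (X : lmodType T).
Local Notation Hom P := {linear P -> X}.
Local Notation cc V := (char (char V)).

Section EvP.
Variables (P : lmodType T).
Fact evp_additive (p : P) (phi : char X) : zmod_morphism (fun g : Hom P => phi (g p)).
Proof. by move=> g h; rewrite -raddfB. Qed.
(** The image of the elementary tensor of [phi] and [p] under X^+ (x) P -> Hom(P, X)^+. *)
Definition evp p phi : char (Hom P) := mkadd (evp_additive p phi).

Fact nu_additive (Psi : cc (Hom P)) p : zmod_morphism (fun phi => Psi (evp p phi)).
Proof. by move=> phi psi; rewrite -raddfB; congr (Psi _); apply: additive_ext. Qed.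
Fact nu_linear (Psi : cc (Hom P)) : linear (fun p => mkadd (nu_additive Psi p) : ddual X).
Proof.
move=> a x y; apply: additive_ext => phi /=; rewrite -[RHS](raddfD Psi); congr (Psi _).
by apply: additive_ext => g /=; rewrite linearP raddfD.
Qed.
(** The natural map [Hom(P, X)^{++} -> Hom(P, X^{++})], which is
    [(P^* (x) X)^{++} = P^* (x) X^{++}] when [P] is finitely generated projective. *)
Definition nu (Psi : cc (Hom P)) : {linear P -> ddual X} := mklin (nu_linear Psi).
Lemma nuE Psi p phi : (nu Psi p : cc X) phi = Psi (evp p phi). Proof. by []. Qed.
End EvP.

Lemma nu_natural (P Q : lmodType T) (d : {linear P -> Q}) Psi p :
  nu (cdual (cdual (@precomp T _ _ X d)) Psi) p = nu Psi (d p).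
Proof.
apply: additive_ext => phi; rewrite !nuE cdualE; congr (Psi _).
by apply: additive_ext.
Qed.

Lemma dual_basis (P : lmodType T) : projective P -> finitely_generated P ->
  exists n (v : 'I_n -> P) (c : 'I_n -> {linear P -> T^o}),
    forall p, p = \sum_(i < n) (c i p : T) *: v i.
Proof.
move=> Pp [n [v vP]].
pose F : lmodType T := dprod_mod (fun _ : 'I_n => T^o).
have lF : linear (fun a : F => \sum_(i < n) (a i : T) *: v i).
  move=> t a b; rewrite scaler_sumr -big_split; apply: eq_bigr => i _ /=.
  by rewrite scalerA -scalerDl.
have [|s sK] := Pp _ _ (mklin lF) (idfun : {linear P -> P}).
  by move=> x; have [a ->] := vP x; exists (a : F).
have lc (i : 'I_n) : linear (fun p => s p i : T^o) by move=> t a b; rewrite linearP.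
by exists n, v, (fun i => mklin (lc i)) => p; rewrite -[LHS]sK.
Qed.

Section Finite.
Variables (P : lmodType T) (Pp : projective P) (Pf : finitely_generated P).

Lemma nu_inj_fgp : injective (@nu P).
Proof.
have [n [v [c cP]]] := dual_basis Pp Pf.
have lE (i : 'I_n) (x : X) : linear (fun p : P => (c i p : T) *: x).
  by move=> t a b; rewrite linearP scalerDl scalerA.
have aphi (F : char (Hom P)) (i : 'I_n) : zmod_morphism (fun x => F (mklin (lE i x))).
  move=> x y; rewrite -raddfB; congr (F _); apply: linear_ext => p /=.
  by rewrite scalerBr.
(* A map [g] is the sum of the maps [c i] times [g (v i)], so every character of [Hom P] is a finite
   sum of evaluations at the [v i]. Hence [nu Psi] determines [Psi]. *)
have dec (F : char (Hom P)) : F = \sum_(i < n) evp (v i) (mkadd (aphi F i)).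
  apply: additive_ext => g.
  have -> : (\sum_(i < n) evp (v i) (mkadd (aphi F i))) g =
      \sum_(i < n) evp (v i) (mkadd (aphi F i)) g.
    by elim/big_rec2: _ => // i a b _ <-.
  rewrite -raddf_sum; congr (F _); apply: linear_ext => p.
  have -> : (\sum_(i < n) mklin (lE i (g (v i)))) p = \sum_(i < n) mklin (lE i (g (v i))) p.
    by elim/big_rec2: _ => // i a b _ <-.
  by rewrite {1}(cP p) linear_sum; apply: eq_bigr => i _; rewrite linearZZ.
move=> Psi Phi e; apply: additive_ext => F; rewrite (dec F) !raddf_sum.
by apply: eq_bigr => i _; rewrite -!nuE e.
Qed.

Lemma nu_surj_fgp : surjective (@nu P).
Proof.
have [n [v [c cP]]] := dual_basis Pp Pf.
have lE (i : 'I_n) (x : X) : linear (fun p : P => (c i p : T) *: x).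
  by move=> t a b; rewrite linearP scalerDl scalerA.
have aphi (F : char (Hom P)) (i : 'I_n) : zmod_morphism (fun x => F (mklin (lE i x))).
  move=> x y; rewrite -raddfB; congr (F _); apply: linear_ext => p /=.
  by rewrite scalerBr.
move=> psi.
(* The preimage is forced by the decomposition of a character into evaluations at the [v i]. *)
have aPsi : zmod_morphism (fun F : char (Hom P) =>
    \sum_(i < n) (psi (v i) : cc X) (mkadd (aphi F i))).
  move=> F G; rewrite -sumrB; apply: eq_bigr => i _.
  by rewrite -raddfB; congr ((psi _ : cc X) _); apply: additive_ext.
exists (mkadd aPsi); apply: linear_ext => p; apply: additive_ext => phi.
rewrite nuE /= [in RHS](cP p) linear_sum.
have -> : forall w : 'I_n -> ddual X, ((\sum_(i < n) w i : ddual X) : cc X) phi =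
    \sum_(i < n) (w i : cc X) phi.
  by move=> w; elim/big_rec2: _ => // i a b _ <-.
apply: eq_bigr => i _; rewrite linearZZ -[RHS]/((psi (v i) : cc X) (cscale X (c i p) phi)).
by congr ((psi _ : cc X) _); apply: additive_ext.
Qed.
End Finite.

(** Both Hom(-, X)^{++} and Hom(-, X^{++}) turn P1 -> P0 -> C -> 0 into a left exact sequence, and
    [nu] is bijective at P0 and P1. *)
Lemma nu_bij (C : lmodType T) : has_fg_projective_resolution C -> bijective (@nu C).
Proof.
move=> [P Pf]; have Pp n := @pres_projective _ _ P n.
pose a := @precomp T _ _ X (pres_aug P); pose d := @precomp T _ _ X (pres_d P 0%N).
have exd : exact_mid a d.
  move=> f f0.
  have [|g gE] := @linear_factor_surj _ _ _ _ (pres_aug P) f (@pres_surjective _ _ P).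
    move=> x /(@pres_exact0 _ _ P)[y <-].
    exact: (congr1 (fun h : {linear _ -> _} => h y) f0).
  by exists g; apply: linear_ext => x; rewrite -gE.
have ai : injective a.
  move=> f g fg; apply: linear_ext => x; have [y <-] := @pres_surjective _ _ P x.
  exact: (congr1 (fun h : {linear _ -> _} => h y) fg).
have cca : injective (cdual (cdual a)).
  have : surjective (cdual a).
    move=> chi; have [psi h] := (char_inj a).1 ai chi.
    by exists psi; apply: additive_ext => u; rewrite cdualE.
  move=> s x y xy; apply: additive_ext => F; have [G <-] := s F.
  exact: (congr1 (fun k : char (char _) => k G) xy).
apply/bij_inj_surj; split=> [x y xy|psi].
  apply/cca/(nu_inj_fgp (Pp 0%N) (Pf 0%N))/linear_ext => p.
  by rewrite !nu_natural xy.
have [Psi0 Psi0E] := nu_surj_fgp (Pp 0%N) (Pf 0%N) (psi \o pres_aug P).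
have /exact_cdual/exact_cdual/(_ Psi0)[|Psi PsiE] := exd.
  apply: (nu_inj_fgp (Pp 1%N) (Pf 1%N)); apply: linear_ext => p.
  rewrite nu_natural Psi0E /= (_ : pres_aug P _ = 0); last first.
    by apply/(@pres_exact0 _ _ P); exists p.
  by rewrite linear0; apply: additive_ext.
exists Psi; apply: linear_ext => x; have [y <-] := @pres_surjective _ _ P x.
by rewrite -nu_natural PsiE Psi0E.
Qed.

(** By naturality [nu] identifies the double character group of the complex Hom(P, X) with Hom(P,
    X^{++}), and taking characters preserves and reflects exactness. *)
Lemma ext_zero_ddual (C : lmodType T) : has_fg_projective_resolution C ->
  ext_zero C X <-> ext_zero C (ddual X).
Proof.
move=> [P Pf]; have Pp n := @pres_projective _ _ P n.
rewrite !(ext_zero_resolution P).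
have E n : hom_exact_at X (pres_d P n.+1) (pres_d P n) <->
    exact_mid (@precomp T _ _ X (pres_d P n)) (@precomp T _ _ X (pres_d P n.+1)).
  split=> ex f f0.
    have [|g gE] := ex f; last by exists g; apply: linear_ext.
    by move=> x; exact: (congr1 (fun h : {linear _ -> _} => h x) f0).
  have [|g gE] := ex f; first by apply: linear_ext.
  by exists g => x; rewrite -gE.
suff E' n : hom_exact_at (ddual X) (pres_d P n.+1) (pres_d P n) <->
    exact_mid (cdual (cdual (@precomp T _ _ X (pres_d P n))))
              (cdual (cdual (@precomp T _ _ X (pres_d P n.+1)))).
  split=> h n; first exact: (E' n).2 ((exact_cdual _ _).1 ((exact_cdual _ _).1 ((E n).1 (h n)))).
  exact: (E n).2 ((exact_cdual _ _).2 ((exact_cdual _ _).2 ((E' n).1 (h n)))).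
have nui k := nu_inj_fgp (Pp k) (Pf k); have nus k := nu_surj_fgp (Pp k) (Pf k).
split=> ex f f0.
  have [|g gE] := ex (nu f).
    by move=> x; rewrite -nu_natural f0; apply: additive_ext.
  have [Psi PsiE] := nus _ g; exists Psi; apply: nui; apply: linear_ext => p.
  by rewrite nu_natural PsiE gE.
have [Psi PsiE] := nus _ f; have [|Phi PhiE] := ex Psi.
  apply: nui; apply: linear_ext => p; rewrite nu_natural PsiE f0.
  by apply: additive_ext.
by exists (nu Phi) => x; rewrite -nu_natural PhiE PsiE.
Qed.
End Evaluation.

(** * Duality between the two classes *)

Section Classes.
Variables (R S : pzRingType) (C : bimodule R S).

Lemma auslanderP (N : lmodType R^c) : auslander_class C N <->
  [/\ ext_zero C (rchar N), ext_zero (bim_right C) (tensC C N) & bijective (@mu R S C N)].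
Proof.
split=> [[h1 h2 h3]|[h1 h2 h3]].
  by split=> //; [apply/ext_balance/Tor_zeroP|apply/Ext_zeroP].
by split=> //; [apply/Tor_zeroP/ext_balance|apply/Ext_zeroP].
Qed.

Lemma bassP (M : lmodType R) : bass_class C M <->
  [/\ ext_zero C M, ext_zero (bim_right C) (lchar (homC C M)) & bijective (@theta R S C M)].
Proof.
split=> [[h1 h2 h3]|[h1 h2 h3]].
  by split=> //; [apply/Ext_zeroP|apply/Tor_zeroP].
by split=> //; [apply/Ext_zeroP|apply/Tor_zeroP].
Qed.

Section DualOfRight.
Variable N : lmodType R^c.
Local Notation X := (tensC C N).
Local Notation H := (homC C (rchar N)).

Lemma rchar_tensC_ext (f g : rchar X) :
  (forall n (c : C), (f : char (tensor N C)) (tens n c) = (g : char (tensor N C)) (tens n c)) ->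
  f = g.
Proof. by move=> h; apply: additive_ext; exact: (@tensor_ext _ _ _ _ f g). Qed.

Fact homC_rchar_linear : linear (fun h : H => runcurry (h : {linear C -> rchar N}) : rchar X).
Proof.
move=> s h g; apply: rchar_tensC_ext => n c.
rewrite runcurryE.
rewrite -[RHS]/(runcurry (h : {linear C -> rchar N}) (tensC_scale s (tens n c)) +
  runcurry (g : {linear C -> rchar N}) (tens n c)).
by rewrite tensC_scale_tens !runcurryE.
Qed.
Definition homC_rchar : {linear H -> rchar X} := mklin homC_rchar_linear.

Lemma homC_rchar_bij : bijective homC_rchar.
Proof.
exists (fun chi : rchar X => rcurry (chi : char (tensor N C)) : H) => [h|chi].
  apply: linear_ext => c; apply: additive_ext => n.
  by rewrite rcurryE -[LHS]/(runcurry _ _) runcurryE.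
by apply: rchar_tensC_ext => n c; rewrite -[LHS]/(runcurry _ _) runcurryE rcurryE.
Qed.

Lemma ldual_homC_rchar_bij : bijective (ldual homC_rchar).
Proof. exact: (cdual_bij homC_rchar).2 homC_rchar_bij. Qed.

Fact mu_additive : zmod_morphism (@mu R S C N).
Proof.
move=> x y; apply: linear_ext => c.
rewrite -[LHS]/(tens (x - y) (c : C)) -[RHS]/(tens x (c : C) - tens y (c : C)).
by apply/eqP; rewrite eq_sym subr_eq -tensDl subrK.
Qed.

Hypothesis Ca2 : has_fg_projective_resolution (bim_right C : lmodType S^c).

(** Put X = N (x) C. The dual of [theta] at N^+ is the double dual of [mu] followed by the
    isomorphisms Hom(C, X)^{++} = Hom(C, X^{++}) = (C (x) X^+)^+, where X^+ = Hom(C, N^+). *)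
Lemma theta_rchar_bij : bijective (@theta R S C (rchar N)) <-> bijective (@mu R S C N).
Proof.
rewrite -(cdual_bij (@theta R S C (rchar N))).
rewrite -[bijective (@mu _ _ _ _)]/(bijective (mkadd mu_additive)).
rewrite -(cdual_bij (mkadd mu_additive)) -(cdual_bij (cdual (mkadd mu_additive))).
pose b (g : {linear bim_right C -> ddual X}) : char (tensor (bim_right C) H) :=
  luncurry (ldual homC_rchar \o ddual_lr _ \o g).
have bb : bijective b.
  apply: bij_comp (luncurry_bij _ _) _; apply: postcomp_bij.
  exact: bij_comp ldual_homC_rchar_bij (ddual_lr_bij _).
apply: (@bijective_compl _ _ _ (b \o @nu _ X (bim_right C))) => [|psi].
  by apply: bij_comp => //; exact: nu_bij.
apply: additive_ext; apply: tensor_ext => c h; rewrite /b /= tensor_lift_tens.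
rewrite [X in _ = psi X]tensor_lift_tens.
rewrite -[LHS]/((nu (cdual (cdual (mkadd mu_additive)) psi) c : char (char X)) (homC_rchar h)).
rewrite nuE cdualE -[RHS]/(psi (((h : {linear C -> rchar N}) (c : C)) : char N)).
congr (psi _); apply: additive_ext => n; rewrite cdualE.
by rewrite -[LHS]/(runcurry (h : {linear C -> rchar N}) (tens n (c : C))) runcurryE.
Qed.

Lemma auslander_rchar : auslander_class C N <-> bass_class C (rchar N).
Proof.
have eX := ext_zero_ddual (tensC C N) Ca2.
have eH : ext_zero (bim_right C) (ddual X) <-> ext_zero (bim_right C) (lchar H).
  apply: (@ext_zero_iso _ _ _ _ (ldual homC_rchar \o ddual_lr X)).
  exact: bij_comp ldual_homC_rchar_bij (ddual_lr_bij _).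
rewrite auslanderP bassP; split=> -[h1 h2 h3]; split=> //.
- exact/eH/eX.
- exact/theta_rchar_bij.
- exact/eX/eH.
- exact/theta_rchar_bij.
Qed.
End DualOfRight.

Section DualOfLeft.
Variable M : lmodType R.
Local Notation H := (homC C M).
Local Notation Y := (tensC C (lchar M)).

Lemma omega_balanced : balanced (fun (f : lchar M) (c : C) => evp c (f : char M) : char {linear C
    -> M}).
Proof.
split=> [f g c|f c d|r f c]; apply: additive_ext => h //=.
  by rewrite linearD raddfD.
by rewrite linearZZ.
Qed.
Local Notation w := (tensor_lift omega_balanced).
Lemma omegaE (f : lchar M) (c : C) (h : {linear C -> M}) :
  w (tens f c) h = (f : char M) (h c).
Proof. by rewrite tensor_lift_tens. Qed.

Fact homC_scale_additive (s : S) : zmod_morphism (homC_scale s : H -> H).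
Proof. by move=> f g; apply: linear_ext. Qed.

Fact omega_linear : linear (w : Y -> lchar H).
Proof.
move=> s x y; rewrite [LHS](raddfD w); congr (_ + _).
pose sT : {additive tensor (lchar M) C -> tensor (lchar M) C} :=
  tensor_map (idfun : {linear lchar M -> lchar M}) (homothetyS C s).
suff e : w \o sT =1 cdual (mkadd (homC_scale_additive s)) \o w.
  by apply: additive_ext => h; have := congr1 (fun k : char {linear C -> M} => k h) (e x).
apply: tensor_ext => f c /=.
rewrite /sT tensor_map_tens; apply: additive_ext => h; rewrite omegaE /=.
by rewrite omegaE.
Qed.
Definition omega : {linear Y -> lchar H} := mklin omega_linear.

Hypothesis Ca1 : has_fg_projective_resolution (C : lmodType R).

(** Up to the adjunction the dual of [omega] is [nu], and bijectivity is detected on character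
    groups. *)
Lemma omega_bij : bijective omega.
Proof.
apply/(cdual_bij omega).
pose b (g : {linear C -> ddual M}) : char (tensor (lchar M) C) :=
  runcurry (ddual_rl M \o g : {linear C -> rchar (lchar M)}).
have bb : bijective b.
  apply: bij_comp (runcurry_bij _ _) _; exact: postcomp_bij (ddual_rl_bij _).
apply: (@eq_bij _ _ (b \o @nu _ M C)) => [|psi /=].
  by apply: bij_comp => //; exact: nu_bij.
apply: additive_ext; apply: tensor_ext => f c.
by rewrite /b runcurryE cdualE [X in _ = psi X]tensor_lift_tens.
Qed.

(** The dual of [theta] at [M] is [mu] at M^+ followed by [omega] and the adjunction. *)
Lemma mu_lchar_bij : bijective (@mu R S C (lchar M)) <-> bijective (@theta R S C M).
Proof.
rewrite -(cdual_bij (@theta R S C M)).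
pose b (g : {linear bim_right C -> Y}) : char (tensor (bim_right C) H) := luncurry (omega \o g).
have bb : bijective b.
  apply: bij_comp (luncurry_bij _ _) _; exact: postcomp_bij omega_bij.
apply: iff_sym; apply: (bijective_compl bb) => chi.
apply: additive_ext; apply: tensor_ext => c h.
rewrite /b luncurryE cdualE [X in _ = chi X]tensor_lift_tens.
exact: omegaE.
Qed.

Lemma bass_lchar : bass_class C M <-> auslander_class C (lchar M).
Proof.
have eM := ext_zero_ddual M Ca1.
have eM' : ext_zero C (ddual M) <-> ext_zero C (rchar (lchar M)).
  exact: (@ext_zero_iso _ _ _ _ (ddual_rl M)) (ddual_rl_bij _).
have eY : ext_zero (bim_right C) Y <-> ext_zero (bim_right C) (lchar H).
  exact: (@ext_zero_iso _ _ _ _ omega) omega_bij.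
rewrite auslanderP bassP; split=> -[h1 h2 h3]; split.
- exact/eM'/eM.
- exact/eY.
- exact/mu_lchar_bij.
- exact/eM/eM'.
- exact/eY.
- exact/mu_lchar_bij.
Qed.
End DualOfLeft.
End Classes.

(** * Direct sums *)

Section DirectSum.
Variables (T : pzRingType) (I : Type) (M : I -> lmodType T).

Definition dsum_proj_fun i (x : dsum_mod M) : M i := (val x : dprod_mod M) i.
Fact dsum_proj_linear i : linear (dsum_proj_fun i). Proof. by []. Qed.
(** The canonical maps are sealed, so that simplification does not unfold them. *)
Fact dsum_proj_sig i : {p : {linear dsum_mod M -> M i} | p =1 @dsum_proj_fun i}.
Proof. by exists (mklin (dsum_proj_linear i)). Qed.
Definition dsum_proj i : {linear dsum_mod M -> M i} := sval (dsum_proj_sig i).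
Lemma dsum_projE i x : dsum_proj i x = (val x : dprod_mod M) i.
Proof. exact: (svalP (dsum_proj_sig i)). Qed.

Lemma dsum_ext (x y : dsum_mod M) : (forall i, dsum_proj i x = dsum_proj i y) -> x = y.
Proof.
move=> xy; apply/val_inj/functional_extensionality_dep => i.
by move: (xy i); rewrite !dsum_projE.
Qed.

Lemma dsum_support (x : dsum_mod M) : finite_set [set i | dsum_proj i x <> 0].
Proof.
rewrite (_ : mkset _ = [set i | (val x : dprod_mod M) i <> 0]); first exact: asboolW (valP x).
by apply/funext => i; rewrite /= dsum_projE.
Qed.

Definition dsum_inj_fun i (x : M i) : dprod_mod M := fun j =>
  if pselect (i = j) is left e then eq_rect i (fun k => M k : Type) x j e else 0.
Fact dsum_inj_finite i x : Defs.finite_support (@dsum_inj_fun i x).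
Proof.
apply/asboolP; apply: (@sub_finite_set _ _ [set i]) => [j /=|]; last exact: finite_set1.
by rewrite /dsum_inj_fun; case: pselect.
Qed.
Fact dsum_inj_linear i :
  linear (fun x : M i => Sub (dsum_inj_fun x) (dsum_inj_finite x) : dsum_mod M).
Proof.
move=> a x y; apply: dsum_ext => j; rewrite linearP !dsum_projE /= /dsum_inj_fun.
by case: pselect => [e|_]; [case: _ / e|rewrite scaler0 addr0].
Qed.
Fact dsum_inj_sig i : {f : {linear M i -> dsum_mod M} |
  forall x j, dsum_proj j (f x) = dsum_inj_fun x j}.
Proof. by exists (mklin (@dsum_inj_linear i)) => x j; rewrite dsum_projE. Qed.
Definition dsum_inj i : {linear M i -> dsum_mod M} := sval (dsum_inj_sig i).

Lemma dsum_injK i x : dsum_proj i (dsum_inj i x) = x.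
Proof.
rewrite (svalP (dsum_inj_sig i)) /dsum_inj_fun; case: pselect => // e.
by rewrite (Prop_irrelevance e erefl).
Qed.
Lemma dsum_inj0 i j x : i <> j -> dsum_proj j (dsum_inj i x) = 0.
Proof. by rewrite (svalP (dsum_inj_sig i)) /dsum_inj_fun; case: pselect. Qed.

Lemma dsum_decomp (x : dsum_mod M) (s : seq {classic I}) : uniq s ->
  (forall i, dsum_proj i x <> 0 -> (i : {classic I}) \in s) ->
  x = \sum_(i <- s) dsum_inj i (dsum_proj i x).
Proof.
move=> us supp; apply: dsum_ext => j; rewrite linear_sum.
have [js|njs] := boolP ((j : {classic I}) \in s).
  rewrite (bigD1_seq (j : {classic I}))//= dsum_injK big1 ?addr0// => i /eqP ij.
  by rewrite dsum_inj0.
rewrite big1_seq => [|i /= si].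
  by apply: contrapT => /supp; rewrite (negPf njs).
by rewrite dsum_inj0// => ij; move: njs; rewrite -ij si.
Qed.

Lemma finite_uniq_seq (A : set I) : finite_set A ->
  exists s : seq {classic I}, uniq s /\ forall i, A i <-> (i : {classic I}) \in s.
Proof.
move=> fA; have /finite_seqP[s sE] : finite_set (A : set {classic I}) by [].
exists (undup s); split=> [|i]; first exact: undup_uniq.
by rewrite mem_undup sE.
Qed.

Section Lift.
Variables (V : lmodType T) (h : forall i, {linear M i -> V}).
Definition dsum_lift_fun (x : dsum_mod M) : V :=
  \sum_(i <- projT1 (cid (finite_uniq_seq (dsum_support x)))) h i (dsum_proj i x).
Lemma dsum_lift_funE x (s : seq {classic I}) : uniq s ->
  (forall i, dsum_proj i x <> 0 -> (i : {classic I}) \in s) ->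
  dsum_lift_fun x = \sum_(i <- s) h i (dsum_proj i x).
Proof.
rewrite /dsum_lift_fun; case: cid => t /= [ut tE] us sE.
rewrite [RHS](bigID (fun i => i \in t))/= [X in _ + X]big1 ?addr0; last first.
  move=> i /negP it; rewrite (_ : dsum_proj _ _ = 0) ?linear0//.
  by apply: contrapT => /tE.
rewrite -[RHS]big_filter; apply: perm_big; apply: uniq_perm => //; first exact: filter_uniq.
move=> i; rewrite mem_filter; apply/idP/andP => [it|[]//]; split=> //.
by apply: sE; apply/tE.
Qed.
Fact dsum_lift_linear : linear dsum_lift_fun.
Proof.
move=> a x y.
have fA : finite_set ([set i | dsum_proj i x <> 0] `|` [set i | dsum_proj i y <> 0]).
  by rewrite finite_setU; split; exact: dsum_support.
have [s [us sE]] := finite_uniq_seq fA.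
have sx i : dsum_proj i x <> 0 -> (i : {classic I}) \in s by move=> xi; apply/sE; left.
have sy i : dsum_proj i y <> 0 -> (i : {classic I}) \in s by move=> yi; apply/sE; right.
have sxy i : dsum_proj i (a *: x + y) <> 0 -> (i : {classic I}) \in s.
  rewrite linearP => xyi; have [x0|/sx//] := pselect (dsum_proj i x = 0).
  by apply: sy => y0; apply: xyi; rewrite x0 y0 scaler0 addr0.
rewrite (dsum_lift_funE us sx) (dsum_lift_funE us sy) (dsum_lift_funE us sxy).
rewrite scaler_sumr -big_split; apply: eq_bigr => i _ /=.
by rewrite !linearP.
Qed.
Fact dsum_lift_sig : {f : {linear dsum_mod M -> V} | f =1 dsum_lift_fun}.
Proof. by exists (mklin dsum_lift_linear). Qed.
Definition dsum_lift : {linear dsum_mod M -> V} := sval dsum_lift_sig.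
Lemma dsum_lift_inj i x : dsum_lift (dsum_inj i x) = h i x.
Proof.
rewrite (svalP dsum_lift_sig) (@dsum_lift_funE _ [:: (i : {classic I})])//.
  by rewrite big_seq1 dsum_injK.
by move=> j; rewrite inE; have [<- _|/dsum_inj0->] := pselect (i = j); rewrite ?eqxx.
Qed.
End Lift.

Lemma dsum_hom_ext (V : lmodType T) (f g : {linear dsum_mod M -> V}) :
  (forall i x, f (dsum_inj i x) = g (dsum_inj i x)) -> f =1 g.
Proof.
move=> fg x; have [s [us sE]] := finite_uniq_seq (dsum_support x).
rewrite (dsum_decomp us (fun i => (sE i).1)) !linear_sum.
by apply: eq_bigr => i _; exact: fg.
Qed.
End DirectSum.
Arguments dsum_proj {T I M} i.
Arguments dsum_inj {T I M} i.
Arguments dsum_lift {T I M V} h.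

(** The identity of [X] as a pointwise finite sum of the maps [j i] after [p i]. This form of a
    decomposition survives tensor products, and Hom out of a finitely generated module, without
    identifying the result with a direct sum. *)
Definition locally_finite (X : zmodType) (I : Type) (F : I -> zmodType)
    (j : forall i, {additive F i -> X}) (p : forall i, {additive X -> F i}) : Prop :=
  forall x, exists A : set I, finite_set A /\
  forall s : seq {classic I}, uniq s -> (forall i, A i -> (i : {classic I}) \in s) ->
    x = \sum_(i <- s) j i (p i x).

Lemma locally_finite_common (X : zmodType) (I : Type) (F : I -> zmodType)
    (j : forall i, {additive F i -> X}) (p : forall i, {additive X -> F i})
    n (x : 'I_n -> X) : locally_finite j p ->
  exists A : set I, finite_set A /\
  forall s : seq {classic I}, uniq s -> (forall i, A i -> (i : {classic I}) \in s) ->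
    forall k, x k = \sum_(i <- s) j i (p i (x k)).
Proof.
move=> lf; have /choice[A AP] := fun k => lf (x k).
exists (\bigcup_(k in [set: 'I_n]) A k); split=> [|s us sA k].
  by apply: bigcup_finite => // k _; case: (AP k).
by case: (AP k) => _; apply => // i Ai; apply: sA; exists k.
Qed.

Lemma dsum_locally_finite (T : pzRingType) (I : Type) (M : I -> lmodType T) :
  locally_finite (@dsum_inj T I M) (@dsum_proj T I M).
Proof.
move=> x; exists [set i | dsum_proj i x <> 0]; split; first exact: dsum_support.
by move=> s; exact: dsum_decomp.
Qed.

(** A character vanishing on all [tens n m] is zero, so no character can separate [z] from [H]. *)
Lemma tensor_ind (T : pzRingType) (N : lmodType T^c) (M : lmodType T) (H : set (tensor N M)) :
  is_subgroup H -> (forall n m, H (tens n m)) -> forall z, H z.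
Proof.
move=> HP Ht z; apply: contrapT => /(char_sep HP)[chi [chi0]]; apply.
by apply: (@tensor_ext _ _ _ _ chi \0) => n m; exact: chi0.
Qed.

Lemma locally_finite_subgroup (X : zmodType) (I : Type) (F : I -> zmodType)
    (j : forall i, {additive F i -> X}) (p : forall i, {additive X -> F i}) :
  is_subgroup [set x | exists A : set I, finite_set A /\
    forall s : seq {classic I}, uniq s -> (forall i, A i -> (i : {classic I}) \in s) ->
    x = \sum_(i <- s) j i (p i x)].
Proof.
split=> [|x y [A [fA Ax]] [B [fB By]]].
  by exists set0; split=> // s _ _; rewrite big1// => i _; rewrite !raddf0.
exists (A `|` B); split; first by rewrite finite_setU.
move=> s us sAB; under eq_bigr do rewrite !raddfB.
rewrite sumrB; congr (_ - _); first by apply: Ax => // i Ai; apply: sAB; left.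
by apply: By => // i Bi; apply: sAB; right.
Qed.

Section TensorDecomp.
Variables (T : pzRingType) (I : Type).

Lemma tensor_locally_finite_r (N : lmodType T^c) (M : lmodType T) (F : I -> lmodType T)
    (j : forall i, {linear F i -> M}) (p : forall i, {linear M -> F i}) :
  locally_finite j p ->
  locally_finite (fun i => tensor_map (idfun : {linear N -> N}) (j i))
                 (fun i => tensor_map (idfun : {linear N -> N}) (p i)).
Proof.
move=> lf; apply: tensor_ind; first exact: locally_finite_subgroup.
move=> n m; have [A [fA AE]] := lf m; exists A; split=> // s us sA.
under eq_bigr do rewrite /= !tensor_map_tens.
rewrite [in LHS](AE s us sA); elim: s {us sA} => [|i s IH].
  by rewrite !big_nil -[LHS](addrK (tens n 0)) -tensDr addr0 subrr.
by rewrite !big_cons tensDr IH.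
Qed.

Lemma tensor_locally_finite_l (N : lmodType T^c) (M : lmodType T) (F : I -> lmodType T^c)
    (j : forall i, {linear F i -> N}) (p : forall i, {linear N -> F i}) :
  locally_finite j p ->
  locally_finite (fun i => tensor_map (j i) (idfun : {linear M -> M}))
                 (fun i => tensor_map (p i) (idfun : {linear M -> M})).
Proof.
move=> lf; apply: tensor_ind; first exact: locally_finite_subgroup.
move=> n m; have [A [fA AE]] := lf n; exists A; split=> // s us sA.
under eq_bigr do rewrite /= !tensor_map_tens.
rewrite [in LHS](AE s us sA); elim: s {us sA} => [|i s IH].
  by rewrite !big_nil -[LHS](addrK (tens 0 m)) -tensDl addr0 subrr.
by rewrite !big_cons tensDl IH.
Qed.
End TensorDecomp.

(** * Closure properties of the two classes *)

(** As [P n.+1] is finitely generated, the cocycle [f] is a finite sum of its components; each is a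
    coboundary in its [F i], and the finitely many solutions are added up. *)
Lemma ext_zero_locally_finite (T : pzRingType) (C X : lmodType T) (I : Type)
    (F : I -> lmodType T) (j : forall i, {linear F i -> X}) (p : forall i, {linear X -> F i}) :
  has_fg_projective_resolution C -> locally_finite j p ->
  (forall i, ext_zero C (F i)) -> ext_zero C X.
Proof.
move=> [P Pf] lf CF; apply/(ext_zero_resolution P) => n f f0.
have [m [v vP]] := Pf n.+1.
have [A [/finite_uniq_seq[s [us sA]] AE]] := locally_finite_common (f \o v) lf.
have vE k : f (v k) = \sum_(i <- s) j i (p i (f (v k))).
  by apply: (AE s us) => i /sA.
have fE x : f x = \sum_(i <- s) j i (p i (f x)).
  have [a ->] := vP x; rewrite linear_sum.
  under [RHS]eq_bigr do rewrite !linear_sum.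
  rewrite exchange_big /=; apply: eq_bigr => k _.
  rewrite [in LHS]linearZZ [in LHS]vE scaler_sumr.
  by apply: eq_bigr => i _; rewrite !linearZZ.
have gx : forall i, exists g : {linear P n -> F i}, forall x, g (pres_d P n x) = p i (f x).
  move=> i; have /(ext_zero_resolution P)/(_ n (p i \o f))[|g gE] := CF i.
    by move=> x /=; rewrite f0 linear0.
  by exists g.
pose g i := projT1 (cid (gx i)); have gE i := projT2 (cid (gx i)).
have gl : linear (fun y => \sum_(i <- s) j i (g i y)).
  move=> a x y; rewrite scaler_sumr -big_split; apply: eq_bigr => i _ /=.
  by rewrite !linearP.
exists (mklin gl) => x /=; rewrite [RHS]fE; apply: eq_bigr => i _.
by rewrite gE.
Qed.

(** A solution for the image of [f] in [D] lifts to [B] because [P n] is projective. The remaining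
    error is a cocycle with values in [A]. *)
Lemma ext_zero_extension (T : pzRingType) (C A B D : lmodType T)
    (i : {linear A -> B}) (q : {linear B -> D}) :
  short_exact i q -> ext_zero C A -> ext_zero C D -> ext_zero C B.
Proof.
move=> [ii iqE qs]; rewrite !(ext_zero_resolution (free_resolution C)).
move: (free_resolution C) => P CA CD n f f0.
have [|h hE] := CD n (q \o f); first by move=> x; rewrite /= f0 linear0.
have [h' h'E] := @pres_projective _ _ P n _ _ q h qs.
have [x|k kE] := @linear_factor_inj _ _ _ _ i (f - (h' \o pres_d P n : {linear _ -> _})) ii.
  apply/iqE; rewrite -[q _]/(q (f x - h' (pres_d P n x))) linearB h'E hE.
  by rewrite subrr.
have dd x : pres_d P n (pres_d P n.+1 x) = 0 by apply/(@pres_exactS _ _ P); exists x.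
have [|l lE] := CA n k.
  move=> x; apply: ii; rewrite kE linear0.
  have -> : (f - (h' \o pres_d P n : {linear _ -> _})) (pres_d P n.+1 x) =
    f (pres_d P n.+1 x) - h' (pres_d P n (pres_d P n.+1 x)) by [].
  by rewrite f0 dd linear0 subrr.
exists (h' + (i \o l : {linear _ -> _})) => x.
rewrite -[LHS]/(h' (pres_d P n x) + i (l (pres_d P n x))) lE kE.
by rewrite -[(f - _) x]/(f x - h' (pres_d P n x)) addrC subrK.
Qed.

Lemma ext_zero_projective (T : pzRingType) (P N : lmodType T) : projective P -> ext_zero P N.
Proof.
move=> Pp n; have [_ _ qs] := cosyz_exact (iter n (@cosyz T) N).
by apply: lift_ext1 (@inj_hull_injective _ _) (cosyz_exact _) _ => h; exact: Pp.
Qed.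

Lemma regular_projective (T : pzRingType) : projective T^o.
Proof.
move=> A B g f gs; have [a ga] := gs (f 1).
have hl : linear (fun x : T^o => (x : T) *: a).
  by move=> t x y; rewrite scalerDl -scalerA.
exists (mklin hl) => x; rewrite -[LHS]/(g ((x : T) *: a)) linearZZ ga -linearZZ.
by congr (f _); exact: mulr1.
Qed.

Lemma retract_bij (A B A' B' : Type) (u : A -> B) (v : A' -> B')
    (s : A -> A') (r : A' -> A) (s' : B -> B') (r' : B' -> B) :
  cancel s r -> cancel s' r' -> (forall x, v (s x) = s' (u x)) ->
  (forall y, u (r y) = r' (v y)) -> bijective v -> bijective u.
Proof.
move=> sr sr' vs ur [w vK wK]; exists (fun b => r (w (s' b))) => x.
  by rewrite -vs vK sr.
by rewrite ur wK sr'.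
Qed.

Section ClosureProperties.
Variables (R S : pzRingType) (C : bimodule R S).

Section TensCMap.
Variables (N N' : lmodType R^c) (f : {linear N -> N'}).
Local Notation tm := (tensor_map f (idfun : {linear C -> C})).
Fact tensC_map_linear : linear (tm : tensC C N -> tensC C N').
Proof.
move=> s x y; rewrite [LHS](raddfD tm); congr (_ + _).
pose m (N : lmodType R^c) : {additive tensor N C -> tensor N C} :=
  tensor_map (idfun : {linear N -> N}) (homothetyS C s).
suff e : tm \o m N =1 m N' \o tm by have := e x.
by apply: tensor_ext => n c; rewrite /m /= !tensor_map_tens.
Qed.
Definition tensC_map : {linear tensC C N -> tensC C N'} := mklin tensC_map_linear.
Lemma tensC_mapE n (c : C) : tensC_map (tens n c : tensC C N) = tens (f n) c.
Proof. exact: tensor_map_tens. Qed.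
End TensCMap.

Lemma tensC_hom_ext (N : lmodType R^c) (V : zmodType) (f g : {additive tensC C N -> V}) :
  (forall n (c : C), f (tens n c : tensC C N) = g (tens n c : tensC C N)) -> f =1 g.
Proof. exact: (@tensor_ext _ N C V f g). Qed.

Section HomCMap.
Variables (M M' : lmodType R) (f : {linear M -> M'}).
Fact homC_map_linear :
  linear (fun h : homC C M => (f \o (h : {linear C -> M}) : {linear C -> M'}) : homC C M').
Proof. by move=> s g h; apply: linear_ext => c /=; rewrite raddfD. Qed.
Definition homC_map : {linear homC C M -> homC C M'} := mklin homC_map_linear.
Lemma homC_mapE (h : homC C M) (c : C) :
  (homC_map h : {linear C -> M'}) c = f ((h : {linear C -> M}) c).
Proof. by []. Qed.
End HomCMap.

Lemma thetaE (M : lmodType R) c h :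
  theta (tens (c : bim_right C) (h : homC C M)) = (h : {linear C -> M}) c.
Proof. exact: tensor_lift_tens. Qed.
Fact theta_additive (M : lmodType R) : zmod_morphism (@theta R S C M).
Proof. by move=> x y; exact: (raddfB (tensor_lift (theta_balanced C M))). Qed.

Lemma auslander_retract (N N' : lmodType R^c) (s : {linear N -> N'}) (r : {linear N' -> N}) :
  (forall x, r (s x) = x) -> auslander_class C N' -> auslander_class C N.
Proof.
move=> rs /auslanderP[h1 h2 h3]; apply/auslanderP.
have rsT : cancel (tensC_map s) (tensC_map r).
  by apply: (@tensC_hom_ext _ _ (tensC_map r \o tensC_map s) idfun) => n c; rewrite /=
      !tensor_map_tens /= rs.
split.
- apply: (@ext_zero_retract _ _ _ _ (rdual r) (rdual s)) h1 => chi.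
  by apply: additive_ext => n; rewrite !rdualE rs.
- exact: (@ext_zero_retract _ _ _ _ (tensC_map s) (tensC_map r)) h2.
- apply: (@retract_bij _ _ _ _ _ (@mu R S C N') s r
    (fun g : {linear bim_right C -> tensC C N} => (tensC_map s \o g : {linear bim_right C -> tensC
        C N'}))
    (fun g : {linear bim_right C -> tensC C N'} => (tensC_map r \o g : {linear bim_right C -> tensC
        C N}))) h3 => // [g|x|y]; apply: linear_ext => c //=.
  + exact: rsT.
  + by rewrite tensor_map_tens.
  + by rewrite tensor_map_tens.
Qed.

Lemma bass_retract (M M' : lmodType R) (s : {linear M -> M'}) (r : {linear M' -> M}) :
  (forall x, r (s x) = x) -> bass_class C M' -> bass_class C M.
Proof.
move=> rs /bassP[h1 h2 h3]; apply/bassP.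
have rsH : cancel (homC_map s) (homC_map r).
  by move=> h; apply: linear_ext => c; rewrite !homC_mapE rs.
split.
- exact: (@ext_zero_retract _ _ _ _ s r) h1.
- apply: (@ext_zero_retract _ _ _ _ (ldual (homC_map r)) (ldual (homC_map s))) h2 => chi.
  by apply: additive_ext => h; rewrite !ldualE rsH.
- pose t (M1 M2 : lmodType R) (f : {linear M1 -> M2}) :=
    tensor_map (idfun : {linear bim_right C -> bim_right C}) (homC_map f).
  apply: (@retract_bij _ _ _ _ _ (@theta R S C M') (t _ _ s) (t _ _ r) s r) h3 => //.
  + by apply: (@tensor_ext _ _ _ _ (t _ _ r \o t _ _ s) idfun) => c h; rewrite /t /=
      !tensor_map_tens rsH.
  + apply: (@tensor_ext _ _ _ _ (mkadd (@theta_additive M') \o t _ _ s) (s \o mkadd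
      (@theta_additive M))) => c h.
    by rewrite /t /= tensor_map_tens !thetaE.
  + apply: (@tensor_ext _ _ _ _ (mkadd (@theta_additive M) \o t _ _ r) (r \o mkadd (@theta_additive
      M'))) => c h.
    by rewrite /t /= tensor_map_tens !thetaE.
Qed.
End ClosureProperties.

(** * Coproducts, extensions and the regular module *)

Section MoreClosure.
Variables (R S : pzRingType) (C : bimodule R S).

Lemma fg_of_resolution (T : pzRingType) (X : lmodType T) :
  has_fg_projective_resolution X -> finitely_generated X.
Proof.
move=> [P /(_ 0%N)[n [v vP]]]; exists n, (fun i => pres_aug P (v i)) => x.
have [y <-] := @pres_surjective _ _ P x; have [a ->] := vP y.
by exists a; rewrite linear_sum; apply: eq_bigr => i _; rewrite linearZZ.
Qed.

Lemma fg_hom_ext (T : pzRingType) (X Y : lmodType T) n (v : 'I_n -> X)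
    (f g : {linear X -> Y}) :
  (forall x, exists a : 'I_n -> T, x = \sum_(i < n) a i *: v i) ->
  (forall i, f (v i) = g (v i)) -> f = g.
Proof.
move=> vP fg; apply: linear_ext => x; have [a ->] := vP x.
by rewrite !linear_sum; apply: eq_bigr => i _; rewrite !linearZZ fg.
Qed.

Hypothesis Ca1 : has_fg_projective_resolution (C : lmodType R).
Hypothesis Ca2 : has_fg_projective_resolution (bim_right C : lmodType S^c).

Lemma bass_coproduct : coproduct_closed (bass_class C).
Proof.
move=> I M MB; pose H i := homC C (M i); pose HM := homC C (dsum_mod M).
have MB1 i : ext_zero C (M i) by have /bassP[] := MB i.
have lfM := @dsum_locally_finite R I M.
(* Hom(C, -) keeps local finiteness because the images of the finitely many generators of [C] share
   one finite support. *)
have lfH : locally_finite (fun i => homC_map C (@dsum_inj _ _ M i) : {additive H i -> HM})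
    (fun i => homC_map C (@dsum_proj _ _ M i) : {additive HM -> H i}).
  move=> h; have [n [v vP]] := fg_of_resolution Ca1.
  have [A [fA AE]] := locally_finite_common ((h : {linear C -> _}) \o v) lfM.
  exists A; split=> // s us sA; apply: (fg_hom_ext vP) => k.
  rewrite [LHS](AE s us sA k); elim: s {us sA} => [|i s IH]; first by rewrite !big_nil.
  by rewrite !big_cons IH.
have lfT := tensor_locally_finite_r (N := bim_right C) lfH.
split.
- apply/Ext_zeroP/(ext_zero_locally_finite Ca1 lfM)/MB1.
- move=> [//|n] _; apply/homology_trivial => z z0.
  have lfz k := @tensor_locally_finite_r _ _ (res (bim_right C) k) _ _ _ _ lfH.
  have [A [/finite_uniq_seq[s [us sA]] AE]] := lfz _ z.
  (* Each component of the cycle [z] is a boundary since Tor vanishes for [M i]. Only finitely many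
     components occur, and their preimages are pushed forward and added. *)
  have b i : exists u, tensor_map (res_d (bim_right C) n.+1) (idfun : {linear H i -> H i}) u =
      tensor_map (idfun : {linear res (bim_right C) n.+1 -> _}) (homC_map C (dsum_proj i)) z.
    have /homology_trivial := bass_Tor (MB i) (isT : (1 <= n.+1)%N); apply.
    pose L := tensor_map (res_d (bim_right C) n) (idfun : {linear H i -> H i}) \o
      tensor_map (idfun : {linear res (bim_right C) n.+1 -> _}) (homC_map C (@dsum_proj _ _ M i)).
    pose L' := tensor_map (idfun : {linear res (bim_right C) n -> _}) (homC_map C (@dsum_proj _ _ M
        i)) \o
      tensor_map (res_d (bim_right C) n) (idfun : {linear HM -> HM}).
    have e : L =1 L' by apply: tensor_ext => x h; rewrite /L /L' /= !tensor_map_tens.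
    by rewrite -[LHS]/(L z) e /L' /= z0 raddf0.
  pose u i := projT1 (cid (b i)); have uE i := projT2 (cid (b i)).
  exists (\sum_(i <- s) tensor_map (idfun : {linear res (bim_right C) n.+2 -> _}) (homC_map C
      (dsum_inj i)) (u i)).
  rewrite raddf_sum [RHS](AE s us (fun i => (sA i).1)); apply: eq_bigr => i _.
  rewrite -[X in _ = _ X](uE i).
  pose L := tensor_map (res_d (bim_right C) n.+1) (idfun : {linear HM -> HM}) \o
    tensor_map (idfun : {linear res (bim_right C) n.+2 -> _}) (homC_map C (@dsum_inj _ _ M i)).
  pose L' := tensor_map (idfun : {linear res (bim_right C) n.+1 -> _}) (homC_map C (@dsum_inj _ _ M
      i)) \o
    tensor_map (res_d (bim_right C) n.+1) (idfun : {linear H i -> H i}).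
  have e : L =1 L' by apply: tensor_ext => x h; rewrite /L /L' /= !tensor_map_tens.
  exact: e.
- have tD (X : lmodType R) : zmod_morphism (@theta R S C X) by exact: theta_additive.
  have thI i z : theta (tensor_map (idfun : {linear bim_right C -> _}) (homC_map C (dsum_inj i)) z) =
      dsum_inj i (@theta R S C (M i) z).
    move: z; apply: (@tensor_ext _ _ _ _ (mkadd (tD (dsum_mod M)) \o tensor_map (idfun : {linear
        bim_right C -> _}) (homC_map C (dsum_inj i))) (dsum_inj i \o mkadd (tD (M i)))) => c h.
    by rewrite /= tensor_map_tens !thetaE.
  have thP i z : theta (tensor_map (idfun : {linear bim_right C -> _}) (homC_map C (dsum_proj i)) z) =
      dsum_proj i (@theta R S C (dsum_mod M) z).
    move: z; apply: (@tensor_ext _ _ _ _ (mkadd (tD (M i)) \o tensor_map (idfun : {linear bim_right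
        C -> _}) (homC_map C (dsum_proj i))) (dsum_proj i \o mkadd (tD (dsum_mod M)))) => c h.
    by rewrite /= tensor_map_tens !thetaE.
  apply/bij_inj_surj; split=> [x y xy|m].
    (* The family indexed by ['I_2] provides one finite list of indices that decomposes both [x] and
       [y]. *)
    have [A [/finite_uniq_seq[s [us sA]] AE]] := locally_finite_common (fun k : 'I_2 => if k == 0
        then x else y) lfT.
    have E := AE s us (fun i => (sA i).1); have := E 0; have := E 1; rewrite /= => -> ->.
    apply: eq_bigr => i _; congr (tensor_map _ _ _).
    have /bassP[_ _ /bij_inj_surj[ti _]] := MB i; apply: ti.
    by rewrite !thP xy.
  have [A [/finite_uniq_seq[s [us sA]] AE]] := lfM m.
  rewrite (AE s us (fun i => (sA i).1)).
  have ex i : exists z, @theta R S C (M i) z = dsum_proj i m.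
    by have /bassP[_ _ /bij_inj_surj[_ ts]] := MB i; exact: ts.
  exists (\sum_(i <- s) tensor_map (idfun : {linear bim_right C -> _}) (homC_map C (dsum_inj i))
      (projT1 (cid (ex i)))).
  rewrite [LHS](raddf_sum (mkadd (tD (dsum_mod M)))); apply: eq_bigr => i _.
  by rewrite /= thI; case: cid => z /= ->.
Qed.

(** The character module of a direct sum is the product of those of the summands, so the solutions
    found for each [N i] assemble into one; [flipr] and [dsum_lift] carry this out. *)
Lemma ext_zero_rchar_dsum (T : pzRingType) (X : lmodType T) (I : Type) (N : I -> lmodType T^c) :
  (forall i, ext_zero X (rchar (N i))) -> ext_zero X (rchar (dsum_mod N)).
Proof.
move=> XN; apply/(ext_zero_resolution (free_resolution X)).
move: (free_resolution X) XN => P XN n f f0.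
have ex i : exists g : {linear P n -> rchar (N i)},
    forall x, g (pres_d P n x) = rdual (dsum_inj i) (f x).
  have /(ext_zero_resolution P)/(_ n (rdual (dsum_inj i) \o f))[|g gE] := XN i.
    by move=> x; rewrite -[LHS]/(rdual (dsum_inj i) (f (pres_d P n.+1 x))) f0 linear0.
  by exists g.
pose g i := projT1 (cid (ex i)); have gE i x : g i (pres_d P n x) = rdual (dsum_inj i) (f x).
  exact: (projT2 (cid (ex i)) x).
pose h := dsum_lift (fun i => flipr (g i)).
have e : ldual (pres_d P n) \o h =1 flipr f.
  apply: dsum_hom_ext => i x; apply: additive_ext => q.
  by rewrite fliprE -[LHS]/((h _ : char (P n)) _) /h dsum_lift_inj fliprE gE rdualE.
exists (flipl h) => q; apply: additive_ext => x.
by rewrite fliplE -fliprE -e.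
Qed.

Lemma auslander_coproduct : coproduct_closed (auslander_class C).
Proof.
move=> I N NA; apply/auslanderP.
have lfN := @dsum_locally_finite R^c I N.
have lfT := @tensor_locally_finite_l _ _ _ C _ _ _ lfN.
have lfT' : locally_finite
    (fun i => tensC_map C (@dsum_inj _ _ N i) : {additive tensC C (N i) -> tensC C (dsum_mod N)})
    (fun i => tensC_map C (@dsum_proj _ _ N i)) := lfT.
split.
- by apply: ext_zero_rchar_dsum => i; have /auslanderP[] := NA i.
- apply: (@ext_zero_locally_finite _ _ _ _ (fun i => tensC C (N i))) Ca2 lfT' _ => i.
  by have /auslanderP[] := NA i.
have muI i x c : mu C (dsum_inj i x) c = tensC_map C (dsum_inj i) (mu C x c).
  by apply/esym; exact: tensC_mapE.
have muP i x c : mu C (dsum_proj i x) c = tensC_map C (dsum_proj i) (mu C x c).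
  by apply/esym; exact: tensC_mapE.
apply/bij_inj_surj; split=> [x y xy|g].
  apply: dsum_ext => i; have /auslanderP[_ _ /bij_inj_surj[mi _]] := NA i.
  by apply: mi; apply: linear_ext => c; rewrite !muP xy.
(* The map [g] is determined by its values on finitely many generators of [C], so finitely many of
   its components yield a preimage. *)
have [n [v vP]] := fg_of_resolution Ca2.
have [A [/finite_uniq_seq[s [us sA]] AE]] := locally_finite_common (g \o v) lfT'.
have ex i : exists x, mu C x = tensC_map C (dsum_proj i) \o g.
  by have /auslanderP[_ _ /bij_inj_surj[_ ms]] := NA i; exact: ms.
pose x i := projT1 (cid (ex i)).
have xE i c : mu C (x i) c = tensC_map C (dsum_proj i) (g c).
  by rewrite (projT2 (cid (ex i))).
exists (\sum_(i <- s) dsum_inj i (x i)).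
rewrite -[LHS]/(mkadd (@mu_additive _ _ C _) _) raddf_sum.
apply: (fg_hom_ext vP) => k.
have -> : g (v k) = \sum_(i <- s) mu C (dsum_inj i (x i)) (v k).
  by rewrite [LHS](AE s us (fun i => (sA i).1) k); apply: eq_bigr => i _; rewrite muI xE.
elim: s {us sA AE} => [|i s IH]; first by rewrite !big_nil.
by rewrite !big_cons -IH.
Qed.

Lemma auslander_extension : extension_closed (auslander_class C).
Proof.
move=> A B D f g fi fgE gs /auslanderP[A1 A2 A3] /auslanderP[D1 D2 D3]; apply/auslanderP.
have fg : short_exact f g by [].
have fgd := short_exact_rdual fg.
have gf x : g (f x) = 0 by apply/fgE; exists x.
(* Tensoring with [C] stays exact because Tor_1(D, C) = 0, available as Ext^1(C, D^+) = 0. Exactness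
   is tested on characters, which the adjunction turns into maps from [C] to character modules. *)
have tes : short_exact (tensC_map C f) (tensC_map C g).
  split.
  - apply/char_inj => chi.
    have [k kE] := ext1_zero_lift (D1 0%N) fgd (rcurry (chi : char (tensor A C))).
    exists (runcurry k : char (tensor B C)).
    apply: (@tensC_hom_ext _ _ _ _ _ ((runcurry k : char (tensor B C)) \o tensC_map C f) chi) => a c.
    rewrite -[LHS]/(runcurry k (tensC_map C f _)) tensC_mapE runcurryE -rdualE kE.
    by rewrite rcurryE.
  - move=> y; split=> [|[x <-]]; last first.
      apply: (@tensC_hom_ext _ _ _ _ _ (tensC_map C g \o tensC_map C f) \0) x => a c.
      rewrite -[LHS]/(tensC_map C g (tensC_map C f _)) !tensC_mapE gf.
      by rewrite -[LHS](addrK (tens 0 c)) -tensDl addr0 subrr.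
    move: y; apply/(char_exact (tensC_map C f) (tensC_map C g)) => chi chi0.
    have [ii iqE _] := fgd.
    have [c|k kE] := @linear_factor_inj _ _ _ _ (rdual g) (rcurry (chi : char (tensor B C))) ii.
      apply/iqE; apply: additive_ext => a; rewrite rdualE rcurryE.
      have : chi (tensC_map C f (tens a c : tensC C A)) = 0 by exact: chi0.
      by rewrite tensC_mapE.
    exists (runcurry k : char (tensor D C)).
    apply: (@tensC_hom_ext _ _ _ _ _ ((runcurry k : char (tensor D C)) \o tensC_map C g) chi) => b c.
    rewrite -[LHS]/(runcurry k (tensC_map C g _)) tensC_mapE runcurryE -rdualE kE.
    by rewrite rcurryE.
  - apply: tensor_ind => [|d c]; first exact: image_subgroup.
    by have [b <-] := gs d; exists (tens b c : tensC C B); rewrite tensC_mapE.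
have [ti tE ts] := tes; split.
- exact: ext_zero_extension fgd D1 A1.
- exact: ext_zero_extension tes A2 D2.
have muf x c : mu C (f x) c = tensC_map C f (mu C x c) by apply/esym; exact: tensC_mapE.
have mug x c : mu C (g x) c = tensC_map C g (mu C x c) by apply/esym; exact: tensC_mapE.
have muB (X : lmodType R^c) (x y : X) : mu C (x - y) = mu C x - mu C y by exact: mu_additive.
have mu0 (X : lmodType R^c) : mu C (0 : X) = 0 by rewrite -(subrr (0 : X)) muB subrr.
have muD (X : lmodType R^c) (x y : X) : mu C (x + y) = mu C x + mu C y.
  by rewrite -[y in LHS]opprK muB -[- y]add0r muB mu0 add0r opprK.
have [Ai As] := (bij_inj_surj _).1 A3; have [Di Ds] := (bij_inj_surj _).1 D3.
(* The five lemma by diagram chase, comparing [f], [g] with the maps they induce on Hom(C, - (x)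
   C). *)
apply/bij_inj_surj; split=> [x y xy|h].
  have /fgE[a aE] : g (x - y) = 0.
    apply: Di; apply: linear_ext => c; rewrite mug muB xy subrr.
    by rewrite mu0 -[RHS]/(0 : tensC C D) -[X in _ = X](linear0 (tensC_map C g)).
  apply/eqP; rewrite -subr_eq0 -aE; apply/eqP.
  suff -> : a = 0 by rewrite linear0.
  apply: Ai; apply: linear_ext => c; apply: ti; rewrite -!muf aE linear0 muB xy subrr.
  by rewrite mu0.
have [d dE] := Ds (tensC_map C g \o h); have [b bd] := gs d.
have [c|k kE] := @linear_factor_inj _ _ _ _ (tensC_map C f) (h - mu C b) ti.
  apply/tE; rewrite -[tensC_map C g _]/(tensC_map C g (h c - mu C b c)) linearB -mug bd dE.
  by rewrite subrr.
have [a aE] := As k; exists (b + f a); apply: linear_ext => c.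
rewrite muD -[LHS]/(mu C b c + mu C (f a) c) muf aE kE.
by rewrite -[(h - _) c]/(h c - mu C b c) addrC subrK.
Qed.

Hypothesis Cb1 : bijective (homothetyR C).
Hypothesis Cc2 : forall i, (1 <= i)%N -> is_trivial (Ext S^c i (bim_right C) (bim_right C)).

(** Under the isomorphism R (x) C = C the map [mu] becomes the homothety map, and the Ext condition
    becomes the vanishing of Ext of [C] by itself over S. *)
Lemma auslander_regular : auslander_class C R^c^o.
Proof.
have bal : balanced (fun (r : R^c^o) (c : C) => (r : R) *: c).
  split=> [r r' c|r c c'|t r c]; [exact: scalerDl|exact: scalerDr|].
  by rewrite scalerA.
pose w := tensor_lift bal.
have wl : linear (w : tensC C R^c^o -> bim_right C).
  move=> s x y; rewrite [LHS](raddfD w); congr (_ + _).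
  pose m : {additive tensor R^c^o C -> tensor R^c^o C} :=
    tensor_map (idfun : {linear R^c^o -> R^c^o}) (homothetyS C s).
  have sa : zmod_morphism (fun c : C => bim_act c s).
    by move=> c d; exact: (linearB (homothetyS C s)).
  suff e : w \o m =1 mkadd sa \o w by have := e x.
  apply: tensor_ext => r c; rewrite /m /w /= tensor_map_tens !tensor_lift_tens /=.
  by rewrite /rmul bim_actZ.
have wE r (c : C) : w (tens r c) = (r : R) *: c by rewrite /w tensor_lift_tens.
have wb : bijective (mklin wl).
  exists (fun c : bim_right C => tens (1 : R^c^o) (c : C) : tensC C R^c^o) => [x|c].
    have a : zmod_morphism (fun y : tensC C R^c^o => tens (1 : R^c^o) (w y) : tensC C R^c^o).
      move=> y z; rewrite [X in tens _ X](raddfB w); apply/eqP.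
      by rewrite eq_sym subr_eq -tensDr subrK.
    apply: (@tensC_hom_ext _ _ _ _ _ (mkadd a) idfun) => r c /=.
    by rewrite wE -tensZ; congr tens; exact: (mulr1 (r : R^c)).
  by rewrite /= wE scale1r.
apply/auslanderP; split.
- exact/ext_balance/ext_zero_projective/regular_projective.
- exact/(ext_zero_iso _ wb)/Ext_zeroP.
apply/(bijective_compl (postcomp_bij _ wb) (h := homothetyR C)) => // r.
by apply: linear_ext => c; rewrite /= wE.
Qed.
End MoreClosure.

(** * Purity *)

(** The elementwise form of purity: it is a closure condition, so pure submodules can be generated
    by adjoining solutions of finite linear systems. *)
Definition pure (T : pzRingType) (B : lmodType T) (P : B -> Prop) : Prop :=
  forall m n (r : 'I_m -> 'I_n -> T) (b : 'I_n -> B),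
  (forall k, P (\sum_(j < n) r k j *: b j)) ->
  exists b', (forall j, P (b' j)) /\
    forall k, \sum_(j < n) r k j *: b' j = \sum_(j < n) r k j *: b j.

Lemma pure_seq (T : pzRingType) (B : lmodType T) (P : B -> Prop) (K J : Type)
    (s : seq K) (t : seq J) (r : K -> J -> T) (b : J -> B) : pure P ->
  (forall i : 'I_(size s), P (\sum_(j <- t) r (tnth (in_tuple s) i) j *: b j)) ->
  exists b' : 'I_(size t) -> B, (forall j, P (b' j)) /\ forall i : 'I_(size s),
    \sum_(j < size t) r (tnth (in_tuple s) i) (tnth (in_tuple t) j) *: b' j =
    \sum_(j <- t) r (tnth (in_tuple s) i) j *: b j.
Proof.
move=> Pp h.
have [|b' [Pb' b'E]] := Pp _ _ (fun i j => r (tnth (in_tuple s) i) (tnth (in_tuple t) j))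
    (b \o tnth (in_tuple t)).
  by move=> i; rewrite /= -(big_tnth _ _ t xpredT (fun j => r _ j *: b j)).
exists b'; split=> // i; rewrite b'E.
by rewrite [RHS]big_tnth.
Qed.

Fact int_linear (U V : lmodType int) (f : {additive U -> V}) : linear f.
Proof.
move=> a x y; rewrite raddfD -[a in LHS]intz scaler_int raddfMz.
by rewrite -[a in RHS]intz scaler_int.
Qed.
Definition zlin (U V : zmodType) (f : {additive U -> V}) : {linear zmodule U -> zmodule V} :=
  mklin (@int_linear (zmodule U) (zmodule V) f).
Definition zlin_to (U : zmodType) (V : lmodType int) (f : {additive U -> V}) :
  {linear zmodule U -> V} := mklin (@int_linear (zmodule U) V f).

Section PureExtension.
Variables (T : pzRingType) (B : lmodType T) (P : submod B) (Pp : pure P).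
Local Notation A := (submod_type P).
Local Notation D := (char A).

(** [A^(D)], [B^(D)] and [T^(D)] as abelian groups *)
Local Notation sumD V := (dsum_mod (fun _ : D => zmodule V : lmodType int)).

Fact act_additive (X : lmodType T) (x : X) : zmod_morphism (fun t : T => t *: x).
Proof. by move=> t u; rewrite scalerBl. Qed.
Definition sumD_act (X : lmodType T) (x : X) : {linear sumD T -> sumD X} :=
  dsum_lift (fun d => dsum_inj d \o zlin (mkadd (act_additive x))).

Lemma sumD_actE (X : lmodType T) (x : X) l d :
  dsum_proj d (sumD_act x l) = (dsum_proj d l : T) *: x.
Proof.
suff e : dsum_proj d \o sumD_act x =1 zlin (mkadd (act_additive x)) \o dsum_proj d by exact: e.
apply: dsum_hom_ext => i y; rewrite /= /sumD_act dsum_lift_inj /=.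
have [->|id] := pselect (i = d); first by rewrite !dsum_injK.
by rewrite !dsum_inj0//= scale0r.
Qed.

Definition sumD_eval : {linear sumD A -> zmodule QmodZ} := dsum_lift (fun d : D => zlin d).
Definition sumD_incl : {linear sumD A -> sumD B} :=
  dsum_lift (fun d : D => dsum_inj d \o zlin (sincl P)).

Lemma sumD_inclE a d : dsum_proj d (sumD_incl a) = sincl P (dsum_proj d a : A).
Proof.
suff e : dsum_proj d \o sumD_incl =1 zlin (sincl P) \o dsum_proj d by exact: e.
apply: dsum_hom_ext => i y; rewrite /= /sumD_incl dsum_lift_inj /=.
have [->|id] := pselect (i = d); first by rewrite !dsum_injK.
by rewrite !dsum_inj0//= linear0.
Qed.

(** the relations of the right module [A^+] on its elements *)
Definition relD : Type := {l : sumD T | forall a : A, sumD_eval (sumD_act a l) = 0}.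

Fact relD_additive (l : relD) : zmod_morphism (fun b : B => sumD_act b (projT1 l)).
Proof.
move=> x y; apply: dsum_ext => d; rewrite linearB !sumD_actE.
by rewrite scalerBr.
Qed.
Definition relD_sum : {linear dsum_mod (fun _ : relD => zmodule B : lmodType int) -> sumD B} :=
  dsum_lift (fun l => zlin_to (mkadd (relD_additive l))).

(** The cokernel of [relD_sum] is A^+ (x) B, so this is what lets the evaluation pairing on A^+ (x)
    A extend to A^+ (x) B. Purity moves the coefficients of the relations from [B] into [A], where
    evaluation kills them. *)
Lemma pure_relation (a : sumD A) y : sumD_incl a + relD_sum y = 0 -> sumD_eval a = 0.
Proof.
move=> ay0.
have [s [us sE]] := finite_uniq_seq (dsum_support y).
have yE := dsum_decomp us (fun l => (sE l).1).
(* Finitely many relations and finitely many coordinates are involved, so the hypothesis is a finite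
   linear system over [B] with constants in [A]. *)
have [t [ut tE]] : exists t : seq {classic D}, uniq t /\ forall d,
    ~ (d : {classic D}) \in t ->
    dsum_proj d a = 0 /\ forall l, l \in s -> dsum_proj d (projT1 (l : relD)) = 0.
  have fA : finite_set ([set d | dsum_proj d a <> 0] `|`
      \bigcup_(l in [set l | l \in s]) [set d | dsum_proj d (projT1 (l : relD)) <> 0]).
    rewrite finite_setU; split; first exact: dsum_support.
    by apply: bigcup_finite => // l _; exact: dsum_support.
  have [t [ut tE]] := finite_uniq_seq fA; exists t; split=> // d dt; split.
    by apply: contrapT => ad; apply: dt; apply/tE; left.
  by move=> l ls; apply: contrapT => ld; apply: dt; apply/tE; right; exists l.
have sumE d : sincl P (dsum_proj d a : A) +
    \sum_(l <- s) (dsum_proj d (projT1 (l : relD)) : T) *: (dsum_proj l y : B) = 0.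
  have := congr1 (dsum_proj d) ay0; rewrite linearD sumD_inclE linear0 => h; rewrite -[RHS]h.
  congr (_ + _); rewrite [in RHS]yE linear_sum [RHS]linear_sum; apply: eq_bigr => l _.
  by rewrite /relD_sum dsum_lift_inj /= sumD_actE.
have [|b [Pb bE]] := @pure_seq _ _ _ _ _ t s (fun d l => dsum_proj d (projT1 (l : relD)))
    (fun l => dsum_proj l y) Pp.
  move=> i; have /eqP := sumE (tnth (in_tuple t) i).
  rewrite addrC addr_eq0 => /eqP ->; rewrite -linearN; exact: sinclP.
have /cid2[b' _ b'E] : exists2 b' : 'I_(size s) -> A, True & forall j, sincl P (b' j) = b j.
  have /choice[b' b'E] : forall j, exists x, sincl P x = b j by move=> j; exact: sincl_surj.
  by exists b'.
pose a' : sumD A := \sum_(j < size s) sumD_act (b' j) (projT1 (tnth (in_tuple s) j : relD)).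
suff -> : a = - a'.
  rewrite linearN linear_sum big1 ?oppr0// => j _.
  by have := projT2 (tnth (in_tuple s) j : relD); exact.
apply: dsum_ext => d; rewrite linearN linear_sum.
have [dt|/tE[-> l0]] := pselect ((d : {classic D}) \in t); last first.
  rewrite big1 ?oppr0// => j _; rewrite sumD_actE l0 ?scale0r//.
  exact: mem_tnth.
apply: (@sincl_inj _ _ P); rewrite linearN linear_sum.
have /tnthP[i di] : (d : {classic D}) \in in_tuple t by [].
apply/eqP; rewrite -addr_eq0; apply/eqP; rewrite -[RHS](sumE d); congr (_ + _).
rewrite di -bE; apply: eq_bigr => j _; rewrite -di sumD_actE linearZZ b'E.
by [].
Qed.

(** A map from [B] to A^{++} is a character of A^+ (x) B. By [pure_relation] the evaluation pairing
    is a well-defined partial character, which extends as Q/Z is injective. *)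
Lemma pure_eta_extend : exists e : {linear B -> ddual A}, forall a, e (sincl P a) = ddual_ev A a.
Proof.
have [||g gE] := @char_of_functional (sumD B)
    [set x | exists a y, x = (sumD_incl a + relD_sum y, sumD_eval a)].
- split=> [|_ _ [a [y ->]] [b [z ->]]]; first by exists 0, 0; rewrite !linear0 addr0.
  exists (a - b), (y - z); rewrite !linearB; congr (_, _) => /=.
  by rewrite opprD addrACA.
- move=> p [a [y pE]]; have /= -> := congr1 snd pE.
  exact: pure_relation (esym (congr1 fst pE)).
have gincl a : g (sumD_incl a) = sumD_eval a.
  by apply: gE; exists a, 0; rewrite linear0 addr0.
have grel (l : sumD T) (b : B) : (forall a : A, sumD_eval (sumD_act a l) = 0) ->
    g (sumD_act b l) = 0.
  move=> l0; apply: gE; exists 0, (dsum_inj (exist _ l l0 : relD) (b : zmodule B)).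
  by rewrite !linear0 add0r /relD_sum dsum_lift_inj.
have actE (X : lmodType T) (x : X) d t :
    sumD_act x (dsum_inj d (t : zmodule T)) = dsum_inj d (t *: x : zmodule X).
  by rewrite /sumD_act dsum_lift_inj.
have evalE d (a : A) : sumD_eval (dsum_inj d (a : zmodule A)) = d a.
  by rewrite /sumD_eval dsum_lift_inj.
(* Additivity and linearity hold because the required identities come from elements of [relD]: here
   a combination of the generators at [d - d'], [d] and [d'], and for scalars one of those at [d]
   and at its scaled character. *)
have ea (b : B) : zmod_morphism (fun d : D => g (dsum_inj d (b : zmodule B))).
  move=> d d'; apply/eqP; rewrite -subr_eq0 -!raddfB -[b]scale1r -!actE.
  rewrite -!linearB; apply/eqP/grel => a; rewrite !linearB !actE !evalE !scale1r.
  by rewrite -[LHS]/((d a - d' a) + (- d a - - d' a)) opprK addrACA subrr addNr addr0.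
have el : linear (fun b : B => mkadd (ea b) : ddual A).
  move=> t x y; apply: additive_ext => d /=.
  rewrite (linearD (dsum_inj d) (t *: x : zmodule B) (y : zmodule B)) raddfD; congr (_ + _).
  apply/eqP; rewrite -subr_eq0 -raddfB -[X in dsum_inj (cscale _ _ _) X]scale1r -!actE -linearB.
  apply/eqP/grel => a; rewrite !linearB !actE !evalE cscaleE scale1r.
  by rewrite subrr.
exists (mklin el) => a; apply: additive_ext => d; rewrite ddual_evE /=.
rewrite -evalE -gincl; congr (g _); apply/esym.
by rewrite /sumD_incl dsum_lift_inj.
Qed.
End PureExtension.

(** * Purity and duality *)

Section ModuleClass.
Variables (T : pzRingType) (X : lmodType T -> Prop).

Definition retract_closed : Prop := forall (N N' : lmodType T)
  (s : {linear N -> N'}) (r : {linear N' -> N}), (forall x, r (s x) = x) -> X N' -> X N.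
Definition pure_sub_closed : Prop := forall (B : lmodType T) (P : submod B),
  pure P -> X B -> X (submod_type P).
Definition pure_quo_closed : Prop := forall (B : lmodType T) (P : submod B),
  pure P -> X B -> X (quo_type P).

Lemma retract_iso (A B : lmodType T) (f : {linear A -> B}) :
  retract_closed -> bijective f -> X B -> X A.
Proof. by move=> rc /linear_inverse[g [fK gK]]; exact: rc fK. Qed.

Lemma retract_summand : retract_closed -> summand_closed X.
Proof.
move=> rc M N Y f /linear_inverse[g [fK gK]].
have sl : linear (fun x : M => f (x, 0)).
  move=> a x y; rewrite -linearP; congr (f _).
  by rewrite -[RHS]/(_ *: _ + _, _ *: _ + _) scaler0 addr0.
have rl : linear (fun y : Y => (g y).1) by move=> a x y; rewrite linearP.
by apply: (rc _ _ (mklin sl) (mklin rl)) => x; rewrite /= fK.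
Qed.

Definition pure_emb (A Z : lmodType T) (i : {linear A -> Z}) : Prop :=
  injective i /\ forall m n (r : 'I_m -> 'I_n -> T) (a : 'I_m -> A) (b : 'I_n -> Z),
    (forall k, \sum_(j < n) r k j *: b j = i (a k)) ->
    exists a' : 'I_n -> A, forall k, \sum_(j < n) r k j *: a' j = a k.

Lemma pure_range (A Z : lmodType T) (i : {linear A -> Z}) :
  pure_emb i -> pure (range_submod i).
Proof.
move=> [ii ip] m n r b /choice[a aE].
have [|a' a'E] := ip m n r a b; first by move=> k; rewrite aE.
exists (i \o a'); split=> [j|k]; first by exists (a' j).
rewrite -aE -a'E linear_sum; apply: eq_bigr => j _; by rewrite linearZZ.
Qed.

Lemma corange_bij (A Z : lmodType T) (i : {linear A -> Z}) : injective i ->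
  exists f : {linear A -> submod_type (range_submod i)}, bijective f.
Proof.
move=> ii; have [|x|f fE] := @linear_factor_inj _ _ _ _ (sincl (range_submod i)) i.
- exact: sincl_inj.
- by apply: sincl_surj; exists x.
exists f; apply/bij_inj_surj; split=> [x y xy|y].
  by apply: ii; rewrite -!fE xy.
by have [x xy] := sinclP y; exists x; apply: sincl_inj; rewrite fE.
Qed.

Lemma pure_emb_closed (A Z : lmodType T) (i : {linear A -> Z}) :
  retract_closed -> pure_sub_closed -> pure_emb i -> X Z -> X A.
Proof.
move=> rc pc ip XZ; have [f fb] := corange_bij ip.1.
exact: retract_iso rc fb (pc _ _ (pure_range ip) XZ).
Qed.
End ModuleClass.

(** If the system had no solution in [N], a character [chi] of N^m would separate [a] from the
    solvable right-hand sides. Evaluating the solution [b] at the components of [chi] shows [chi a]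
    = 0. *)
Lemma pure_emb_ddual (T : pzRingType) (N : lmodType T) : pure_emb (ddual_ev N).
Proof.
split=> [|m n r a b bE].
  apply: linear_inj => x x0; apply: char_eq => chi.
  by rewrite -ddual_evE x0 raddf0.
apply: contrapT => nsol.
pose V : zmodType := dprod_mod (fun _ : 'I_m => N).
pose sys (c : 'I_n -> N) : V := fun k => \sum_(j < n) r k j *: c j.
have sysB : is_subgroup [set v : V | exists c, v = sys c].
  split=> [|_ _ [c ->] [d ->]].
    by exists (fun=> 0); apply/functional_extensionality_dep => k; rewrite /sys big1// => j _;
        rewrite scaler0.
  exists (fun j => c j - d j); apply/functional_extensionality_dep => k.
  rewrite /sys -[LHS]/(_ - _) -sumrB; apply: eq_bigr => j _.
  by rewrite scalerBr.
have [|chi [chi0 []]] := char_sep (v := a : V) sysB.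
  by move=> [c cE]; apply: nsol; exists c => k; rewrite cE.
pose ins k (x : N) : V := fun l => if l == k then x else 0.
have insB k : zmod_morphism (ins k).
  move=> x y; apply/functional_extensionality_dep => l.
  by rewrite -[RHS]/(ins k x l - ins k y l) /ins; case: eqP; rewrite ?subrr.
have insE (v : V) : v = \sum_(k < m) ins k (v k).
  apply/functional_extensionality_dep => l.
  have -> : (\sum_(k < m) ins k (v k)) l = \sum_(k < m) ins k (v k) l.
    by elim/big_rec2: _ => // k x y _ <-.
  rewrite (bigD1 l)//= big1 ?addr0 /ins ?eqxx// => k /negPf kl.
  by rewrite eq_sym kl.
have chiE (v : V) : chi v = \sum_(k < m) chi (ins k (v k)).
  by rewrite -raddf_sum -insE.
pose chik k : char N := chi \o mkadd (insB k).
rewrite (chiE a).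
transitivity (\sum_(k < m) (ddual_ev N (a k) : char (char N)) (chik k)); first by [].
have sumE (w : 'I_n -> ddual N) phi : ((\sum_(j < n) w j : ddual N) : char (char N)) phi =
    \sum_(j < n) (w j : char (char N)) phi.
  by elim/big_rec2: _ => // i x y _ <-.
transitivity (\sum_(k < m) \sum_(j < n) ((r k j *: b j : ddual N) : char (char N)) (chik k)).
  by apply: eq_bigr => k _; rewrite -sumE bE.
rewrite exchange_big big1//= => j _.
transitivity ((b j : char (char N)) (\sum_(k < m) cscale N (r k j) (chik k))).
  by rewrite raddf_sum.
suff -> : \sum_(k < m) cscale N (r k j) (chik k) = 0 by rewrite raddf0.
apply: additive_ext => x.
have -> : (\sum_(k < m) cscale N (r k j) (chik k)) x = \sum_(k < m) cscale N (r k j) (chik k) x.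
  by elim/big_rec2: _ => // i u v _ <-.
rewrite -[RHS](chi0 (sys (fun l => if l == j then x else 0))); last by eexists.
rewrite [RHS]chiE; apply: eq_bigr => k _.
rewrite cscaleE /chik /=; congr (chi (ins k _)).
rewrite /sys (bigD1 j)//= eqxx big1 ?addr0// => l /negPf ->.
by rewrite scaler0.
Qed.

Section PureDual.
Variables (R S : pzRingType) (C : bimodule R S).

Section Left.
Variables (B : lmodType R) (P : submod B) (Pp : pure P).
Local Notation A := (submod_type P).
(** The section is the transpose of the map from [B] to A^{++} of [pure_eta_extend]. *)
Lemma pure_ldual_split : exists s : {linear lchar A -> lchar B},
  forall chi, ldual (sincl P) (s chi) = chi.
Proof.
have [e eE] := pure_eta_extend Pp.
have sa (chi : lchar A) : zmod_morphism (fun b => (e b : char (char A)) chi).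
  by move=> x y; rewrite linearB.
have sl : linear (fun chi => mkadd (sa chi) : lchar B).
  move=> t x y; apply: additive_ext => b; rewrite /= raddfD; congr (_ + _).
  by rewrite linearZZ; congr ((e b : char (char A)) _); apply: additive_ext.
exists (mklin sl) => chi; apply: additive_ext => a.
by rewrite ldualE /= eE.
Qed.
Lemma pure_ldual_quo : exists r : {linear lchar B -> lchar (quo_type P)},
  forall chi, r (ldual (sproj P) chi) = chi.
Proof.
have [s sE] := pure_ldual_split.
have pe : short_exact (sincl P) (sproj P).
  split; [exact: sincl_inj| |exact: sproj_surj] => x; rewrite sproj_eq0.
  by split=> [/sincl_surj//|[y <-]]; exact: sinclP.
have [ii ie _] := short_exact_ldual pe.
have [chi|r rE] := @linear_factor_inj _ _ _ _ (ldual (sproj P))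
    (idfun - (s \o ldual (sincl P) : {linear _ -> _}) : {linear lchar B -> lchar B}) ii.
  apply/ie; rewrite -[ldual _ _]/(ldual (sincl P) (chi - s (ldual (sincl P) chi))).
  by rewrite linearB sE subrr.
exists r => chi; apply: ii; rewrite rE.
rewrite -[LHS]/(ldual (sproj P) chi - s (ldual (sincl P) (ldual (sproj P) chi))).
have -> : ldual (sincl P) (ldual (sproj P) chi) = 0 by apply/ie; exists chi.
by rewrite linear0 subr0.
Qed.
End Left.

Section Right.
Variables (B : lmodType R^c) (P : submod B) (Pp : pure P).
Local Notation A := (submod_type P).
Lemma pure_rdual_split : exists s : {linear rchar A -> rchar B},
  forall chi, rdual (sincl P) (s chi) = chi.
Proof.
have [e eE] := pure_eta_extend Pp.
have sa (chi : rchar A) : zmod_morphism (fun b => (e b : char (char A)) chi).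
  by move=> x y; rewrite linearB.
have sl : linear (fun chi => mkadd (sa chi) : rchar B).
  move=> t x y; apply: additive_ext => b; rewrite /= raddfD; congr (_ + _).
  by rewrite linearZZ; congr ((e b : char (char A)) _); apply: additive_ext.
exists (mklin sl) => chi; apply: additive_ext => a.
by rewrite rdualE /= eE.
Qed.
Lemma pure_rdual_quo : exists r : {linear rchar B -> rchar (quo_type P)},
  forall chi, r (rdual (sproj P) chi) = chi.
Proof.
have [s sE] := pure_rdual_split.
have pe : short_exact (sincl P) (sproj P).
  split; [exact: sincl_inj| |exact: sproj_surj] => x; rewrite sproj_eq0.
  by split=> [/sincl_surj//|[y <-]]; exact: sinclP.
have [ii ie _] := short_exact_rdual pe.
have [chi|r rE] := @linear_factor_inj _ _ _ _ (rdual (sproj P))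
    (idfun - (s \o rdual (sincl P) : {linear _ -> _}) : {linear rchar B -> rchar B}) ii.
  apply/ie; rewrite -[rdual _ _]/(rdual (sincl P) (chi - s (rdual (sincl P) chi))).
  by rewrite linearB sE subrr.
exists r => chi; apply: ii; rewrite rE.
rewrite -[LHS]/(rdual (sproj P) chi - s (rdual (sincl P) (rdual (sproj P) chi))).
have -> : rdual (sincl P) (rdual (sproj P) chi) = 0 by apply/ie; exists chi.
by rewrite linear0 subr0.
Qed.
End Right.

Hypothesis Ca1 : has_fg_projective_resolution (C : lmodType R).
Hypothesis Ca2 : has_fg_projective_resolution (bim_right C : lmodType S^c).

Lemma bass_pure_sub : pure_sub_closed (bass_class C).
Proof.
move=> B P Pp /(bass_lchar B Ca1) XB; apply/(bass_lchar _ Ca1).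
have [s sE] := pure_ldual_split Pp; exact: auslander_retract sE XB.
Qed.
Lemma bass_pure_quo : pure_quo_closed (bass_class C).
Proof.
move=> B P Pp /(bass_lchar B Ca1) XB; apply/(bass_lchar _ Ca1).
have [s sE] := pure_ldual_quo Pp; exact: auslander_retract sE XB.
Qed.
Lemma auslander_pure_sub : pure_sub_closed (auslander_class C).
Proof.
move=> B P Pp /(auslander_rchar B Ca2) XB; apply/(auslander_rchar _ Ca2).
have [s sE] := pure_rdual_split Pp; exact: bass_retract sE XB.
Qed.
Lemma auslander_pure_quo : pure_quo_closed (auslander_class C).
Proof.
move=> B P Pp /(auslander_rchar B Ca2) XB; apply/(auslander_rchar _ Ca2).
have [s sE] := pure_rdual_quo Pp; exact: bass_retract sE XB.
Qed.
End PureDual.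

(** * Closure under products *)

Lemma pure_emb_dprod (T : pzRingType) (I : Type) (N W : I -> lmodType T) (Z : lmodType T)
    (u : {linear dprod_mod N -> Z}) (q : forall i, {linear Z -> W i})
    (w : forall i, {linear N i -> W i}) :
  (forall i x, q i (u x) = w i (x i)) -> (forall i, pure_emb (w i)) -> pure_emb u.
Proof.
move=> quw wp; split=> [|m n r a b bE].
  move=> x y xy; apply/functional_extensionality_dep => i; apply: (wp i).1.
  by rewrite -!quw xy.
have ex i : exists a' : 'I_n -> N i, forall k, \sum_(j < n) r k j *: a' j = a k i.
  apply: (wp i).2 (fun k => a k i) (q i \o b) _ => k.
  rewrite -quw -bE linear_sum; apply: eq_bigr => j _; by rewrite linearZZ.
exists (fun j i => projT1 (cid (ex i)) j) => k; apply/functional_extensionality_dep => i.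
rewrite -[RHS](projT2 (cid (ex i)) k).
by elim/big_rec2: _ => // j x y _ <-.
Qed.

Section Products.
Variables (R S : pzRingType) (C : bimodule R S).
Hypothesis Ca1 : has_fg_projective_resolution (C : lmodType R).
Hypothesis Ca2 : has_fg_projective_resolution (bim_right C : lmodType S^c).

Fact dprod_proj_linear (T : pzRingType) (I : Type) (N : I -> lmodType T) i :
  linear (fun x : dprod_mod N => x i).
Proof. by []. Qed.
Definition dprod_proj (T : pzRingType) (I : Type) (N : I -> lmodType T) i :
  {linear dprod_mod N -> N i} := mklin (@dprod_proj_linear T I N i).

(** Followed by the projection to N_i^{++}, the map [flipr f] is evaluation at the i-th coordinate,
    a pure embedding. Its target is in the class by duality and the closure of the Bass class under
    coproducts. *)
Lemma auslander_product : product_closed (auslander_class C).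
Proof.
move=> I N NA.
pose f := dsum_lift (fun i => rdual (@dprod_proj _ _ N i)).
apply: (@pure_emb_closed _ _ _ (lchar (dsum_mod (fun i => rchar (N i)))) (flipr f)).
- exact: auslander_retract.
- exact: auslander_pure_sub.
- have inv i : exists g : {linear lchar (rchar (N i)) -> ddual (N i)}, cancel (ddual_lr (N i)) g /\
    cancel g (ddual_lr (N i)).
    exact/linear_inverse/ddual_lr_bij.
  apply: (@pure_emb_dprod _ _ _ _ _ _ (fun i => projT1 (cid (inv i)) \o ldual (dsum_inj i)) (fun i
      => ddual_ev (N i))); last by move=> i; exact: pure_emb_ddual.
  move=> i x; have [h1 h2] := projT2 (cid (inv i)).
  apply: (can_inj h1); rewrite -[X in ddual_lr _ X]/(projT1 (cid (inv i)) (ldual (dsum_inj i)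
      (flipr f x))) h2.
  apply: additive_ext => chi; rewrite ldualE fliprE /f dsum_lift_inj.
  by [].
- apply/(bass_lchar _ Ca1)/(bass_coproduct Ca1) => i.
  exact/(auslander_rchar _ Ca2).
Qed.

Lemma bass_product : product_closed (bass_class C).
Proof.
move=> I M MB.
pose f := dsum_lift (fun i => ldual (@dprod_proj _ _ M i)).
apply: (@pure_emb_closed _ _ _ (rchar (dsum_mod (fun i => lchar (M i)))) (flipl f)).
- exact: bass_retract.
- exact: bass_pure_sub.
- have inv i : exists g : {linear rchar (lchar (M i)) -> ddual (M i)}, cancel (ddual_rl (M i)) g /\
    cancel g (ddual_rl (M i)).
    exact/linear_inverse/ddual_rl_bij.
  apply: (@pure_emb_dprod _ _ _ _ _ _ (fun i => projT1 (cid (inv i)) \o rdual (dsum_inj i)) (fun i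
      => ddual_ev (M i))); last by move=> i; exact: pure_emb_ddual.
  move=> i x; have [h1 h2] := projT2 (cid (inv i)).
  apply: (can_inj h1); rewrite -[X in ddual_rl _ X]/(projT1 (cid (inv i)) (rdual (dsum_inj i)
      (flipl f x))) h2.
  apply: additive_ext => chi; rewrite rdualE fliplE /f dsum_lift_inj.
  by [].
- apply/(auslander_rchar _ Ca2)/(auslander_coproduct Ca2) => i.
  exact/(bass_lchar _ Ca1).
Qed.
End Products.

(** * Preenvelopes and precovers *)

(** Terms built from variables by linear combinations and by choosing solutions
    of finite linear systems: their values form a pure submodule whose size is
    bounded in terms of the ring and of the set of variables. *)
Inductive term (T : Type) (V : Type) : Type :=
| tvar (v : V)
| tzero
| tlin (a : T) (k l : term T V)
| tsol m n (r : 'I_m -> 'I_n -> T) (c : 'I_m -> term T V) (j : 'I_n).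
Arguments tzero {T V}.

Section Hull.
Variables (T : pzRingType) (A : lmodType T) (G : submod A).

(** A linear system in A / G: preenvelopes use G = 0, and [rigid_bounded] a larger G. *)
Definition solves m n (r : 'I_m -> 'I_n -> T) (y : 'I_m -> A) (b : 'I_n -> A) : Prop :=
  forall k, G (\sum_(j < n) r k j *: b j - y k).

Definition solution m n (r : 'I_m -> 'I_n -> T) (y : 'I_m -> A) : 'I_n -> A :=
  if pselect (exists b, solves r y b) is left e then projT1 (cid e) else fun=> 0.

Lemma solutionP m n (r : 'I_m -> 'I_n -> T) y b : solves r y b -> solves r y (solution r y).
Proof.
rewrite /solution => yb; case: pselect => [e|[]]; first exact: projT2 (cid e).
by exists b.
Qed.

Variables (V : Type) (v : V -> A).
Fixpoint teval (k : term T V) : A :=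
  match k with
  | tvar x => v x
  | tzero => 0
  | tlin a k l => a *: teval k + teval l
  | tsol m n r c j => solution r (fun i => teval (c i)) j
  end.

Lemma is_submod_hull : is_submod [set x | exists k, teval k = x].
Proof.
split=> [|a _ _ [k <-] [l <-]]; first by exists tzero.
by exists (tlin a k l).
Qed.
Definition hull : submod A := Submod is_submod_hull.

Lemma hull_var x : hull (v x). Proof. by exists (tvar T x). Qed.

(** Purity of [(hull + G) / G] in [A / G]. *)
Lemma hull_solve m n (r : 'I_m -> 'I_n -> T) (y : 'I_m -> A) b :
  (forall k, hull (y k)) -> solves r y b -> exists b', (forall j, hull (b' j)) /\ solves r y b'.
Proof.
move=> /choice[c cE] yb; exists (solution r y); split; last exact: solutionP yb.
move=> j; exists (tsol r c j) => /=; congr (solution r _ j).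
by apply/funext => i; rewrite cE.
Qed.
End Hull.

Section ZeroSubmod.
Variables (T : pzRingType) (A : lmodType T).
Fact is_submod0 : is_submod [set 0 : A].
Proof. by split=> // a _ _ -> ->; rewrite scaler0 addr0. Qed.
Definition zero_submod : submod A := Submod is_submod0.

Lemma hull_pure (V : Type) (v : V -> A) : pure (hull zero_submod v).
Proof.
move=> m n r b hb.
have [|b' [hb' b'E]] := @hull_solve _ _ zero_submod _ v _ _ r (fun k => \sum_(j < n) r k j *: b j) b hb.
  by move=> k; rewrite /= subrr.
exists b'; split=> // k; apply/eqP; rewrite -subr_eq0; apply/eqP; exact: b'E.
Qed.
End ZeroSubmod.

(** [rigid_quotient] makes every map rigid by passing to a pure quotient; [rigid_bounded] then
    bounds the source of a rigid map in terms of [T] and [Y]. *)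
Definition purely_rigid (T : pzRingType) (A Y : lmodType T) (f : {linear A -> Y}) : Prop :=
  forall P : submod A, pure P -> (forall x, P x -> f x = 0) -> forall x, P x -> x = 0.

(** [ttype L y D s k] is the value at [k] of a family in [A] indexed by [term T unit]
    that satisfies the linear relations [L], lies over [y], and agrees with [s] on [D]. *)
Inductive type_term (T Y : Type) : Type :=
| tt_zero
| tt_lin (a : T) (k l : type_term T Y)
| tt_type (L : T -> term T unit -> term T unit -> term T unit -> Prop)
    (y : term T unit -> Y) (D : term T unit -> Prop)
    (s : term T unit -> type_term T Y) (k : term T unit).
Arguments tt_zero {T Y}.

Section Rigid.
Variables (T : pzRingType) (A Y : lmodType T) (f : {linear A -> Y}).
Local Notation K := (term T unit).

Definition realizes (L : T -> K -> K -> K -> Prop) (y : K -> Y) (D : K -> Prop)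
    (s : K -> A) (e : K -> A) : Prop :=
  [/\ forall a k1 k2 k3, L a k1 k2 k3 -> e k3 = a *: e k1 + e k2,
      forall k, f (e k) = y k & forall k, D k -> e k = s k].

Definition realization L y D s : K -> A :=
  if pselect (exists e, realizes L y D s e) is left ex then projT1 (cid ex) else fun=> 0.

Lemma realizationP L y D s e : realizes L y D s e -> realizes L y D s (realization L y D s).
Proof.
rewrite /realization => h; case: pselect => [ex|[]]; first exact: projT2 (cid ex).
by exists e.
Qed.

Fixpoint tteval (k : type_term T Y) : A :=
  match k with
  | tt_zero => 0
  | tt_lin a k l => a *: tteval k + tteval l
  | tt_type L y D s k => realization L y D (fun l => tteval (s l)) k
  end.

Lemma is_submod_tteval : is_submod [set x | exists k, tteval k = x].
Proof.
split=> [|a _ _ [k <-] [l <-]]; first by exists tt_zero.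
by exists (tt_lin a k l).
Qed.
Let G : submod A := Submod is_submod_tteval.

(** Bican-El Bashir-Enochs: given [a], let [Q] be a small submodule containing [a]
    such that [(Q + G) / G] is pure in [A / G].  A copy [sigma] of [Q] over [Y] and over
    [Q :&: G] is found in [G]; then [(1 - sigma) Q] is pure and contained in [ker f]. *)
Lemma rigid_bounded : purely_rigid f -> surjective tteval.
Proof.
move=> rig a; pose v (_ : unit) := a; pose e0 : K -> A := teval G v.
pose Q := hull G v.
(* Values in [G] are named by terms. Elsewhere [tt_zero] is a dummy, since [D] selects the indices
   with value in [G]. *)
have /choice[s sE] : forall k : K, exists t, G (e0 k) -> tteval t = e0 k.
  by move=> k; have [[t tE]|nG] := pselect (G (e0 k)); [exists t|exists tt_zero].
pose L b k1 k2 k3 := e0 k3 = b *: e0 k1 + e0 k2.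
pose D k := G (e0 k).
(* The family [e0] realizes its own type, hence so does the chosen family [e'], whose values are
   named by terms and so lie in [G]. *)
have : realizes L (fun k => f (e0 k)) D (tteval \o s) e0 by split=> // k /sE.
move/realizationP; set e' := realization _ _ _ _ => -[e'L e'f e'D].
have Ge' k : G (e' k) by exists (tt_type L (fun k => f (e0 k)) D s k).
have /choice[kap kapE] : forall x : submod_type Q, exists k, e0 k = sincl Q x.
  by move=> x; have [k kE] := sinclP x; exists k.
have sl : linear (fun x : submod_type Q => e' (kap x)).
  by move=> b x y; apply: e'L; rewrite /L !kapE linearP.
pose sig : {linear submod_type Q -> A} := mklin sl.
have sigf x : f (sig x) = f (sincl Q x) by rewrite -kapE -e'f.
have sigG x : G (sig x) by exact: Ge'.
have sigD x : G (sincl Q x) -> sig x = sincl Q x.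
  by rewrite -kapE => Gx; rewrite -[LHS]/(e' _) e'D//= sE.
pose d : {linear submod_type Q -> A} := sincl Q - sig.
have dE x : d x = sincl Q x - sig x by [].
have [x xa] : exists x, sincl Q x = a by apply: sincl_surj; exact: (hull_var G v tt).
suff : d x = 0 by rewrite dE xa => /eqP; rewrite subr_eq0 => /eqP ->; exact: sigG.
apply: (rig (range_submod d)) => [m n r b|_ [y <-]|]; last by exists x.
- move=> /choice[q qE].
  have [||b' [/choice[z zE] b'G]] := @hull_solve _ _ G _ v _ _ r (sincl Q \o q) b.
  + by move=> k; exact: sinclP.
  + move=> k; rewrite -qE dE -[(sincl Q \o q) k]/(sincl Q (q k)) addrAC subrr add0r.
    exact: submodN (sigG _).
  have /choice[y yE] : forall j, exists y, sincl Q y = b' j.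
    by move=> j; apply: sincl_surj; exists (z j).
  (* As [d] kills the elements of [Q] that lie in [G], a solution modulo [G] becomes an exact one
     after applying [d]. *)
  have Gz k : d (\sum_(j < n) r k j *: y j - q k) = 0.
    rewrite dE sigD ?subrr// linearB linear_sum.
    have -> : \sum_(j < n) sincl Q (r k j *: y j) = \sum_(j < n) r k j *: b' j.
      by apply: eq_bigr => j _; rewrite linearZZ yE.
    exact: b'G.
  exists (d \o y); split=> [j|k]; first by exists (y j).
  rewrite -qE; move/eqP: (Gz k); rewrite linearB subr_eq0 linear_sum => /eqP <-.
  by apply: eq_bigr => j _; rewrite linearZZ.
- by rewrite dE linearB sigf subrr.
Qed.
End Rigid.

Lemma pure_zero (T : pzRingType) (A : lmodType T) : pure (zero_submod A).
Proof.
move=> m n r b b0; exists (fun=> 0); split=> // k; rewrite (b0 k) big1// => j _.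
by rewrite scaler0.
Qed.

Lemma chain_common (V : Type) (F : set (set V)) m (b : 'I_m -> V) :
  F !=set0 -> total_on F subset -> (forall k, (\bigcup_(X in F) X) (b k)) ->
  exists2 X, F X & forall k, X (b k).
Proof.
move=> [X0 FX0] Ftot; elim: m b => [|m IH] b bU; first by exists X0 => // -[].
have [X FX Xb] := IH (fun k => b (lift ord0 k)) (fun k => bU _).
have [X1 FX1 X1b] := bU ord0.
have [h|h] := Ftot _ _ FX FX1.
  by exists X1 => // k; case: (unliftP ord0 k) => [j ->|->//]; apply/h/Xb.
by exists X => // k; case: (unliftP ord0 k) => [j ->//|->]; apply/h.
Qed.

(** [P] is maximal among the pure submodules inside the kernel of [f]; unions of chains stay pure
    because systems are finite. Pure submodules of A / P pull back to pure submodules of [A]. *)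
Lemma rigid_quotient (T : pzRingType) (A Y : lmodType T) (f : {linear A -> Y}) :
  exists (P : submod A) (g : {linear quo_type P -> Y}),
    [/\ pure P, forall x, g (sproj P x) = f x & purely_rigid g].
Proof.
have [||P0 [[Ps Pp Pf] _ Pmax]] := @Zorn_above _
    (fun P : set A => [/\ is_submod P, pure P & forall x, P x -> f x = 0]) [set 0].
- split; [exact: is_submod0|exact: pure_zero|by move=> _ ->; rewrite linear0].
- move=> F FP F0 Ftot; split.
  + split=> [|a x y [X FX Xx] [X' FX' X'y]].
      by have [X FX] := F0; exists X => //; have [[]] := FP _ FX.
    have [XX'|X'X] := Ftot _ _ FX FX'.
      by exists X' => //; have [[_ h] _ _] := FP _ FX'; apply: h => //; exact: XX'.
    by exists X => //; have [[_ h] _ _] := FP _ FX; apply: h => //; exact: X'X.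
  + move=> m n r b /(chain_common F0 Ftot)[X FX Xb].
    have [_ /(_ _ _ r b Xb)[b' [Xb' b'E]] _] := FP _ FX.
    by exists b'; split=> // j; exists X.
  + by move=> x [X FX Xx]; have [_ _ h] := FP _ FX; exact: h.
pose P := Submod Ps.
have [|x /sproj_eq0/Pf//|g gE] := @linear_factor_surj _ _ _ _ (sproj P) f.
  exact: sproj_surj.
exists P, g; split=> // Q Qp Qg q Qq.
suff QP : [set x | Q (sproj P x)] = P0.
  have [x xq] := sproj_surj q; have Qx : Q (sproj P x) by rewrite xq.
  by rewrite -xq; apply/sproj_eq0; rewrite -[P x]/(P0 x) -QP.
apply: Pmax.
  move=> x Px; have -> : [set x | Q (sproj P x)] x = Q (sproj P x) by [].
  by rewrite (_ : sproj P x = 0); [exact: submod0|apply/sproj_eq0].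
split.
- split=> [|a x y Qx Qy].
    by change (Q (sproj P 0)); rewrite linear0; exact: submod0.
  by change (Q (sproj P (a *: x + y))); rewrite linearP; exact: submodZD.
- move=> m n r b Qb.
  have [|b1 [Qb1 b1E]] := Qp m n r (sproj P \o b).
    move=> k; suff <- : sproj P (\sum_(j < n) r k j *: b j) = \sum_(j < n) r k j *: (sproj P \o b) j.
      exact: Qb.
    by rewrite linear_sum; apply: eq_bigr => j _; rewrite linearZZ.
  have /choice[b2 b2E] : forall j, exists x, sproj P x = b1 j by move=> j; exact: sproj_surj.
  (* The lifts [b2] satisfy the system up to an error in [P], which purity of [P] corrects by some
     [c] inside [P]. *)
  have [|c [Pc cE]] := Pp m n r (fun j => b2 j - b j).
    move=> k; apply/(@sproj_eq0 _ _ P); rewrite linear_sum.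
    transitivity (\sum_(j < n) r k j *: b1 j - \sum_(j < n) r k j *: sproj P (b j)).
      by rewrite -sumrB; apply: eq_bigr => j _; rewrite linearZZ linearB b2E scalerBr.
    by rewrite b1E subrr.
  exists (fun j => b2 j - c j); split=> [j|k].
    have c0 : sproj P (c j) = 0 by apply/sproj_eq0/Pc.
    by change (Q (sproj P (b2 j - c j))); rewrite linearB b2E c0 subr0.
  under eq_bigr do rewrite scalerBr.
  rewrite sumrB cE -sumrB; apply: eq_bigr => j _.
  by rewrite -scalerBr opprB addrCA subrr addr0.
- by move=> x /Qg; rewrite gE.
Qed.

Section Approximations.
Variables (T : pzRingType) (X : lmodType T -> Prop).
Hypothesis Xretract : retract_closed X.

Lemma ker_quo (F A : lmodType T) (h : {linear F -> A}) :
  exists j : {linear quo_type (ker_submod h) -> A},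
    injective j /\ forall x, j (sproj _ x) = h x.
Proof.
have [|x /sproj_eq0//|j jE] := @linear_factor_surj _ _ _ _ (sproj (ker_submod h)) h.
  exact: sproj_surj.
exists j; split=> //; apply: linear_inj => q; have [x <-] := sproj_surj q.
by rewrite jE => h0; apply/sproj_eq0.
Qed.

Lemma emb_of_pure (A Z : lmodType T) (i : {linear A -> Z}) (P : submod Z) :
  injective i -> (forall z, P z <-> exists a, i a = z) -> pure P -> pure_emb i.
Proof.
move=> ii Pi Pp; split=> // m n r a b bE.
have [|b' [Pb' b'E]] := Pp m n r b; first by move=> k; apply/Pi; exists (a k).
have /choice[a' a'E] : forall j, exists a', i a' = b' j by move=> j; apply/Pi.
exists a' => k; apply: ii; rewrite -bE -b'E linear_sum; apply: eq_bigr => j _.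
by rewrite linearZZ a'E.
Qed.

(** Every map from [Y] to [A] factors through the hull of its image, a quotient of [F]. The index
    type [I] lists all quotients of [F] in the class together with a map from [Y], so the product
    over [I] receives every such factorization. *)
Lemma preenveloping_of_pure_sub :
  product_closed X -> pure_sub_closed X -> preenveloping X.
Proof.
move=> Xprod Xsub Y; pose K : choiceType := {classic (term T Y)}.
pose F := free_mod T K.
pose I := {L : submod F & {g : {linear Y -> quo_type L} | X (quo_type L)}}.
pose M (i : I) : lmodType T := quo_type (projT1 i).
pose g (i : I) : {linear Y -> M i} := sval (projT2 i).
have dl : linear (fun y => (fun i => g i y) : dprod_mod M).
  by move=> a x y; apply/functional_extensionality_dep => i; rewrite linearP.
exists (dprod_mod M), (mklin dl); split; first by apply: Xprod => -[L [h XL]].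
move=> A XA f; pose P := hull (zero_submod A) f.
pose h : {linear F -> A} := free_lift (teval (zero_submod A) f : K -> A).
have hP z : P z <-> exists x, h x = z.
  split=> [[k <-]|[x <-]]; first by exists (free_gen T (k : K)); exact: free_lift_gen.
  have fx := coef_finite x.
  rewrite -[h x]/(free_lift _ x) (@free_liftE _ _ _ _ _ x (fun y => id)) fsbig_finite//=.
  elim/big_ind: _ => [|u w Pu Pw|k _]; [exact: (submod0 P)|exact: (@submodD _ _ P _ _ Pu Pw)|].
  by apply: (@submodZ _ _ P); exists k.
have [j [ji jE]] := ker_quo h.
have jP z : P z <-> exists q, j q = z.
  rewrite hP; split=> [[x <-]|[q <-]]; first by exists (sproj _ x); rewrite jE.
  by have [x <-] := sproj_surj q; exists x; rewrite jE.
have XL : X (quo_type (ker_submod h)).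
  have jp : pure_emb j by exact: emb_of_pure ji jP (@hull_pure _ _ _ _).
  exact: (pure_emb_closed Xretract Xsub jp XA).
have [y|e eE] := @linear_factor_inj _ _ _ _ j f ji; first exact/jP/hull_var.
pose i : I := existT _ (ker_submod h) (exist _ e XL).
exists (j \o @dprod_proj _ _ M i) => y.
exact: eE.
Qed.

(** Dual to the preenvelope: the rigid quotient of [A] is the image of the free module on
    [type_term T Y], hence isomorphic to a summand of the coproduct over [I]. *)
Lemma precover_of_pure_quo : coproduct_closed X -> pure_quo_closed X ->
  forall Y : lmodType T, exists (A : lmodType T) (f : {linear A -> Y}), precover X f.
Proof.
move=> Xsum Xquo Y; pose K : choiceType := {classic (type_term T Y)}.
pose F := free_mod T K.
pose I := {L : submod F & {g : {linear quo_type L -> Y} | X (quo_type L)}}.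
pose M (i : I) : lmodType T := quo_type (projT1 i).
pose g (i : I) : {linear M i -> Y} := sval (projT2 i).
exists (dsum_mod M), (dsum_lift g); split; first by apply: Xsum => -[L [h XL]].
move=> A XA f; have [P [f' [Pp f'E rig]]] := rigid_quotient f.
have XAP := Xquo _ _ Pp XA; have surj := rigid_bounded rig.
pose h : {linear F -> quo_type P} := free_lift (tteval f' : K -> quo_type P).
have hs : surjective h.
  move=> x; have [k <-] := surj x; exists (free_gen T (k : K)); exact: free_lift_gen.
have [j [ji jE]] := ker_quo h.
have jb : bijective j.
  apply/bij_inj_surj; split=> // y; have [x <-] := hs y; exists (sproj _ x); exact: jE.
have [j' [jK j'K]] := linear_inverse jb.
pose i : I := existT _ (ker_submod h) (exist _ (f' \o j : {linear _ -> _}) (retract_iso Xretract jb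
    XAP)).
exists (dsum_inj (i : I) \o (j' : {linear quo_type P -> M i}) \o sproj P) => x.
by rewrite /= dsum_lift_inj /g /= j'K f'E.
Qed.
End Approximations.

(** * Covers *)

Section Colimit.
Variables (T : pzRingType) (F : lmodType T) (I : Type) (le : I -> I -> Prop).
Variable kap : I -> I -> {linear F -> F}.
Hypothesis le_refl : forall i, le i i.
Hypothesis le_trans : forall i j l, le i j -> le j l -> le i l.
Hypothesis le_directed : forall i j, exists l, le i l /\ le j l.
Hypothesis kap_comp : forall i j l x, le i j -> le j l -> kap j l (kap i j x) = kap i l x.
Variable i0 : I.

Local Notation Sum := (dsum_mod (fun _ : I => F)).

(** Components at stages not below [j] are sent to 0. Supports being finite, nothing is lost for
    large [j]. *)
Definition col_leg j i : {linear F -> F} := if pselect (le i j) then kap i j else \0.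
Definition col_sum j : {linear Sum -> F} := dsum_lift (col_leg j).

Lemma col_sum_inj i j x : le i j -> col_sum j (dsum_inj i x) = kap i j x.
Proof. by move=> ij; rewrite /col_sum dsum_lift_inj /col_leg; case: pselect. Qed.

Lemma upper_bound n (i : 'I_n -> I) : exists l, forall k, le (i k) l.
Proof.
elim: n i => [|n IH] i; first by exists i0 => -[].
have [l lP] := IH (fun k => i (lift ord0 k)); have [m [lm im]] := le_directed l (i ord0).
exists m => k; case: (unliftP ord0 k) => [j ->|->//].
exact: le_trans (lP j) lm.
Qed.

Lemma col_stable (x : Sum) : exists j, forall l, le j l ->
  forall (V : lmodType T) (h : I -> {linear F -> V}),
  (forall i y, le i l -> h l (kap i l y) = h i y) -> dsum_lift h x = h l (col_sum l x).
Proof.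
have [s [us sE]] := finite_uniq_seq (dsum_support x).
have [j jP] := upper_bound (fun k : 'I_(size s) => tnth (in_tuple s) k : I).
exists j => l jl V h hk.
rewrite (dsum_decomp us (fun i => (sE i).1)) !linear_sum.
apply: eq_big_seq => i si; rewrite dsum_lift_inj.
have /tnthP[k ik] : i \in in_tuple s by [].
have il : le i l by rewrite ik; exact: le_trans (jP k) jl.
by rewrite col_sum_inj// hk.
Qed.

Fact is_submod_col : is_submod [set x | exists j, forall l, le j l -> col_sum l x = 0].
Proof.
split=> [|a x y [j jx] [l ly]]; first by exists i0 => l _; rewrite linear0.
have [m [jm lm]] := le_directed j l; exists m => k mk.
by rewrite linearP jx ?ly ?scaler0 ?addr0//; [exact: le_trans mk|exact: le_trans mk].
Qed.
Definition col_rel : submod Sum := Submod is_submod_col.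

Lemma col_sum_step (x : Sum) : exists j, forall m l, le j m -> le m l ->
  col_sum l x = kap m l (col_sum m x).
Proof.
have legE i l y : le i l -> col_leg l i y = kap i l y by rewrite /col_leg; case: pselect.
have [j jP] := col_stable x; exists j => m l jm ml.
rewrite {1}/col_sum (jP m jm _ (col_leg l)) ?legE// => i y im.
by rewrite !legE ?kap_comp//; exact: le_trans ml.
Qed.

Lemma col_truncate (x : Sum) j :
  (forall m l, le j m -> le m l -> col_sum l x = kap m l (col_sum m x)) ->
  forall l, le j l -> col_rel (x - dsum_inj l (col_sum l x)).
Proof.
move=> jP l jl; exists l => k lk; rewrite linearB col_sum_inj// -jP//.
by rewrite subrr.
Qed.

(** Far enough along, the right-hand sides have zero [col_sum]. Subtracting from each [b j] its
    pushforward to such a stage therefore keeps the sums and moves the solution into [col_rel]. *)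
Lemma col_rel_pure : pure col_rel.
Proof.
move=> m n r b /choice[t tP].
have /choice[u uP] := fun j => col_sum_step (b j).
have [t0 t0P] := upper_bound t; have [u0 u0P] := upper_bound u.
have [l [tl ul]] := le_directed t0 u0.
exists (fun j => b j - dsum_inj l (col_sum l (b j))); split=> [j|k].
  by apply: (col_truncate (uP j)); exact: le_trans (u0P j) ul.
under eq_bigr do rewrite scalerBr -!linearZZ.
rewrite sumrB -(linear_sum (dsum_inj l)) -(linear_sum (col_sum l)) tP; last exact: le_trans (t0P k) tl.
by rewrite linear0 subr0.
Qed.

Lemma directed_colimit : exists (P : submod Sum), pure P /\
  exists gam : I -> {linear F -> quo_type P},
  [/\ forall i j x, le i j -> gam j (kap i j x) = gam i x,
      forall i x, gam i x = 0 -> exists j, le i j /\ kap i j x = 0,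
      forall y, exists i x, gam i x = y
    & forall (V : lmodType T) (h : I -> {linear F -> V}),
        (forall i j x, le i j -> h j (kap i j x) = h i x) ->
        exists g : {linear quo_type P -> V}, forall i x, g (gam i x) = h i x].
Proof.
exists col_rel; split; first exact: col_rel_pure.
pose gam i : {linear F -> quo_type col_rel} := sproj col_rel \o dsum_inj i.
have gamE i x : gam i x = sproj col_rel (dsum_inj i x) by [].
exists gam; split.
- move=> i j x ij; apply/eqP; rewrite !gamE -subr_eq0 -linearB; apply/eqP/sproj_eq0.
  exists j => l jl; rewrite linearB !col_sum_inj//; last exact: le_trans jl.
  by rewrite kap_comp// subrr.
- move=> i x; rewrite gamE => /sproj_eq0[j jP]; have [l [il jl]] := le_directed i j.
  by exists l; split=> //; rewrite -(jP l jl) col_sum_inj.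
- move=> y; have [x <-] := sproj_surj y; have [j jP] := col_sum_step x.
  exists j, (col_sum j x); apply/esym/eqP; rewrite gamE -subr_eq0 -linearB; apply/eqP/sproj_eq0.
  exact: col_truncate jP _ (le_refl j).
- move=> V h hk; have [|x|g gE] := @linear_factor_surj _ _ _ _ (sproj col_rel) (dsum_lift h).
  + exact: sproj_surj.
  + move=> /sproj_eq0[j jP]; have [l lP] := col_stable x; have [k [jk lk]] := le_directed j l.
    by rewrite (lP k lk _ h) ?jP ?linear0// => i y ik; exact: hk.
  + by exists g => i x; rewrite gamE gE dsum_lift_inj.
Qed.
End Colimit.

(** A coherent chain of endomorphisms of [F]: its triples [(i, j, k)] are the nodes
    [i <= j] together with the transition map [k] from [i] to [j]. *)
Section Chains.
Variables (T : pzRingType) (X : lmodType T -> Prop).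
Hypotheses (Xsum : coproduct_closed X) (Xquo : pure_quo_closed X).
Variables (F Y : lmodType T) (f : {linear F -> Y}) (fp : precover X f).
Local Notation E := {linear F -> F}.
Definition is_over (k : E) : Prop := forall x, f (k x) = f x.

Variables (N : Type) (ok : N -> N -> E -> Prop).

Definition eid : E := idfun.
Definition ecomp (k' k : E) : E := k' \o k.

(** [N] labels the stages, and [eid] marks which labels occur. [ok] imposes strictness between
    distinct stages: growing kernels in [stable_kernel], non-surjective transitions in
    [cover_of_precover]. *)
Record chain (R : set (N * N * E)) : Prop := {
  chain_nodes : forall i j k, R (i, j, k) -> R (i, i, eid) /\ R (j, j, eid);
  chain_uniq : forall i j k k', R (i, j, k) -> R (i, j, k') -> k = k';
  chain_total : forall i j, R (i, i, eid) -> R (j, j, eid) ->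
    (exists k, R (i, j, k)) \/ (exists k, R (j, i, k));
  chain_comp : forall i j l k k', R (i, j, k) -> R (j, l, k') -> R (i, l, ecomp k' k);
  chain_ok : forall i j k, R (i, j, k) -> is_over k /\ (i = j \/ ok i j k);
  chain_anti : forall i j k k', R (i, j, k) -> R (j, i, k') -> i = j }.

Lemma chain_max (R0 : set (N * N * E)) : chain R0 ->
  exists R, [/\ chain R, R0 `<=` R & forall R', R `<=` R' -> chain R' -> R' = R].
Proof.
move=> R0c; apply: Zorn_above => // Fam FP F0 Ftot.
have two p q : (\bigcup_(R in Fam) R) p -> (\bigcup_(R in Fam) R) q ->
    exists R, [/\ Fam R, R p & R q].
  move=> [R FR Rp] [R' FR' R'q]; have [RR'|R'R] := Ftot _ _ FR FR'.
    by exists R'; split=> //; apply: RR'.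
  by exists R; split=> //; apply: R'R.
split.
- by move=> i j k [R FR /(chain_nodes (FP _ FR))[]]; split; exists R.
- move=> i j k k' p q; have [R [FR Rp Rq]] := two _ _ p q.
  exact: (chain_uniq (FP _ FR) Rp Rq).
- move=> i j p q; have [R [FR Rp Rq]] := two _ _ p q.
  by have [[k Rk]|[k Rk]] := chain_total (FP _ FR) Rp Rq; [left|right]; exists k; exists R.
- move=> i j l k k' p q; have [R [FR Rp Rq]] := two _ _ p q.
  by exists R => //; exact: (chain_comp (FP _ FR) Rp Rq).
- by move=> i j k [R FR Rp]; exact: (chain_ok (FP _ FR) Rp).
- move=> i j k k' p q; have [R [FR Rp Rq]] := two _ _ p q.
  exact: (chain_anti (FP _ FR) Rp Rq).
Qed.

Definition cocone (R : set (N * N * E)) (c : N -> E) : Prop :=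
  (forall i, is_over (c i)) /\ forall i j k, R (i, j, k) -> forall x, c j (k x) = c i x.

(** The colimit of the chain is a pure quotient of a coproduct of copies of [F], hence in the class,
    and its map to [Y] lifts through the precover [f]. *)
Lemma chain_cocone R : chain R -> exists c, cocone R c.
Proof.
move=> Rc; have [[n0 Rn0]|noR] := pselect (exists n, R (n, n, eid)); last first.
  exists (fun=> eid); split=> // i j k /(chain_nodes Rc)[Ri _].
  by case: noR; exists i.
pose I := {n | R (n, n, eid)}.
pose le (i j : I) := exists k, R (sval i, sval j, k).
pose kap (i j : I) : E := if pselect (le i j) is left e then projT1 (cid e) else \0.
have kapE i j k : R (sval i, sval j, k) -> kap i j = k.
  rewrite /kap => Rk; case: pselect => [e|[]]; last by exists k.
  exact: (chain_uniq Rc (projT2 (cid e)) Rk).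
have kapR i j : le i j -> R (sval i, sval j, kap i j).
  by move=> [k Rk]; rewrite (kapE _ _ _ Rk).
have [|||||P [Pp [gam [gamk _ _ univ]]]] := @directed_colimit _ F I le kap.
- by move=> [i Ri]; exists eid.
- by move=> i j l [k Rk] [k' Rk']; exists (ecomp k' k); exact: (chain_comp Rc Rk Rk').
- move=> [i Ri] [j Rj]; have [[k Rk]|[k Rk]] := chain_total Rc Ri Rj.
    by exists (exist _ j Rj); split; [exists k|exists eid].
  by exists (exist _ i Ri); split; [exists eid|exists k].
- move=> i j l x ij jl; have h := chain_comp Rc (kapR _ _ ij) (kapR _ _ jl).
  by rewrite (kapE _ _ _ h).
- exact: (exist _ n0 Rn0).
have [XF lift] := fp.
have [|g gE] := univ _ (fun=> f).
  by move=> i j x ij; have [ov _] := chain_ok Rc (kapR _ _ ij); exact: ov.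
have [u uE] : exists u : {linear quo_type P -> F}, forall x, f (u x) = g x.
  by apply: lift; apply: Xquo => //; exact: Xsum.
pose c n : E := if pselect (R (n, n, eid)) is left Rn then u \o gam (exist _ n Rn) else eid.
exists c; split=> [n x|i j k Rk x].
  by rewrite /c; case: pselect => // Rn; rewrite /= uE gE.
have [Ri Rj] := chain_nodes Rc Rk.
rewrite /c; case: pselect => // Ri'; case: pselect => // Rj' /=; congr (u _).
rewrite -(gamk (exist _ i Rj') (exist _ j Ri')); last by exists k.
by rewrite (kapE _ _ k).
Qed.

(** A maximal chain admits no new top stage [n] reached from each stage [i] by [b] after [c i]. *)
Lemma chain_extend R c n b : chain R -> cocone R c ->
  (forall R', R `<=` R' -> chain R' -> R' = R) ->
  ~ R (n, n, eid) -> is_over b -> (forall i, R (i, i, eid) -> ok i n (ecomp b (c i))) -> False.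
Proof.
move=> Rc [cov cR] Rmax nn bov bok; apply: (nn).
pose R' : set (N * N * E) := fun t => R t \/
  ((R (t.1.1, t.1.1, eid) /\ t.1.2 = n) /\ t.2 = ecomp b (c t.1.1)) \/ t = (n, n, eid).
suff R'c : chain R' by rewrite -(Rmax R') => // [|t Rt]; [right; right|left].
have Rl i k : ~ R (i, n, k) by move=> /(chain_nodes Rc)[_ /nn].
have Rr i k : ~ R (n, i, k) by move=> /(chain_nodes Rc)[/nn].
have idE (k : E) : ecomp k eid = k by apply: linear_ext.
have idE' (k : E) : ecomp eid k = k by apply: linear_ext.
split.
- move=> i j k [Rk|[[[/= Ri ->] _]|[-> -> _]]].
  + by have [Ri Rj] := chain_nodes Rc Rk; split; left.
  + by split; [left|right; right].
  + by split; right; right.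
- move=> i j k k' [Rk|[[[/= Ri jn] kE]|[iE jE kE]]] [Rk'|[[[/= Ri' jn'] kE']|[iE' jE' kE']]];
    subst=> //;
  try by [case: (nn) | case: (Rl _ _ Rk) | case: (Rl _ _ Rk') | case: (Rr _ _ Rk) | case: (Rr _ _ Rk')].
  exact: (chain_uniq Rc Rk Rk').
- move=> i j [Ri|[[[/= Ri iE] _]|[iE _]]] [Rj|[[[/= Rj jE] _]|[jE _]]]; subst;
  try by case: (nn).
  + by have [[k Rk]|[k Rk]] := chain_total Rc Ri Rj; [left|right]; exists k; left.
  + by left; exists (ecomp b (c i)); right; left.
  + by right; exists (ecomp b (c j)); right; left.
  + by left; exists eid; right; right.
- move=> i j l k k' [Rk|[[[/= Ri jn] kE]|[iE jE kE]]] [Rk'|[[[/= Rj jn'] kE']|[iE' jE' kE']]]; subst;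
  try by [case: (nn) | case: (Rl _ _ Rk) | case: (Rl _ _ Rk') | case: (Rr _ _ Rk) | case: (Rr _ _ Rk')].
  + by left; exact: (chain_comp Rc Rk Rk').
  + right; left; split => /=; first by have [] := chain_nodes Rc Rk.
    by apply: linear_ext => x /=; rewrite (cR _ _ _ Rk).
  + by right; left; rewrite idE'.
  + by right; right; rewrite idE.
- move=> i j k [Rk|[[[/= Ri jn] kE]|[iE jE kE]]]; subst.
  + exact: (chain_ok Rc Rk).
  + by split; [move=> x /=; rewrite bov cov|right; exact: bok].
  + by split; [move=> x|left].
- move=> i j k k' [Rk|[[[/= Ri jn] kE]|[iE jE kE]]] [Rk'|[[[/= Rj jn'] kE']|[iE' jE' kE']]]; subst=> //;
  try by [case: (nn) | case: (Rl _ _ Rk) | case: (Rl _ _ Rk') | case: (Rr _ _ Rk) | case: (Rr _ _ Rk')].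
  exact: (chain_anti Rc Rk Rk').
Qed.
End Chains.

Section Covers.
Variables (T : pzRingType) (X : lmodType T -> Prop).
Hypotheses (Xsum : coproduct_closed X) (Xquo : pure_quo_closed X).

(** Otherwise every endomorphism over [Y] could be followed by one that enlarges its kernel. Along a
    maximal chain of such steps starting at the identity, the cocone gives an endomorphism whose
    enlargement is a new top stage. *)
Lemma stable_kernel (F Y : lmodType T) (f : {linear F -> Y}) : precover X f ->
  exists h : {linear F -> F}, is_over f h /\
    forall b : {linear F -> F}, is_over f b -> forall x, b (h x) = 0 -> h x = 0.
Proof.
move=> fp; apply: contrapT => none.
have bad (h : {linear F -> F}) : is_over f h ->
    exists b, is_over f b /\ exists x, b (h x) = 0 /\ h x <> 0.
  move=> hov; apply: contrapT => nb; apply: none; exists h; split=> // b bov x bh.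
  by apply: contrapT => hx; apply: nb; exists b; split=> //; exists x.
pose ok (h h' k : {linear F -> F}) : Prop :=
  (forall x, k (h x) = h' x) /\ exists x, h' x = 0 /\ h x <> 0.
pose id1 := @eid T F.
have [|R [Rc R0 Rmax]] := @chain_max _ _ _ f _ ok [set (id1, id1, id1)].
  split.
  - by move=> i j k [-> -> _].
  - by move=> i j k k' [_ _ ->] [_ _ ->].
  - by move=> i j [-> _] [-> _]; left; exists id1.
  - move=> i j l k k' [-> _ ->] [_ -> ->]; congr (_, _, _).
    by apply: linear_ext.
  - by move=> i j k [-> -> ->]; split; [move=> x|left].
  - by move=> i j k k' [-> -> _].
have Rid : R (id1, id1, id1) by exact: R0.
have [c [cov cR]] := chain_cocone Xsum Xquo fp Rc.
have nodeP h : R (h, h, id1) -> forall x, c h (h x) = c id1 x.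
  move=> Rh x; have [[k Rk]|[k Rk]] := chain_total Rc Rid Rh.
    rewrite -(cR _ _ _ Rk); have [_ [hE|[kh _]]] := chain_ok Rc Rk.
      by move: Rk; rewrite -hE => Rk; rewrite (chain_uniq Rc Rk Rid).
    by rewrite -kh.
  (* A proper step into the identity is impossible, since it would enlarge a kernel up to 0. *)
  have [_ [hE|[_ [y [y0 hy]]]]] := chain_ok Rc Rk; first by rewrite hE.
  by case: hy; rewrite -[y]/(id1 y) y0 linear0.
have [b [bov [x [bx cx]]]] := bad _ (cov id1).
apply: (@chain_extend _ _ _ f _ ok R c (ecomp b (c id1)) b) => //.
- by move=> /nodeP/(_ x); rewrite /= bx linear0 => /esym.
- move=> h Rh; split=> [y|]; first by rewrite /= nodeP.
  by exists x; split=> // hx; apply: cx; rewrite -(nodeP _ Rh) hx linear0.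
Qed.

(** [G] is the colimit of F -> F -> ... with all transition maps [h]. An element of [G] represented
    by [x] is also represented by [h x] one stage later, where the choice of [h] forbids further
    loss. *)
Lemma injective_precover (F Y : lmodType T) (f : {linear F -> Y}) : precover X f ->
  exists (G : lmodType T) (g : {linear G -> Y}), precover X g /\
    forall k : {linear G -> G}, is_over g k -> injective k.
Proof.
move=> fp; have [XF lift] := fp; have [h [hov hst]] := stable_kernel fp.
pose pw := fix pw n : {linear F -> F} := if n is n'.+1 then h \o pw n' else idfun.
have pwD m n x : pw m (pw n x) = pw (m + n)%N x by elim: m => //= m ->.
have pwov n x : f (pw n x) = f x by elim: n => //= n <-; exact: hov.
have [|||||P [Pp [gam [gamk gam0 gams univ]]]] :=
  @directed_colimit _ F nat (fun m n => (m <= n)%N) (fun m n => pw (n - m)%N).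
- by [].
- by move=> i j l; exact: leq_trans.
- by move=> i j; exists (maxn i j); rewrite leq_maxl leq_maxr.
- by move=> i j l x ij jl; rewrite pwD; congr (pw _ x); rewrite addnBA// subnK.
- exact: 0%N.
have [|g gE] := univ _ (fun=> f); first by move=> i j x _; exact: pwov.
exists (quo_type P), g; split.
  split; first by apply: Xquo => //; exact: Xsum.
  move=> A' XA' k; have [k' k'E] := lift _ XA' k.
  by exists (gam 0%N \o k') => x; rewrite /= gE k'E.
move=> k kov; apply: linear_inj => y ky.
have [u uE] : exists u : {linear quo_type P -> F}, forall x, f (u x) = g x.
  by apply: lift; apply: Xquo => //; exact: Xsum.
have [i [x xy]] := gams y.
have step z : gam i.+1 (h z) = gam i z.
  by rewrite -(gamk i i.+1 z)// subSnn.
have hx : h x = 0.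
  apply: (hst (u \o k \o gam i.+1)) => [z|]; first by rewrite /= uE kov gE.
  by rewrite /= step xy ky linear0.
by rewrite -xy -step hx linear0.
Qed.

Lemma no_powerset_injection (A : Type) (i : set A -> A) : ~ injective i.
Proof.
move=> ii; pose D : set A := [set a | exists S, i S = a /\ ~ S a].
have nD : ~ D (i D) by move=> DD; have [S [/ii SD nS]] := DD; apply: nS; rewrite SD.
by apply: (nD); exists D.
Qed.

(** A non-surjective endomorphism [h] over [Y] extends any chain by a stage with non-surjective
    transitions, so a maximal chain uses every label. *)
Lemma cover_of_precover (F Y : lmodType T) (f : {linear F -> Y}) : precover X f ->
  exists (G : lmodType T) (g : {linear G -> Y}), Defs.cover X g.
Proof.
move=> /injective_precover[G [g [gp ginj]]]; exists G, g; split=> // h gh.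
have hov : is_over g h by move=> x; rewrite -gh.
apply/bij_inj_surj; split; first exact: ginj.
apply: contrapT => hns.
(* The labels are chosen to outnumber the subsets of [G]: distinct stages have distinct ranges of
   [c], contradicting Cantor's theorem. *)
pose N := set (set G); pose ok (i j : N) (k : {linear G -> G}) : Prop := ~ surjective k.
have [|R [Rc _ Rmax]] := @chain_max _ _ _ g N ok set0; first by split.
have [c [cov cR]] := chain_cocone Xsum Xquo gp Rc.
have [[n nn]|full] := pselect (exists n, ~ R (n, n, @eid T G)).
  apply: (chain_extend Rc (conj cov cR) Rmax nn hov) => i _ hc; apply: hns => y.
  by have [x <-] := hc y; exists (c i x).
have node n : R (n, n, @eid T G) by apply: contrapT => nn; apply: full; exists n.
(* As [c j] is injective and [c i] is [c j] after [k], equal ranges would make [k] surjective. *)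
have lt i j k : R (i, j, k) -> range (c i) = range (c j) -> i = j.
  move=> Rk rij; have [_ [//|[]]] := chain_ok Rc Rk => y.
  have : range (c i) (c j y) by rewrite rij; exists y.
  by case=> x _; rewrite -(cR _ _ _ Rk) => /(ginj _ (cov j)) <-; exists x.
apply: (@no_powerset_injection (set G) (fun n => range (c n))) => i j rij.
have [[k Rk]|[k Rk]] := chain_total Rc (node i) (node j); first exact: lt Rk rij.
by apply/esym; exact: lt Rk (esym rij).
Qed.

Lemma covering_of_pure_quo : retract_closed X -> covering X.
Proof.
move=> Xr Y; have [A [f fp]] := precover_of_pure_quo Xr Xsum Xquo Y.
exact: cover_of_precover fp.
Qed.
End Covers.

(** * The two duality pairs and the resulting approximations *)

Section Main.
Variables (R S : pzRingType) (C : bimodule R S) (Cs : semidualizing C).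
Let Ca1 := semidualizing_a1 Cs.
Let Ca2 := semidualizing_a2 Cs.

Lemma auslander_bass_duality : duality_pair (@rchar R) (auslander_class C) (bass_class C).
Proof.
split=> [M||n M MB]; first exact: (auslander_rchar M Ca2).
  by apply: retract_summand; exact: bass_retract.
exact: bass_coproduct Ca1 _ _ MB.
Qed.

Lemma bass_auslander_duality : duality_pair (@lchar R) (bass_class C) (auslander_class C).
Proof.
split=> [M||n M MA]; first exact: (bass_lchar M Ca1).
  by apply: retract_summand; exact: auslander_retract.
exact: auslander_coproduct Ca2 _ _ MA.
Qed.
End Main.

Theorem theorem1p1 (R S : pzRingType) (C : bimodule R S) :
  semidualizing C ->
  let A : lmodType R^c -> Prop := auslander_class C in
  let B : lmodType R -> Prop := bass_class C in
  (((coproduct_closed_duality_pair (@rchar R) A B /\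
     product_closed_duality_pair (@rchar R) A B) /\
    (coproduct_closed_duality_pair (@lchar R) B A /\
     product_closed_duality_pair (@lchar R) B A)) /\
   perfect_duality_pair (@rchar R) A B) /\
  ((covering A /\ preenveloping A) /\ (covering B /\ preenveloping B)).
Proof.
move=> Cs A B.
have Ca1 := semidualizing_a1 Cs; have Ca2 := semidualizing_a2 Cs.
have AB := auslander_bass_duality Cs; have BA := bass_auslander_duality Cs.
have Asum : coproduct_closed A by exact: auslander_coproduct.
have Bsum : coproduct_closed B by exact: bass_coproduct.
have Aprod : product_closed A by exact: auslander_product.
have Bprod : product_closed B by exact: bass_product.
have Ar : retract_closed A := @auslander_retract R S C.
have Br : retract_closed B := @bass_retract R S C.
split.
  split; first by split; split; split.
  split=> //; last exact: auslander_extension.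
  exact: auslander_regular (semidualizing_b1 Cs) (semidualizing_c2 Cs).
split; split.
- by apply: covering_of_pure_quo => //; exact: auslander_pure_quo.
- by apply: preenveloping_of_pure_sub => //; exact: auslander_pure_sub.
- by apply: covering_of_pure_quo => //; exact: bass_pure_quo.
- by apply: preenveloping_of_pure_sub => //; exact: bass_pure_sub.
Qed.
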